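(* For $i\neq j$, define $\mathbf{n}_{ij}$ to be the unit normal vector pointing out of $B_i$ into $B_j$ if $B_i\cap B_j$ is a $(d-1)$-dimensional face, and the zero vector otherwise. Then the matrix representation $A_n\in\mathbb{R}^{n\times n}$ of $\mathcal{A}_n:\Delta_n\to\Delta_n$ with respect to the basis $\chi_{B_1},\ldots,\chi_{B_n}$ under multiplication on the left is $$(A_n)_{ij}=\begin{cases}\displaystyle \frac{1}{m(B_j)}\int_{B_i\cap B_j}\max\{F(x)\cdot \mathbf{n}_{ij},0\}\, dm_{d-1}(x), & i\neq j,\\[2mm] \displaystyle -\sum_{k\neq i} \frac{m(B_k)}{m(B_i)}(A_n)_{ik}, & j=i.\end{cases}$$
   Context: $M\subset\mathbb{R}^d$ is a smooth compact manifold (the domain of the flow, $d$-dimensional), $m$ is the normalized Lebesgue measure on $M$, $F:M\to\mathbb{R}^d$ is a smooth vector field generating a flow $\Phi^t:M\to M$, $t\in\mathbb{R}$, i.e. $\frac{d}{dt}\Phi^t(x)=F(\Phi^t(x))$, $\Phi^0=\mathrm{id}$. The transfer operator $\mathcal{P}^t:L^1(M,m)\to L^1(M,m)$ is $\mathcal{P}^tf(x)=f(\Phi^{-t}x)\,|\det D\Phi^{-t}(x)|$; equivalently $\int_A\mathcal{P}^tf\,dm=\int_{\Phi^{-t}A}f\,dm$ for all measurable $A$. $\{B_1,\ldots,B_n\}$ is a partition (up to null sets, cells sharing only boundaries) of $M$ into $d$-dimensional connected subsets of positive volume with polyhedral faces (typically hyperrectangles or simplices). $\chi_B$ denotes the characteristic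 function of $B$. $\Delta_n=\mathrm{span}\{\chi_{B_1},\ldots,\chi_{B_n}\}$ and $\pi_n:L^1\to\Delta_n$, $\pi_nf=\sum_{i=1}^n\frac{1}{m(B_i)}\int_{B_i}f\,dm\;\chi_{B_i}$. The operator $\mathcal{A}_n:\Delta_n\to\Delta_n$ is $$\mathcal{A}_nf:=\lim_{t\to0}\frac{\pi_n\mathcal{P}^t\pi_nf-\pi_nf}{t}$$ where $t\to 0$ through positive values. ''Matrix representation under multiplication on the left'' means $\mathcal{A}_n\chi_{B_i}=\sum_{j}(A_n)_{ij}\chi_{B_j}$, so that a coefficient row vector $v$ is mapped to $vA_n$. $m_{d-1}$ denotes $(d-1)$-dimensional Lebesgue (surface) measure on faces, normalized by the same constant as $m$.
   Formalization: It is assumed that any two distinct cells meet either in a flat face with one consistent normal direction or in a set of dimension at most d-2; otherwise the single vector n_ij is not defined, and setting it to zero makes the formula false. *)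

(* Defs.v *)
From HB Require Import structures.
From mathcomp Require Import all_boot all_order all_algebra.
From mathcomp Require Import all_classical all_reals all_analysis.
From mathcomp Require Import measurable_realfun.
Import Order.TTheory GRing.Theory Num.Theory.
Import numFieldNormedType.Exports.

Set Implicit Arguments.
Unset Strict Implicit.
Unset Printing Implicit Defensive.

Local Open Scope classical_set_scope.
Local Open Scope ring_scope.

(** * Lebesgue measure on R^n *)

Definition rV_display : measure_display.
Proof. exact: default_measure_display. Qed.

(* The sigma-algebra on row vectors is the one generated by the coordinate
   projections; as R is second countable, this is the Borel sigma-algebra. *)
Section measurable_rV.
Context (R : realType) (n : nat).

Definition rV_coord (i : 'I_n) (x : 'rV[R]_n) : measurableTypeR R := x 0 i.

Let rV_set0 : g_sigma_preimage rV_coord set0.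
Proof. exact: sigma_algebra0. Qed.

Let rV_setC A : g_sigma_preimage rV_coord A ->
  g_sigma_preimage rV_coord (~` A).
Proof. exact: sigma_algebraC. Qed.

Let rV_bigcup (F : (set 'rV[R]_n)^nat) :
  (forall i, g_sigma_preimage rV_coord (F i)) ->
  g_sigma_preimage rV_coord (\bigcup_i (F i)).
Proof. exact: sigma_algebra_bigcup. Qed.

HB.instance Definition _ := @isMeasurable.Build
  rV_display
  'rV[R]_n (g_sigma_preimage rV_coord) rV_set0 rV_setC rV_bigcup.

Lemma measurable_rV_coord (i : 'I_n) : measurable_fun setT (rV_coord i).
Proof.
move=> _ Y mY; rewrite setTI; apply: sub_sigma_algebra => /=.
rewrite -bigcup_seq/=; exists i => /=; first by rewrite mem_index_enum.
by exists Y => //; rewrite setTI.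
Qed.

Lemma measurable_fun_rV d (T : measurableType d) (f : T -> 'rV[R]_n) :
  (forall i, measurable_fun setT (rV_coord i \o f)) -> measurable_fun setT f.
Proof.
move=> mf _ A mA; rewrite setTI.
have : preimage_set_system setT f (g_sigma_preimage rV_coord) (f @^-1` A).
  by exists A => //; rewrite setTI.
rewrite -g_sigma_preimage_comp; apply: smallest_sub.
  exact: sigma_algebra_measurable.
move=> B; rewrite -bigcup_seq/= => -[i _ [C mC <-]].
by apply: mf.
Qed.

End measurable_rV.

Section lebesgue_rV.
Context (R : realType).

Definition rV_cons n (p : measurableTypeR R * 'rV[R]_n) : 'rV[R]_n.+1 :=
  row_mx (p.1 : R)%:M p.2.

Definition rV_uncons n (x : 'rV[R]_n.+1) : measurableTypeR R * 'rV[R]_n :=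
  (x 0 ord0, rsubmx (x : 'rV[R]_(1 + n))).

Lemma rV_consK n : cancel (@rV_cons n) (@rV_uncons n).
Proof.
move=> [x y]; rewrite /rV_cons /rV_uncons row_mxKr; congr (_, _).
transitivity (row_mx (x : R)%:M y 0 (lshift n (ord0 : 'I_1))).
  by congr (row_mx _ _ _ _); apply/val_inj.
by rewrite row_mxEl mxE.
Qed.

Lemma measurable_rV_cons n : measurable_fun setT (@rV_cons n).
Proof.
apply: measurable_fun_rV => i; have [j ->|j ->] := split_ordP (i : 'I_(1 + n)).
  rewrite (_ : _ \o _ = fst); first exact: measurable_fst.
  apply/funext => -[x y]; transitivity ((x : R)%:M 0 j : R).
    exact: (@row_mxEl _ 1 1 n).
  by rewrite mxE [j]ord1.
rewrite (_ : _ \o _ = @rV_coord R n j \o snd).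
  by apply: measurableT_comp; [exact: measurable_rV_coord|].
by apply/funext => -[x y]; exact: (@row_mxEr _ 1 1 n).
Qed.

Lemma measurable_rV_uncons n : measurable_fun setT (@rV_uncons n).
Proof.
apply/measurable_fun_pairP; split; first exact: (measurable_rV_coord ord0).
apply: measurable_fun_rV => i.
rewrite (_ : _ \o _ = @rV_coord R n.+1 (rshift 1 i)).
  exact: measurable_rV_coord.
by apply/funext => x; rewrite /rV_coord /= mxE.
Qed.

HB.instance Definition _ n :=
  isMeasurableFun.Build _ _ _ _ (@rV_cons n) (@measurable_rV_cons n).

Section step.
Variables (n : nat) (mu : {sigma_finite_measure set 'rV[R]_n -> \bar R}).

Definition lebesgue_rV_step : set 'rV[R]_n.+1 -> \bar R :=
  pushforward (@lebesgue_measure R \x mu)%E (@rV_cons n).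

Let step0 : lebesgue_rV_step set0 = 0%E.
Proof. exact: measure0. Qed.

Let step_ge0 A : (0 <= lebesgue_rV_step A)%E.
Proof. exact: measure_ge0. Qed.

Let step_sigma_additive : semi_sigma_additive lebesgue_rV_step.
Proof. exact: measure_semi_sigma_additive. Qed.

HB.instance Definition _ := isMeasure.Build _ _ _ lebesgue_rV_step
  step0 step_ge0 step_sigma_additive.

Let step_sigma_finite : sigma_finite setT lebesgue_rV_step.
Proof.
have /sigma_finiteP[F [TF ndF Foo]] := sigma_finiteT (@lebesgue_measure R).
have /sigma_finiteP[G [TG ndG Goo]] := sigma_finiteT mu.
exists (fun k => @rV_uncons n @^-1` (F k `*` G k)).
  apply/esym; rewrite -subTset => x _.
  have [j _ Fj] : (\bigcup_k F k) (rV_uncons x).1 by rewrite -TF.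
  have [k _ Gk] : (\bigcup_k G k) (rV_uncons x).2 by rewrite -TG.
  exists (maxn j k) => //; split.
    by move: Fj; exact/subsetPset/ndF/leq_maxl.
  by move: Gk; exact/subsetPset/ndG/leq_maxr.
move=> k; have [mF Fk] := Foo k; have [mG Gk] := Goo k; split.
  by rewrite -[X in measurable X]setTI; apply: measurable_rV_uncons => //;
    exact: measurableX.
rewrite /lebesgue_rV_step /pushforward -comp_preimage.
rewrite (_ : _ \o _ = id); last by apply/funext => p; exact: rV_consK.
by rewrite preimage_id product_measure1E// lte_mul_pinfty// ge0_fin_numE.
Qed.

HB.instance Definition _ := Measure_isSigmaFinite.Build _ _ _
  lebesgue_rV_step step_sigma_finite.

End step.

Fixpoint lebesgue_rV n : {sigma_finite_measure set 'rV[R]_n -> \bar R} :=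
  if n is k.+1 then lebesgue_rV_step (lebesgue_rV k) else \d_(0 : 'rV[R]_0).

End lebesgue_rV.

(** * Vector fields and flows *)

(* From here on the ambient space is R^d with d = k.+1. *)

Section euclidean.
Context (R : realType).

Definition dot d (u v : 'rV[R]_d) : R := \sum_(i < d) u 0 i * v 0 i.

(* 'D_v is the directional derivative; the matrix norm of the library is the
   sup norm, which affects neither derivatives nor the topology. *)
Fixpoint iter_derive k (s : seq 'rV[R]_k.+1) (f : 'rV[R]_k.+1 -> 'rV[R]_k.+1) :=
  if s is v :: s' then (fun x => 'D_v (iter_derive s' f) x) else f.

(* C^oo on the open set U: all iterated directional derivatives exist and are
   continuous. *)
Definition smooth_on k (U : set 'rV[R]_k.+1) (f : 'rV[R]_k.+1 -> 'rV[R]_k.+1) :=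
  forall (s : seq 'rV[R]_k.+1) (x : 'rV[R]_k.+1), U x ->
    {for x, continuous (iter_derive s f)} /\
    (forall v, derivable (iter_derive s f) x v).

(* Smoothness on a closed domain: smooth on some open neighbourhood. *)
Definition smooth_near k (M : set 'rV[R]_k.+1)
    (f : 'rV[R]_k.+1 -> 'rV[R]_k.+1) :=
  exists U : set 'rV[R]_k.+1, [/\ open U, M `<=` U & smooth_on U f].

(* Phi is only meaningful on M: its values outside M are irrelevant. *)
Record is_flow k (M : set 'rV[R]_k.+1) (F : 'rV[R]_k.+1 -> 'rV[R]_k.+1)
    (Phi : R -> 'rV[R]_k.+1 -> 'rV[R]_k.+1) : Prop := IsFlow {
  flow_in : forall t x, M x -> M (Phi t x) ;
  flow0 : forall x, M x -> Phi 0 x = x ;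
  flowD : forall s t x, M x -> Phi (s + t) x = Phi s (Phi t x) ;
  flow_ode : forall t x, M x ->
    is_derive t (1 : R) (fun s => Phi s x) (F (Phi t x)) }.

End euclidean.

(** * Normalized volume and surface measures *)

Section measures.
Context (R : realType).

Lemma inv_volume_ge0 d (M : set 'rV[R]_d) :
  0 <= (fine (lebesgue_rV R d M))^-1.
Proof. by rewrite invr_ge0 fine_ge0// measure_ge0. Qed.

Definition inv_volume d (M : set 'rV[R]_d) : {nonneg R} :=
  NngNum (inv_volume_ge0 M).

(* Lebesgue measure scaled so that M has mass 1; it is only ever evaluated on
   subsets of M. *)
Definition normalized_lebesgue d (M : set 'rV[R]_d) : set 'rV[R]_d -> \bar R :=
  mscale (inv_volume M) (lebesgue_rV R d).

HB.instance Definition _ d (M : set 'rV[R]_d) :=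
  Measure.on (@normalized_lebesgue d M).

(* The rows of Q are an orthonormal basis of the hyperplane orthogonal to v. *)
Definition is_frame k (v : 'rV[R]_k.+1) (Q : 'M[R]_(k, k.+1)) :=
  Q *m Q^T = 1%:M /\ Q *m v^T = 0.

Definition frame k (v : 'rV[R]_k.+1) : 'M[R]_(k, k.+1) := xget 0 (is_frame v).

(* Isometric parametrization of the hyperplane through p orthogonal to v. *)
Definition chart k (p v : 'rV[R]_k.+1) (y : 'rV[R]_k) : 'rV[R]_k.+1 :=
  p + y *m frame v.

Lemma measurable_chart k (p v : 'rV[R]_k.+1) : measurable_fun setT (chart p v).
Proof.
apply: measurable_fun_rV => i.
rewrite (_ : _ \o _ = fun y : 'rV[R]_k =>
    p 0 i + \sum_(j < k) rV_coord j y * frame v j i); last first.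
  by apply/funext => y; rewrite /rV_coord/= /chart !mxE.
apply: measurable_funD => //; apply: measurable_sum => j.
by apply: measurable_funM => //; exact: measurable_rV_coord.
Qed.

HB.instance Definition _ k (p v : 'rV[R]_k.+1) :=
  isMeasurableFun.Build _ _ _ _ (chart p v) (@measurable_chart k p v).

(* The (d-1)-dimensional Lebesgue measure on the hyperplane through p
   orthogonal to v. *)
Section hyperplane_lebesgue.
Variables (k : nat) (p v : 'rV[R]_k.+1).

Definition hyperplane_lebesgue : set 'rV[R]_k.+1 -> \bar R :=
  pushforward (lebesgue_rV R k) (chart p v).

Let hyperplane0 : hyperplane_lebesgue set0 = 0%E.
Proof. exact: measure0. Qed.

Let hyperplane_ge0 A : (0 <= hyperplane_lebesgue A)%E.
Proof. exact: measure_ge0. Qed.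

Let hyperplane_sigma_additive : semi_sigma_additive hyperplane_lebesgue.
Proof. exact: measure_semi_sigma_additive. Qed.

HB.instance Definition _ := isMeasure.Build _ _ _ hyperplane_lebesgue
  hyperplane0 hyperplane_ge0 hyperplane_sigma_additive.

End hyperplane_lebesgue.

(* The scaling constant is that of normalized_lebesgue M. *)
Definition normalized_surface k (M : set 'rV[R]_k.+1) (p v : 'rV[R]_k.+1) :
    set 'rV[R]_k.+1 -> \bar R :=
  mscale (inv_volume M) (hyperplane_lebesgue p v).

HB.instance Definition _ k (M : set 'rV[R]_k.+1) (p v : 'rV[R]_k.+1) :=
  Measure.on (@normalized_surface k M p v).

End measures.

(** * Polyhedral partitions *)

Section partitions.
Context (R : realType) (k : nat).
Local Notation V := 'rV[R]_k.+1.

(* A finite union of finite intersections of closed half-spaces. *)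
Definition polyhedral (P : set V) := exists s : seq (seq (V * R)),
  P = [set x | has (fun c => all (fun h => dot h.1 x <= h.2) c) s].

(* E has dimension at most d - 2: it is covered by finitely many affine
   subspaces p + W with dim W <= d - 2. *)
Definition codim2 (E : set V) := exists s : seq (V * 'M[R]_k.+1),
  all (fun pW => ((\rank pW.2).+2 <= k.+1)%N) s /\
  (forall x, E x -> has (fun pW => (x - pW.1 <= pW.2)%MS) s).

Definition relint_face (A B : set V) (v x : V) :=
  (A `&` B) x /\
  \forall y \near nbhs x, dot (y - x) v = 0 -> (A `&` B) y.

(* A `&` B is a (d-1)-dimensional face with unit normal v pointing out of A
   into B: it lies in a hyperplane orthogonal to v and has nonempty relative
   interior there; near each relatively interior point, A has points strictly
   behind that hyperplane and B has points strictly ahead of it. *)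
Definition face_normal (A B : set V) (v : V) :=
  [/\ dot v v = 1,
      forall x y, (A `&` B) x -> (A `&` B) y -> dot (y - x) v = 0,
      exists x, relint_face A B v x &
      forall x, relint_face A B v x ->
        closure (A `&` [set y | dot (y - x) v < 0]) x /\
        closure (B `&` [set y | 0 < dot (y - x) v]) x].

Definition is_face (A B : set V) := exists v, face_normal A B v.

(* Zero when A `&` B is not a face. *)
Definition unit_normal (A B : set V) : V := xget 0 (face_normal A B).

(* Writing the cells as M `&` P, with P polyhedral, makes all faces between
   cells polyhedral while still allowing M to have a curved boundary; if M is
   itself a polyhedron, the cells are arbitrary polyhedra.  No regularity of the
   boundary of M is assumed.  Cells need not be convex; that two cells meet
   either in a common (planar, consistently oriented) face or in a set of
   dimension at most d - 2 is automatic for hyperrectangles and simplices, and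
   is what makes a single normal vector per pair of cells meaningful. *)
Record polyhedral_partition (M : set V) n (B : 'I_n -> set V) : Prop :=
  PolyhedralPartition {
  cell_polyhedral : forall i, exists2 P, polyhedral P & B i = M `&` P ;
  cell_connected : forall i, connected (B i) ;
  cell_regular : forall i, closure (interior (B i)) = B i ;
  cell_volume : forall i, (0 < lebesgue_rV R k.+1 (B i))%E ;
  cell_disjoint : forall i j, i != j ->
    lebesgue_rV R k.+1 (B i `&` B j) = 0%E ;
  cell_cover : lebesgue_rV R k.+1 (M `\` \bigcup_i B i) = 0%E ;
  cell_faces : forall i j, i != j ->
    is_face (B i) (B j) \/ codim2 (B i `&` B j) }.

End partitions.

(** * Transfer operator and discretized generator *)

Section generator.
Context (R : realType) (k : nat).
Local Notation V := 'rV[R]_k.+1.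
Variable M : set V.
Local Notation m := (normalized_lebesgue M).

(* By the change of variables formula this is the same as
   P t f x = f (Phi (- t) x) * |det D(Phi (- t)) x|; it determines P t f up to
   equality almost everywhere and makes sense for a flow defined on M only.
   L^1 classes are represented by integrable functions. *)
Definition is_transfer_operator (Phi : R -> V -> V)
    (P : R -> (V -> R) -> (V -> R)) :=
  forall t f, m.-integrable M (EFin \o f) ->
    m.-integrable M (EFin \o P t f) /\
    (forall A, measurable A -> A `<=` M ->
      \int[m]_(x in A) P t f x = \int[m]_(x in Phi (- t) @` A) f x).

Variables (n : nat) (B : 'I_n -> set V).

(* The element of Delta_n with coefficient row vector v. *)
Definition step_fun (v : 'rV[R]_n) : V -> R :=
  fun x => \sum_(i < n) v 0 i * \1_(B i) x.

Definition Delta : set (V -> R) := range step_fun.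

Definition volume (i : 'I_n) : R := fine (m (B i)).

Definition projection (f : V -> R) : V -> R :=
  fun x => \sum_(i < n) (volume i)^-1 * (\int[m]_(y in B i) f y) * \1_(B i) x.

(* discrete_generator P f g : the value at f of the operator A_n is g, the
   limit being taken in L^1(M, m). *)
Definition discrete_generator (P : R -> (V -> R) -> (V -> R))
    (f g : V -> R) :=
  Delta g /\
  (\int[m]_(x in M)
     `|(projection (P t (projection f)) x - projection f x) / t - g x|%:E)%E
    @[t --> 0^'+] --> 0%E.

Definition left_matrix_representation (P : R -> (V -> R) -> (V -> R))
    (A : 'M[R]_n) :=
  forall v : 'rV[R]_n,
    discrete_generator P (step_fun v) (step_fun (v *m A)).

Variable F : V -> V.

(* The outward flux through the face, with m_{d-1} taken on the hyperplane
   through an arbitrary point of the face. *)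
Definition outflow (i j : 'I_n) : R :=
  let nij := unit_normal (B i) (B j) in
  let p := xget 0 (B i `&` B j) in
  \int[normalized_surface M p nij]_(x in B i `&` B j) Num.max (dot (F x) nij) 0.

Definition rate (i j : 'I_n) : R := (volume j)^-1 * outflow i j.

Definition rate_matrix : 'M[R]_n :=
  \matrix_(i, j) if i != j then rate i j
    else - \sum_(l < n | l != i) volume l / volume i * rate i l.

End generator.

(* Main.v *)
Require Import Defs.
From HB Require Import structures.
From mathcomp Require Import all_boot all_order all_algebra.
From mathcomp Require Import all_classical all_reals all_analysis.
From mathcomp Require Import measurable_realfun.
From mathcomp Require Import zify ring lra.
Import Order.TTheory GRing.Theory Num.Theory.
Import numFieldNormedType.Exports.

Set Implicit Arguments.
Unset Strict Implicit.
Unset Printing Implicit Defensive.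

Local Open Scope classical_set_scope.
Local Open Scope ring_scope.

(** The coefficient of the indicator of cell j in the projection of P^t applied
    to the indicator of cell i is m(S_ij(t)) / m(B_j), where S_ij(t) is the set
    of the points of B_i that are in B_j at time t.  The theorem therefore says
    that, for i different from j, m(S_ij(t)) / t tends to the flux from B_i to
    B_j through their common face; the diagonal entries follow from conservation
    of mass (crossing_total), and convergence in L^1 from convergence of the
    finitely many coefficients (generator_limit).

    To compute the limit of m(S_ij(t)) / t, follow a trajectory from B_i to B_j
    during the time t.  Either it comes near two different bounding hyperplanes,
    and then it starts in a set of measure O(t^2) (two_forms_measure), or it
    meets the intersection of the two cells (polyset_crossing).  When this
    intersection has codimension at least 2, the second case is again O(t^2)
    (codim2_flux).  When it is a face with normal vector v, what happens at the
    meeting point depends on the normal flux F.v there.  If the flux is less than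
    - e, the trajectory started in both cells, which is a null event; if its
    absolute value is less than e, the trajectory started in a slab of thickness
    O(e t) around the face; otherwise the starting point belongs to the tube
    swept out by flowing the part of the face with flux at least e backwards
    during the time t.  Conversely, almost all of this tube consists of points
    that go from B_i to B_j (crossing_upper and crossing_lower).  These
    statements rest on face_orientation: near a generic point of the face
    with nonzero flux, B_i fills the part of M behind the hyperplane and B_j the
    part ahead of it.

    The tube is measured by slicing it with hyperplanes parallel to the face
    (lebesgue_rV_slices, which needs rotation invariance of Lebesgue measure).
    The slice at depth a consists of displaced copies of the points y of the face
    with a <= t F(y).v, up to O(t^2), and the displacement is a bi-Lipschitz
    correspondence with constant 1 + O(t).  A Lipschitz correspondence
    multiplies volumes in dimension d - 1 by at most the (d-1)-st power of its
    constant (lebesgue_rV_lipschitz); integrating over the depth gives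
    t times the integral of F.v, up to a factor 1 + O(t) and an error O(t^2)
    (tube_measure).  Letting first t and then e tend to 0 yields the integral of
    max(F.v, 0) over the face (face_flux_limit).

    All estimates compare the flow with the identity for short times, by means
    of a bound and a Lipschitz constant of F on M (flow_speed, flow_near_id,
    flow_linear). *)

(** * Lebesgue measure of boxes, Borel sets and translates *)

Section coordinates.
Context {R : realType}.

Lemma rV_cons0 n p : @rV_cons R n p 0 ord0 = p.1.
Proof. by have := congr1 fst (rV_consK p). Qed.

Lemma rV_consS n p i : @rV_cons R n p 0 (lift ord0 i) = p.2 0 i.
Proof.
have /= <- := congr1 (fun q : measurableTypeR R * 'rV[R]_n => q.2 0 i) (rV_consK p).
set x := rV_cons p; rewrite [RHS]mxE -[LHS]/((x : 'rV[R]_(1 + n)) 0 _).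
by congr (x _ _); apply/val_inj.
Qed.

Lemma measurable_box n (A : 'I_n -> set (measurableTypeR R)) :
  (forall i, measurable (A i)) ->
  measurable [set x : 'rV[R]_n | forall i, A i (x 0 i)].
Proof.
move=> mA; rewrite [X in measurable X](_ : _ =
    \bigcap_(i in [set: 'I_n]) (rV_coord i @^-1` A i)); last first.
  by apply/seteqP; split => [x Ax i _|x Ax i]; [exact: Ax|exact: (Ax i)].
apply: fin_bigcap_measurable => // i _.
by rewrite -[X in measurable X]setTI; exact: measurable_rV_coord.
Qed.

Lemma lebesgue_rVS n (A : set 'rV[R]_n.+1) : lebesgue_rV R n.+1 A =
  (@lebesgue_measure R \x lebesgue_rV R n)%E (@rV_cons R n @^-1` A).
Proof. by []. Qed.

Lemma lebesgue_rV_box n (A : 'I_n -> set (measurableTypeR R)) (a : 'I_n -> R) :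
  (forall i, measurable (A i)) ->
  (forall i, lebesgue_measure (A i) = (a i)%:E) ->
  lebesgue_rV R n [set x : 'rV[R]_n | forall i, A i (x 0 i)] =
  (\prod_(i < n) a i)%:E.
Proof.
elim: n A a => [|n IH] A a mA Aa.
  by rewrite big_ord0 /= diracE mem_set// => -[].
have mS := @measurable_box n (fun i => A (lift ord0 i)) (fun i => mA _).
rewrite lebesgue_rVS [X in product_measure1 _ _ X](_ : _ = A ord0 `*`
    [set y : 'rV[R]_n | forall i : 'I_n, A (lift ord0 i) (y 0 i)]); last first.
  apply/seteqP; split => -[x y] /=.
    move=> Axy; split => [|i]; first by have := Axy ord0; rewrite rV_cons0.
    by have := Axy (lift ord0 i); rewrite rV_consS.
  move=> [Ax Ay] i; case: (unliftP ord0 i) => [j ->|->].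
    by rewrite rV_consS; exact: Ay.
  by rewrite rV_cons0.
transitivity (mule (lebesgue_measure (A ord0)) (lebesgue_rV R n
    [set y : 'rV[R]_n | forall i : 'I_n, A (lift ord0 i) (y 0 i)])).
  exact: product_measure1E.
by rewrite Aa (IH (fun i => A (lift ord0 i)) (fun i => a (lift ord0 i)))// big_ord_recl EFinM.
Qed.

(** The sigma-algebra is generated by the coordinates, so a countable basis of
    boxes with rational centres and sides is what links it to the topology. *)
Lemma open_measurable_rV n (U : set 'rV[R]_n) : open U -> measurable U.
Proof.
move=> oU.
pose box (q : 'rV[rat]_n * rat) :=
  [set x : 'rV[R]_n | forall i, ball (ratr (q.1 0 i) : R) (ratr q.2) (x 0 i)].
have mbox q : measurable (box q).
  apply: (measurable_box (A := fun i => ball (ratr (q.1 0 i) : R) (ratr q.2))).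
  by move=> i; exact: measurable_realfun.measurable_ball.
have -> : U = \bigcup_q (if `[< box q `<=` U >] then box q else set0).
  apply/seteqP; split => [x Ux|x [q _]]; last by case: asboolP => // qU /qU.
  have /nbhs_ballP[e /= e0 xeU] : nbhs x U by exact: open_nbhs_nbhs.
  have [r] := rat_in_itvoo (divr_gt0 e0 (@ltr0n R 2)).
  rewrite in_itv/= => /andP[r0 re].
  have H i : exists p : rat, ball (x 0 i) (ratr r) (ratr p : R).
    have [|p] := @rat_in_itvoo R (x 0 i - ratr r) (x 0 i + ratr r).
      by rewrite ltrBlDr -addrA ltrDl addr_gt0.
    rewrite in_itv/= => /andP[h1 h2]; exists p; rewrite /ball/=.
    by rewrite ltr_distlC h1 h2.
  have [p Hp] := choice H.
  have xb : box (\row_i p i, r) x.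
    by move=> i /=; rewrite mxE; apply: ball_sym; exact: Hp.
  exists (\row_i p i, r) => //; case: asboolP => //; case => y yb.
  apply: xeU; split=> // i j; rewrite ord1; have := yb j; have := xb j; rewrite /= mxE.
  move=> /ball_sym xp py; apply: (@le_ball _ _ _ (ratr r + ratr r)).
    by rewrite [leRHS]splitr lerD// ltW.
  exact: ball_triangle xp py.
apply: countable_bigcupT_measurable; first exact: countableP.
by move=> q; case: ifP.
Qed.

Lemma closed_measurable_rV n (U : set 'rV[R]_n) : closed U -> measurable U.
Proof.
by move=> cU; rewrite -[U]setCK; apply: measurableC; apply: open_measurable_rV;
  exact: closed_openC.
Qed.

Lemma compact_closed_rV n (U : set 'rV[R]_n) : compact U -> closed U.
Proof. by apply: compact_closed; exact: norm_hausdorff. Qed.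

Lemma compact_measurable_rV n (U : set 'rV[R]_n) : compact U -> measurable U.
Proof. by move=> /compact_closed_rV; exact: closed_measurable_rV. Qed.

Lemma lebesgue_measure_shift (a : R) (A : set (measurableTypeR R)) :
  measurable A ->
  lebesgue_measure [set x : measurableTypeR R | A (x + a)] = lebesgue_measure A.
Proof.
move=> mA.
pose f (x : measurableTypeR R) : measurableTypeR R := (x : R) + a.
have mf : measurable_fun setT f by exact: measurable_funD.
pose g : {mfun measurableTypeR R >-> measurableTypeR R} :=
  HB.pack f (isMeasurableFun.Build _ _ _ _ f mf).
apply/esym/(@lebesgue_measure_unique R (pushforward lebesgue_measure g)) => // X.
move=> [[x y] _ <-]; rewrite [RHS](_ : _ = lebesgue_measure (g @^-1` `]x, y]))//.
rewrite [X in _ = _ X](_ : _ = `]x - a, y - a]%classic).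
  rewrite !lebesgue_measure_itv/= !lte_fin ltrD2r; case: ifP => // _.
  by rewrite -!EFinB; congr EFin; ring.
apply/seteqP; split => z /=; rewrite /g/= /f !in_itv/= => /andP[? ?];
  apply/andP; lra.
Qed.

(** The one-dimensional case passes through the recursive construction because
    a product measure is determined by its values on rectangles. *)
Lemma lebesgue_rV_shift n (a : 'rV[R]_n) (A : set 'rV[R]_n) :
  measurable A -> lebesgue_rV R n [set x | A (x + a)] = lebesgue_rV R n A.
Proof.
elim: n a A => [|n IH] a A mA.
  congr (\d_(0 : 'rV[R]_0)); apply/funext => x /=; congr A.
  by apply/rowP => -[].
pose b : 'rV[R]_n := \row_i a 0 (lift ord0 i).
pose f (p : measurableTypeR R * 'rV[R]_n) : measurableTypeR R * 'rV[R]_n :=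
  ((p.1 : R) + a 0 ord0, p.2 + b).
have mf : measurable_fun setT f.
  apply/measurable_fun_pairP; split.
    by apply: measurable_funD => //; exact: measurable_fst.
  apply: measurable_fun_rV => i.
  rewrite (_ : _ \o _ = fun p => rV_coord i p.2 + a 0 (lift ord0 i)); last first.
    by apply/funext => p; rewrite /rV_coord /f/= !mxE.
  apply: measurable_funD => //; apply: measurableT_comp; last exact: measurable_snd.
  exact: measurable_rV_coord.
pose g : {mfun (measurableTypeR R * 'rV[R]_n)%type >->
               (measurableTypeR R * 'rV[R]_n)%type} :=
  HB.pack f (isMeasurableFun.Build _ _ _ _ f mf).
have mA' : measurable (@rV_cons R n @^-1` A).
  by rewrite -[X in measurable X]setTI; exact: measurable_rV_cons.
rewrite !lebesgue_rVS.
transitivity (pushforward (@lebesgue_measure R \x lebesgue_rV R n)%E g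
    (@rV_cons R n @^-1` A)).
  congr (product_measure1 _ _ _); apply/funext => p /=; congr A.
  apply/rowP => i; rewrite mxE.
  case: (unliftP ord0 i) => [j ->|->]; first by rewrite !rV_consS/= !mxE.
  by rewrite !rV_cons0.
apply/esym.
apply: (product_measure_unique (m' := pushforward _ g)) => // X Y mX mY.
transitivity ((@lebesgue_measure R \x lebesgue_rV R n)%E
  ([set x : measurableTypeR R | X ((x : R) + a 0 ord0)] `*`
   [set y | Y (y + b)])) => //.
transitivity (mule
  (lebesgue_measure [set x : measurableTypeR R | X ((x : R) + a 0 ord0)])
  (lebesgue_rV R n [set y | Y (y + b)])).
  apply: product_measure1E.
    rewrite -[X in measurable X]setTI.
    by apply: (measurable_funD (@measurable_id _ _ setT) (measurable_cst _)).
  rewrite -[X in measurable X]setTI.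
  have : measurable_fun setT (fun y : 'rV[R]_n => y + b); last exact.
  apply: measurable_fun_rV => i.
  rewrite (_ : _ \o _ = fun y => rV_coord i y + a 0 (lift ord0 i)); last first.
    by apply/funext => y; rewrite /rV_coord/= !mxE.
  by apply: measurable_funD => //; exact: measurable_rV_coord.
by rewrite IH// lebesgue_measure_shift.
Qed.

End coordinates.

(** * Norm and scalar product on row vectors *)

Section sup_norm.
Context {R : realType}.

Lemma le_coord_norm m n (x : 'M[R]_(m, n)) i j : `|x i j| <= `|x|.
Proof.
by rewrite [leRHS]/Num.norm/= mx_normrE; exact: (le_bigmax _ _ (i, j)).
Qed.

Lemma norm_le_coord m n (x : 'M[R]_(m, n)) (c : R) :
  0 <= c -> (forall i j, `|x i j| <= c) -> `|x| <= c.
Proof.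
move=> c0 xc; rewrite /Num.norm/= mx_normrE; by apply: bigmax_le => //.
Qed.

Lemma norm_mulmx_le m n p (u : 'M[R]_(m, n)) (A : 'M[R]_(n, p)) :
  `|u *m A| <= n%:R * `|u| * `|A|.
Proof.
apply: norm_le_coord => [|i j]; first by rewrite !mulr_ge0.
rewrite mxE (le_trans (ler_norm_sum _ _ _))//.
rewrite -mulrA mulr_natl -[X in _ <= _ *+ X](card_ord n) -sumr_const ler_sum// => l _.
by rewrite normrM ler_pM// le_coord_norm.
Qed.

Lemma dot_mulmx n (u v : 'rV[R]_n) : dot u v = (u *m v^T) 0 0.
Proof. by rewrite mxE; apply: eq_bigr => i _; rewrite mxE. Qed.

(** The norm on row vectors is the sup norm, hence the dimension factor in
    this form of the Cauchy-Schwarz inequality. *)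
Lemma norm_dot_le n (u v : 'rV[R]_n) : `|dot u v| <= n%:R * `|u| * `|v|.
Proof.
rewrite (le_trans (ler_norm_sum _ _ _))//.
rewrite -mulrA mulr_natl -[X in _ <= _ *+ X](card_ord n) -sumr_const ler_sum// => l _.
by rewrite normrM ler_pM// le_coord_norm.
Qed.

Lemma dotDl n (u v w : 'rV[R]_n) : dot (u + v) w = dot u w + dot v w.
Proof. by rewrite !dot_mulmx mulmxDl mxE. Qed.

Lemma dotZl n a (u w : 'rV[R]_n) : dot (a *: u) w = a * dot u w.
Proof. by rewrite !dot_mulmx -scalemxAl mxE. Qed.

Lemma dotC n (u w : 'rV[R]_n) : dot u w = dot w u.
Proof. by apply: eq_bigr => i _; rewrite mulrC. Qed.

Lemma dotNl n (u w : 'rV[R]_n) : dot (- u) w = - dot u w.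
Proof. by rewrite -scaleN1r dotZl mulN1r. Qed.

Lemma dotBl n (u v w : 'rV[R]_n) : dot (u - v) w = dot u w - dot v w.
Proof. by rewrite dotDl dotNl. Qed.

Lemma dotDr n (u v w : 'rV[R]_n) : dot w (u + v) = dot w u + dot w v.
Proof. by rewrite !(dotC w) dotDl. Qed.

Lemma dotZr n a (u w : 'rV[R]_n) : dot w (a *: u) = a * dot w u.
Proof. by rewrite !(dotC w) dotZl. Qed.

Lemma dotBr n (u v w : 'rV[R]_n) : dot w (u - v) = dot w u - dot w v.
Proof. by rewrite !(dotC w) dotBl. Qed.

Lemma dot_ge0 n (u : 'rV[R]_n) : 0 <= dot u u.
Proof. by apply: sumr_ge0 => i _; rewrite -expr2 sqr_ge0. Qed.

Lemma dot_eq0 n (u : 'rV[R]_n) : (dot u u == 0) = (u == 0).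
Proof.
apply/idP/eqP => [|->]; last by apply/eqP; apply: big1 => i _; rewrite mxE mul0r.
rewrite psumr_eq0 => [/allP u0|i _]; last by rewrite -expr2 sqr_ge0.
apply/rowP => i; have /= := u0 i (mem_index_enum _).
by rewrite -expr2 sqrf_eq0 mxE => /eqP.
Qed.

Lemma norm_le_unit n (v : 'rV[R]_n) : dot v v = 1 -> `|v| <= 1.
Proof.
move=> v1; apply: norm_le_coord => // i j; rewrite ord1.
rewrite -(@ler_pXn2r _ 2)// ?nnegrE// expr1n real_normK ?num_real//.
rewrite -v1 /dot (bigD1 j)//= -expr2 lerDl sumr_ge0// => l _.
by rewrite -expr2 sqr_ge0.
Qed.

Lemma lipschitz_continuous_rV m (W : normedModType R) (f : 'rV[R]_m -> W) (c : R) :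
  (forall x y, `|f x - f y| <= c * `|x - y|) -> continuous f.
Proof.
move=> fc x; apply/(@cvgrPdist_lt _ _ _ (nbhs (x : 'rV[R]_m))) => e e0.
pose d := Num.max c 0 + 1.
have d0 : 0 < d by rewrite ltr_wpDl// le_max lexx orbT.
apply: (filterS _ (nbhsx_ballx x _ (divr_gt0 e0 d0))) => y.
rewrite -ball_normE/= ltr_pdivlMr// => xy.
rewrite (le_lt_trans (fc _ _))// (le_lt_trans _ xy)// mulrC ler_wpM2l//.
by rewrite /d ler_wpDr// le_max lexx.
Qed.

Lemma continuous_dot2 n : continuous (fun x : 'rV[R]_n => dot x x).
Proof.
move=> x; apply/(@cvgrPdist_le _ _ _ (nbhs (x : 'rV[R]_n))) => e e0.
pose c := n%:R * (`|x| + `|x| + 1) + 1.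
have c0 : 0 < c by rewrite ltr_wpDl// mulr_ge0// !addr_ge0.
have d0 : 0 < Num.min 1 (e / c) by rewrite lt_min ltr01 divr_gt0.
apply: (filterS _ (nbhsx_ballx x _ d0)) => y.
rewrite -ball_normE/= lt_min ltr_pdivlMr// => /andP[xy1 xy].
have -> : dot x x - dot y y = dot (x - y) (x + y).
  by rewrite dotBl !dotDr (dotC y x); ring.
rewrite (le_trans (norm_dot_le _ _))// mulrAC mulrC (le_trans _ (ltW xy))//.
rewrite ler_wpM2l//; apply: (@le_trans _ _ (n%:R * (`|x| + `|x| + 1))).
  rewrite ler_wpM2l// -addrA (le_trans (ler_normD _ _))// lerD2l.
  have -> : (y : 'rV[R]_n) = x - (x - y) by rewrite opprB addrC subrK.
  by rewrite (le_trans (ler_normB _ _))// lerD2l ltW.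
by rewrite lerDl.
Qed.

End sup_norm.

(** * Approximation of compact sets by grid cubes *)

Section neighbourhoods.
Context {R : realType} {n : nat}.
Local Notation V := 'rV[R]_n.
Implicit Types X Y : set V.

Definition thicken X (r : R) : set V := [set x | exists2 y, X y & `|x - y| < r].

Lemma measurable_thicken X r : measurable (thicken X r).
Proof.
apply: open_measurable_rV; rewrite openE => x [y Xy xy].
rewrite -subr_gt0 in xy.
apply: (filterS _ (nbhsx_ballx x _ xy)) => z; rewrite -ball_normE/= => xz.
exists y => //; rewrite -(subrK x z) -addrA (le_lt_trans (ler_normD _ _))//.
by rewrite -ltrBrDr distrC.
Qed.

Lemma bounded_le X : bounded_set X -> exists2 r : R, 0 < r & forall x, X x -> `|x| <= r.
Proof.
move=> [r [_ rX]]; exists (Num.max r 0 + 1); first by rewrite ltr_wpDl// le_max lexx orbT.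
by move=> x Xx; apply: rX => //; rewrite ltr_pwDr// le_max lexx.
Qed.

Lemma compact_le X : compact X -> exists2 r : R, 0 < r & forall x, X x -> `|x| <= r.
Proof. by move=> /compact_bounded; exact: bounded_le. Qed.

Lemma measurable_norm_le (r : R) : measurable [set x : V | `|x| <= r].
Proof.
apply: closed_measurable_rV.
have -> : [set x : V | `|x| <= r] = (fun x : V => `|x|) @^-1` [set y | y <= r] by [].
by apply: closed_comp => [x _|]; [exact: norm_continuous|exact: closed_le].
Qed.

Lemma lebesgue_rV_norm_le (r : R) : (lebesgue_rV R n [set x : V | (`|x| <= r)%R] < +oo)%E.
Proof.
have H : measurable [set x : V | forall i, `[- Num.max r 0, Num.max r 0]%classic (x 0 i)].
  exact: (measurable_box (A := fun i => `[- Num.max r 0, Num.max r 0]%classic)).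
apply: (@le_lt_trans _ _ (lebesgue_rV R n [set x : V | forall i,
    `[- Num.max r 0, Num.max r 0]%classic (x 0 i)])).
  apply: le_measure; rewrite ?inE//; first exact: measurable_norm_le.
  move=> x/= xr i; rewrite in_itv/= -ler_norml (le_trans (le_coord_norm _ _ _))//.
  by rewrite (le_trans xr)// le_max lexx.
rewrite (@lebesgue_rV_box _ _ (fun i => `[- Num.max r 0, Num.max r 0]%classic)
  (fun=> Num.max r 0 *+ 2)) ?ltry// => i.
rewrite lebesgue_measure_itv/= lte_fin; case: ifPn => [_|].
  by rewrite -EFinD opprK.
rewrite -leNgt => h; congr EFin; have : 0 <= Num.max r 0 by rewrite le_max lexx orbT.
lra.
Qed.

Section cvg_thicken.
Variable nu : {measure set V -> \bar R}.
Hypothesis nu_fin : forall r : R, (nu [set x : V | (`|x| <= r)%R] < +oo)%E.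

(** A compact set is the decreasing intersection of its open neighbourhoods. *)
Lemma cvg_thicken X : compact X ->
  nu (thicken X (2 / N.+1%:R)) @[N --> \oo] --> nu X.
Proof.
move=> cX; have XE : X = \bigcap_N thicken X (2 / N.+1%:R).
  apply/seteqP; split => [x Xx N _|x Ux].
    by exists x => //; rewrite subrr normr0 divr_gt0.
  have /closure_id -> := compact_closed_rV cX.
  move=> B /nbhs_ballP[e /= e0 xB].
  have [N Ne] : exists N, 2 / N.+1%:R < e.
    exists (Num.truncn (2 / e)); rewrite ltr_pdivrMr// mulrC -ltr_pdivrMr//.
    by rewrite truncnS_gt.
  have [y Xy xy] := Ux N I; exists y; split => //.
  by apply: xB; rewrite -ball_normE/=; exact: lt_trans xy _.
rewrite [in X in _ --> X]XE; apply: nonincreasing_cvg_mu.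
- have [r r0 rX] := compact_le cX; apply: le_lt_trans (nu_fin (r + 2)).
  apply: le_measure; rewrite ?inE; [exact: measurable_thicken|exact: measurable_norm_le|].
  move=> x/= [y Xy]; rewrite divr1 => xy; rewrite -(subrK y x) addrC.
  by rewrite (le_trans (ler_normD _ _))// lerD// ?rX// ltW.
- by move=> N; exact: measurable_thicken.
- by rewrite -XE; exact: compact_measurable_rV.
- move=> N N' NN'; apply/subsetPset => x [y Xy xy]; exists y => //.
  by rewrite (lt_le_trans xy)// ler_pM2l// lef_pV2 ?posrE// ler_nat.
Qed.

End cvg_thicken.

End neighbourhoods.

Section grid.
Context {R : realType} {n : nat}.
Local Notation V := 'rV[R]_n.
Implicit Types X Y : set V.

Definition grid_index N (x : V) : 'rV[int]_n :=
  \row_i Num.floor (N.+1%:R * x 0 i).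

Definition grid_cube N (z : 'rV[int]_n) : set V := [set x | grid_index N x = z].

(** These coverings shrink to X when X is compact, and to compare two measures
    on them it is enough to compare them on half-open cubes of side 1/(N+1). *)
Definition grid_cover N X : set V :=
  \bigcup_(z in grid_index N @` X) grid_cube N z.

Let side N (z : 'rV[int]_n) (i : 'I_n) : set (measurableTypeR R) :=
  `[(z 0 i)%:~R / N.+1%:R, ((z 0 i)%:~R + 1) / N.+1%:R[%classic.

Let measurable_side N z i : measurable (side N z i).
Proof. exact: measurable_itv. Qed.

Lemma grid_cubeE N z : grid_cube N z = [set x : V | forall i, side N z i (x 0 i)].
Proof.
apply/seteqP; split => x /=.
  move=> <- i; rewrite /side/= in_itv/= !mxE.
  rewrite ler_pdivrMr// ltr_pdivlMr// [x 0 i * _]mulrC.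
  by have := mem_rg1_floor (N.+1%:R * x 0 i); rewrite /range1.
move=> xz; apply/rowP => i; rewrite mxE.
have := xz i; rewrite /side/= in_itv/= ler_pdivrMr// ltr_pdivlMr// mulrC => h.
by apply: floor_def; rewrite intrD.
Qed.

Lemma measurable_grid_cube N z : measurable (grid_cube N z).
Proof. by rewrite grid_cubeE; apply: measurable_box. Qed.

Lemma lebesgue_rV_grid_cube N z :
  lebesgue_rV R n (grid_cube N z) = (N.+1%:R^-1 ^+ n)%:E.
Proof.
rewrite grid_cubeE (@lebesgue_rV_box _ _ _ (fun=> N.+1%:R^-1))//.
  by rewrite prodr_const card_ord.
move=> i; rewrite /side lebesgue_measure_itv/= lte_fin ltr_pM2r ?invr_gt0// ltrDl ltr01.
by rewrite -EFinB -mulrBl addrAC subrr add0r mul1r.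
Qed.

Lemma grid_cube_diam N z x y : grid_cube N z x -> grid_cube N z y ->
  `|x - y| <= N.+1%:R^-1.
Proof.
rewrite grid_cubeE => xz yz; apply: norm_le_coord => // j i; rewrite ord1 !mxE.
have := xz i; have := yz i; rewrite /side/= !in_itv/= !mulrDl mul1r.
move: ((z 0 i)%:~R / N.+1%:R : R) (N.+1%:R^-1 : R) => a b.
by move=> /andP[? ?] /andP[? ?]; rewrite ler_norml; apply/andP; lra.
Qed.

Lemma sub_grid_cover N X : X `<=` grid_cover N X.
Proof. by move=> x Xx; exists (grid_index N x) => //; exists x. Qed.

Lemma grid_cover_sub N X : grid_cover N X `<=` thicken X (2 / N.+1%:R).
Proof.
move=> x [z [y Xy yz] xz]; exists y => //.
by rewrite (le_lt_trans (grid_cube_diam xz yz))// ltr_pMl ?invr_gt0// ltr1n.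
Qed.

Lemma finite_grid_index N X : bounded_set X -> finite_set (grid_index N @` X).
Proof.
move=> /bounded_le[r r0 rX].
pose b := (Num.truncn (N.+1%:R * r)).+1.
pose f (u : 'rV['I_(b + b).+1]_n) : 'rV[int]_n := \row_i ((u 0 i)%:Z - b%:Z).
apply: (@sub_finite_set _ _ (range f)); last exact/finite_image/finite_finset.
move=> _ [x Xx <-].
have H i : exists m : 'I_(b + b).+1, Num.floor (N.+1%:R * x 0 i) = m%:Z - b%:Z.
  have xb : `|N.+1%:R * x 0 i| < b%:R.
    rewrite normrM ger0_norm// (@le_lt_trans _ _ (N.+1%:R * r))//.
      by rewrite ler_wpM2l// (le_trans (le_coord_norm _ _ _))// rX.
    exact: truncnS_gt.
  move: xb; rewrite ltr_norml => /andP[b1 b2].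
  have f1 : - b%:Z <= Num.floor (N.+1%:R * x 0 i).
    by rewrite floor_ge_int intrN ltW.
  have f2 : Num.floor (N.+1%:R * x 0 i) < b%:Z by rewrite floor_lt_int.
  have [m mE] : exists m : nat, Num.floor (N.+1%:R * x 0 i) + b%:Z = m%:Z.
    exists `|(Num.floor (N.+1%:R * x 0 i) + b%:Z)%R|%N.
    by rewrite gez0_abs// -lerBlDr sub0r.
  have mb : (m < (b + b).+1)%N by lia.
  by exists (Ordinal mb); rewrite /= -mE addrK.
have [g gE] := choice H.
by exists (\row_i g i) => //; apply/rowP => i; rewrite !mxE gE.
Qed.

Lemma measurable_grid_cover N X : bounded_set X -> measurable (grid_cover N X).
Proof.
move=> bX; apply: fin_bigcup_measurable; first exact: finite_grid_index.
by move=> z _; exact: measurable_grid_cube.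
Qed.

Lemma measure_grid_cover (nu : {measure set V -> \bar R}) N X : bounded_set X ->
  nu (grid_cover N X) = (\sum_(z \in grid_index N @` X) nu (grid_cube N z))%E.
Proof.
move=> bX; apply: measure_fin_bigcup; first exact: finite_grid_index.
- by move=> z1 z2 _ _ [x [<- <-]].
- by move=> z _; exact: measurable_grid_cube.
Qed.

Lemma cvg_grid_cover (nu : {measure set V -> \bar R}) X :
  (forall r : R, (nu [set x : V | (`|x| <= r)%R] < +oo)%E) ->
  compact X -> nu (grid_cover N X) @[N --> \oo] --> nu X.
Proof.
move=> nu_fin cX; apply: squeeze_cvge (cvg_thicken nu_fin cX); last exact: cvg_cst.
apply: nearW => N; have mX := compact_measurable_rV cX.
have mG := measurable_grid_cover N (compact_bounded cX).
apply/andP; split; apply: le_measure; rewrite ?inE//.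
- exact: sub_grid_cover.
- exact: measurable_thicken.
- exact: grid_cover_sub.
Qed.

(** The lower corner a is made of the infima of the coordinates; a set of
    sup-norm diameter d fits in a box of side d, which loses nothing in
    volume, whereas a ball around one of its points would lose a factor 2^n. *)
Lemma small_set_box (S : set V) (d : R) : 0 <= d ->
  (forall x y, S x -> S y -> `|x - y| <= d) ->
  exists a : V, S `<=` [set x | forall i, `[a 0 i, a 0 i + d]%classic (x 0 i)].
Proof.
move=> d0 Sd.
pose C i := [set x 0 i | x in S].
exists (\row_i inf (C i)) => x Sx i /=; rewrite in_itv/= mxE.
have lb y : S y -> lbound (C i) (y 0 i - d).
  move=> Sy _ [z Sz <-]; rewrite lerBlDl -lerBlDr.
  apply: (le_trans _ (Sd _ _ Sy Sz)); rewrite (le_trans (ler_norm _))//.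
  by have := le_coord_norm (y - z) 0 i; rewrite !mxE.
apply/andP; split; first by apply: inf_lbound; [exists (x 0 i - d); exact: lb|exists x].
rewrite -lerBlDr; apply: lb_le_inf; last exact: lb.
by exists (x 0 i); exists x.
Qed.

(** Cover X by grid cubes: the points of Y related to one cube fit in a box
    whose volume is L^n times that of the cube. A relation is used instead of
    a map because both a set and its displaced copy are known only through the
    trajectories joining them, and the bound is needed in both directions. *)
Lemma lebesgue_rV_lipschitz X Y (L : R) (rel : V -> V -> Prop) :
  compact X -> measurable Y -> 0 <= L ->
  (forall y, Y y -> exists2 x, X x & rel x y) ->
  (forall x x' y y', X x -> X x' -> Y y -> Y y' -> rel x y -> rel x' y' ->
    `|y - y'| <= L * `|x - x'|) ->
  (lebesgue_rV R n Y <= (L ^+ n)%:E * lebesgue_rV R n X)%E.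
Proof.
move=> cX mY L0 YX relL; have bX := compact_bounded cX.
suff H N : (lebesgue_rV R n Y <= (L ^+ n)%:E * lebesgue_rV R n (grid_cover N X))%E.
  have Xfin : (lebesgue_rV R n X < +oo)%E.
    have [r r0 rX] := compact_le cX; apply: le_lt_trans (lebesgue_rV_norm_le r).
    apply: le_measure; rewrite ?inE//; [exact: compact_measurable_rV|].
    exact: measurable_norm_le.
  have := cvg_grid_cover (nu := lebesgue_rV R n) (@lebesgue_rV_norm_le R n) cX.
  move=> /(cvgeZl (fin_numE _ : (L ^+ n)%:E \is a fin_num)) h.
  by apply: (cvge_ge _ h); apply: nearW.
pose S z : set V := [set y | Y y /\ exists2 x, X x /\ grid_cube N z x & rel x y].
have Sd z y y' : S z y -> S z y' -> `|y - y'| <= L / N.+1%:R.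
  move=> [Yy [x [Xx zx] xy]] [Yy' [x' [Xx' zx'] xy']].
  rewrite (le_trans (relL _ _ _ _ Xx Xx' Yy Yy' xy xy'))// ler_wpM2l//.
  exact: grid_cube_diam zx zx'.
have LN : 0 <= L / N.+1%:R by rewrite divr_ge0.
have [a aS] := choice (fun z => small_set_box LN (Sd z)).
pose C z := [set x : V | forall i, `[a z 0 i, a z 0 i + L / N.+1%:R]%classic (x 0 i)].
have mC z : measurable (C z).
  exact: (measurable_box (A := fun i => `[a z 0 i, a z 0 i + L / N.+1%:R]%classic)).
have CE z : lebesgue_rV R n (C z) = ((L ^+ n)%:E * lebesgue_rV R n (grid_cube N z))%E.
  rewrite (@lebesgue_rV_box _ _ (fun i => `[a z 0 i, a z 0 i + L / N.+1%:R]%classic)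
    (fun=> L / N.+1%:R))//.
    by rewrite prodr_const card_ord lebesgue_rV_grid_cube -EFinM exprMn.
  move=> i; rewrite lebesgue_measure_itv/= lte_fin ltrDl.
  rewrite -EFinB addrAC subrr add0r; case: ltP => // h; congr EFin.
  by apply/eqP; rewrite eq_le LN h.
rewrite measure_grid_cover// ge0_mule_fsumr//.
under eq_fsbigr do rewrite -CE.
apply: content_sub_fsum => //; first exact: finite_grid_index.
move=> y Yy; have [x Xx xy] := YX y Yy.
by exists (grid_index N x); [exists x|apply: aS; split => //; exists x].
Qed.

End grid.

(** * Rotation invariance *)

Section rotation.
Context {R : realType} {n : nat}.
Local Notation V := 'rV[R]_n.

(** If each measure gives the same mass to all cubes of a given mesh, then the
    two are proportional on grid coverings. In the limit their ratios on X and
    on K agree, and one set K on which they coincide fixes the constant. *)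
Lemma eq_measure_compact (nu : {measure set V -> \bar R}) (K : set V) :
  (forall r : R, (nu [set x : V | (`|x| <= r)%R] < +oo)%E) ->
  (forall N z, nu (grid_cube N z) = nu (grid_cube N 0)) ->
  compact K -> nu K = lebesgue_rV R n K -> (0 < lebesgue_rV R n K)%E ->
  forall X, compact X -> nu X = lebesgue_rV R n X.
Proof.
move=> nu_fin nu_cube cK nuK K0 X cX.
have mu_fin := @lebesgue_rV_norm_le R n.
have fin (m : {measure set V -> \bar R}) Y :
    (forall r : R, (m [set x : V | (`|x| <= r)%R] < +oo)%E) -> compact Y ->
    m Y \is a fin_num.
  move=> m_fin cY; rewrite ge0_fin_numE//.
  have [r r0 rY] := compact_le cY; apply: le_lt_trans (m_fin r).
  apply: le_measure; rewrite ?inE//; [exact: compact_measurable_rV|].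
  exact: measurable_norm_le.
have H N : (nu (grid_cover N X) * lebesgue_rV R n (grid_cover N K) =
            lebesgue_rV R n (grid_cover N X) * nu (grid_cover N K))%E.
  have bX := compact_bounded cX; have bK := compact_bounded cK.
  pose count (Y : set V) := (\sum_(z \in @grid_index R n N @` Y) (1 : \bar R))%E.
  have nuE Y : bounded_set Y -> nu (grid_cover N Y) = (nu (grid_cube N 0) * count Y)%E.
    move=> bY; rewrite measure_grid_cover// ge0_mule_fsumr//.
    by apply: eq_fsbigr => z _; rewrite mule1 nu_cube.
  have muE Y : bounded_set Y -> lebesgue_rV R n (grid_cover N Y) =
      (lebesgue_rV R n (grid_cube N 0) * count Y)%E.
    move=> bY; rewrite measure_grid_cover// ge0_mule_fsumr//.
    rewrite lebesgue_rV_grid_cube; apply: eq_fsbigr => z _.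
    by rewrite mule1; exact: lebesgue_rV_grid_cube.
  by rewrite !nuE// !muE// muleACA [RHS]muleACA [(nu _ * _)%E]muleC.
have cvX := cvg_grid_cover nu_fin cX; have cvK := cvg_grid_cover nu_fin cK.
have cmX := cvg_grid_cover mu_fin cX; have cmK := cvg_grid_cover mu_fin cK.
have [fX fK fmX fmK] : [/\ nu X \is a fin_num, nu K \is a fin_num,
  lebesgue_rV R n X \is a fin_num & lebesgue_rV R n K \is a fin_num].
  by split; exact: fin.
have := cvgeM (mule_def_fin fX fmK) cvX cmK.
rewrite (funext H : _ = (fun N => _ : \bar R)) => /(_ _) c1.
have /(_ _) c2 := cvgeM (mule_def_fin fmX fK) cmX cvK.
have : (nu X * lebesgue_rV R n K = lebesgue_rV R n X * nu K)%E.
  exact: (cvg_unique (@ereal_hausdorff R) c1 c2).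
move: fX fmX fmK K0; rewrite nuK.
move: (nu X) (lebesgue_rV R n X) (lebesgue_rV R n K) => [a| |] [b| |] [c| |]//=.
rewrite lte_fin => _ _ _ c0; rewrite -!EFinM => -[ac]; congr EFin.
by move/mulIf: ac; apply; rewrite gt_eqF.
Qed.

Definition orthogonal_mx (O : 'M[R]_n) := O *m O^T = 1%:M.

Lemma measurable_mulmx (O : 'M[R]_n) : measurable_fun setT (fun x : V => x *m O).
Proof.
apply: measurable_fun_rV => i.
rewrite (_ : _ \o _ = fun x : V => \sum_(j < n) rV_coord j x * O j i); last first.
  by apply/funext => y; rewrite /rV_coord/= mxE.
apply: measurable_sum => j; apply: measurable_funM => //.
exact: measurable_rV_coord.
Qed.

(** The image of Lebesgue measure under an orthogonal matrix is still
    translation invariant, and it agrees with Lebesgue measure on a Euclidean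
    ball, which the matrix preserves. *)
Lemma lebesgue_rV_rotation (O : 'M[R]_n) (X : set V) :
  orthogonal_mx O -> compact X ->
  lebesgue_rV R n [set x | X (x *m O)] = lebesgue_rV R n X.
Proof.
move=> OO cX; have OtO : O^T *m O = 1%:M by exact: mulmx1C.
pose f : {mfun V >-> V} := HB.pack (fun x : V => x *m O : V)
  (isMeasurableFun.Build _ _ _ _ (fun x : V => x *m O : V) (measurable_mulmx O)).
(* radius sqrt n makes the ball contain a unit cube, so its measure is positive *)
pose K := [set x : V | dot x x <= n%:R].
have cK : compact K.
  apply: bounded_closed_compact; last first.
    apply: (@closed_comp _ _ (fun x : V => dot x x) [set y : R | y <= n%:R]).
      by move=> x _; exact: continuous_dot2.
    exact: closed_le.
  exists (n%:R); split; first exact: num_real.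
  move=> r nr x; rewrite /K/= => xn; apply: norm_le_coord => [|i j].
    by rewrite (le_trans _ (ltW nr)).
  rewrite ord1 (le_trans _ (ltW nr))//.
  have : x 0 j ^+ 2 <= n%:R.
    rewrite (le_trans _ xn)// /dot (bigD1 j)//= -expr2 lerDl sumr_ge0// => l _.
    by rewrite -expr2 sqr_ge0.
  rewrite -(real_normK (num_real _)) => h.
  have n1 : 1 <= n%:R :> R by rewrite ler1n (leq_ltn_trans _ (ltn_ord j)).
  rewrite -(@ler_pXn2r _ 2)// ?nnegrE// (le_trans h)//.
  by rewrite expr2 ler_peMl.
apply: (@eq_measure_compact (pushforward (lebesgue_rV R n) f) K) => //.
- move=> r; apply: le_lt_trans (lebesgue_rV_norm_le (n%:R * r * `|O^T|)).
  apply: (@le_measure _ _ _ (lebesgue_rV R n)); rewrite ?inE.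
  + rewrite -[X in measurable X]setTI; apply: measurable_mulmx => //.
    exact: measurable_norm_le.
  + exact: measurable_norm_le.
  + move=> x /= xr; rewrite -[x in leLHS]mulmx1 -OO mulmxA.
    by rewrite (le_trans (norm_mulmx_le _ _))// ler_wpM2r// ler_wpM2l.
- move=> N z.
  pose a : V := (\row_i ((z 0 i)%:~R / N.+1%:R)) *m O^T.
  rewrite -[RHS](lebesgue_rV_shift (- a)); last first.
    rewrite -[X in measurable X]setTI; apply: measurable_mulmx => //.
    exact: measurable_grid_cube.
  congr (lebesgue_rV R n _); apply/funext => x /=; rewrite /grid_cube/=.
  rewrite mulmxDl mulNmx -mulmxA OtO mulmx1.
  have E i : Num.floor (N.+1%:R * (x *m O - \row_i ((z 0 i)%:~R / N.+1%:R)) 0 i) =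
      Num.floor (N.+1%:R * (x *m O) 0 i) - z 0 i.
    rewrite [in LHS]mxE [X in _ + X]mxE [X in - X]mxE mulrBr mulrCA divff// mulr1.
    by rewrite -intrN floorDrz ?intr_int// intrKfloor.
  move: E; set u := _ - _; set y := _ *m O => E; clearbody u y.
  apply/propeqP; split => /rowP xz; apply/rowP => i; have := xz i; rewrite !mxE E.
    by move=> ->; rewrite subrr.
  by move/eqP; rewrite subr_eq0 => /eqP.
- congr (lebesgue_rV R n _); apply/funext => x /=.
  by rewrite /K/= !dot_mulmx trmx_mul mulmxA -(mulmxA x) OO mulmx1.
- apply: (@lt_le_trans _ _ (lebesgue_rV R n (grid_cube 0 0))).
    by rewrite lebesgue_rV_grid_cube lte_fin.
  apply: le_measure; rewrite ?inE//; [exact: measurable_grid_cube|exact: compact_measurable_rV|].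
  move=> x; rewrite grid_cubeE /K/= => x01.
  rewrite -[X in _ <= X%:R](card_ord n) -sumr_const ler_sum// => i _.
  have := x01 i; rewrite /= in_itv/= mxE !divr1 add0r => /andP[? ?].
  by rewrite -expr2 exprn_ile1// ltW.
Qed.

End rotation.

(** * Slices by parallel hyperplanes *)

Section slicing.
Context {R : realType} {k : nat}.
Local Notation V := 'rV[R]_k.+1.

Lemma compact_preimage_shift m (p : 'rV[R]_m) (X : set 'rV[R]_m) :
  compact X -> compact [set x | X (p + x)].
Proof.
move=> cX; have -> : [set x | X (p + x)] = (fun x => x - p) @` X.
  apply/seteqP; split => [x Xx|_ [x Xx <-]] /=.
    by exists (p + x) => //; rewrite addrC addKr.
  by rewrite addrC subrK.
apply: continuous_compact cX; apply: continuous_subspaceT.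
apply: (lipschitz_continuous_rV (c := 1)) => x y.
by rewrite opprB addrA subrK mul1r.
Qed.

Definition slab_coord (p v : V) (Q : 'M[R]_(k, k.+1)) (s : R) (y : 'rV[R]_k) : V :=
  p + s *: v + y *m Q.

Lemma orthogonal_frame (v : V) (Q : 'M[R]_(k, k.+1)) : dot v v = 1 ->
  is_frame v Q -> @orthogonal_mx R k.+1 (col_mx v Q).
Proof.
move=> v1 [QQ Qv]; rewrite /orthogonal_mx.
have E : col_mx v Q *m (col_mx v Q)^T = (1%:M : 'M[R]_(1 + k)).
  rewrite tr_col_mx mul_col_row QQ Qv scalar_mx_block; congr block_mx.
  - by apply/matrixP => i j; rewrite !ord1 -dot_mulmx v1 mxE eqxx.
  - by apply: trmx_inj; rewrite trmx_mul trmxK Qv trmx0.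
exact: E.
Qed.

(** The orthonormal basis made of v and the rows of Q is rotated onto the
    coordinate axes, where this is the product construction of the measure. *)
Lemma lebesgue_rV_slices (p v : V) (Q : 'M[R]_(k, k.+1)) (X : set V) :
  dot v v = 1 -> is_frame v Q -> compact X ->
  lebesgue_rV R k.+1 X =
  (\int[lebesgue_measure]_s lebesgue_rV R k [set y | X (slab_coord p v Q s y)])%E.
Proof.
move=> v1 vQ cX.
rewrite -(lebesgue_rV_shift p); last exact: compact_measurable_rV.
rewrite (_ : [set x | X (x + p)] = [set x | X (p + x)]); last first.
  by apply/funext => x /=; rewrite addrC.
have cX' := (@compact_preimage_shift _ p _ cX).
rewrite -(lebesgue_rV_rotation (orthogonal_frame v1 vQ) cX') lebesgue_rVS.
apply: eq_integral => s _ /=; congr (lebesgue_rV R k _); apply/funext => y.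
rewrite xsectionE/= /slab_coord -addrA; congr (X (p + _)).
by rewrite -mul_scalar_mx; exact: (@mul_row_col _ 1 1 k k.+1).
Qed.

(** The Householder reflection that exchanges v with the first basis vector e
    is an orthogonal matrix with first row v; its remaining rows form the
    frame. *)
Lemma exists_frame (v : V) : dot v v = 1 -> exists Q, is_frame v Q.
Proof.
move=> v1.
have [W [WW W0]] : exists W : 'M[R]_(1 + k, 1 + k), W *m W^T = 1%:M /\ usubmx W = v;
    last first.
  exists (dsubmx W); move: WW; rewrite -[W]vsubmxK tr_col_mx mul_col_row.
  rewrite scalar_mx_block col_mxKd W0 => /eq_block_mx[_ _ Ov WW].
  by split.
pose e : 'rV[R]_(1 + k) := delta_mx 0 0.
have rowO (W : 'M[R]_(1 + k)) : usubmx W = e *m W.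
  by rewrite /e -rowE; apply/rowP => i; rewrite !mxE; congr (W _ _); apply/val_inj.
have [->|ve] := eqVneq v e.
  by exists 1%:M; rewrite trmx1 mulmx1 rowO mulmx1.
have e1 : dot e e = 1 by rewrite dot_mulmx /e trmx_delta mul_delta_mx mxE eqxx.
pose u : 'rV[R]_(1 + k) := v - e; pose c := 2 / dot u u.
have uu : dot u u != 0 by rewrite dot_eq0 subr_eq0.
have uuE : dot e u = - (dot u u / 2).
  by rewrite /u dotBl !dotBr v1 e1 (dotC v e); field.
pose w := u^T *m u.
have wt : w^T = w by rewrite trmx_mul trmxK.
have muluu (x : 'rV[R]_(1 + k)) : x *m w = dot x u *: u.
  by rewrite mulmxA [x *m _]mx11_scalar -dot_mulmx mul_scalar_mx.
have ww : w *m w = dot u u *: w.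
  by rewrite {1}/w -mulmxA muluu -scalemxAr.
exists (1%:M - c *: w); split.
  have -> : (1%:M - c *: w)^T = 1%:M - c *: w.
    by clearbody w; rewrite linearB linearZ/= trmx1 wt.
  rewrite mulmxBl mul1mx mulmxBr mulmx1.
  rewrite -scalemxAl -scalemxAr ww !scalerA -addrA -opprD -scalerBl -scalerDl.
  rewrite [c + _](_ : _ = 0) ?scale0r ?subr0// /c; field.
  exact: uu.
rewrite rowO mulmxBr mulmx1 -scalemxAr muluu scalerA uuE.
rewrite [c * _](_ : _ = -1); last by rewrite /c; field; exact: uu.
by rewrite scaleN1r opprK /u addrC subrK.
Qed.

Lemma frameP (v : V) : dot v v = 1 -> is_frame v (frame v).
Proof. by move=> /exists_frame[Q vQ]; exact: (@xgetPex _ 0 _ (ex_intro _ Q vQ)). Qed.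

End slicing.

Section slabs.
Context {R : realType} {k : nat}.
Local Notation V := 'rV[R]_k.+1.
Implicit Types (p v : V) (Q : 'M[R]_(k, k.+1)) (X : set V).

Lemma slab_coordB p v Q s y : slab_coord p v Q s y - p = s *: v + y *m Q.
Proof. by rewrite /slab_coord -[X in X - p]addrA [LHS]addrC addKr. Qed.

Lemma dot_slab_coord p v Q s y : dot v v = 1 -> is_frame v Q ->
  dot (slab_coord p v Q s y - p) v = s.
Proof.
move=> v1 [QQ Qv]; rewrite slab_coordB dotDl dotZl v1 mulr1.
by rewrite dot_mulmx -mulmxA Qv mulmx0 mxE addr0.
Qed.

Lemma slab_coordK p v Q s y : is_frame v Q ->
  (slab_coord p v Q s y - p) *m Q^T = y.
Proof.
move=> [QQ Qv]; have vQ : v *m Q^T = 0.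
  by apply: trmx_inj; rewrite trmx_mul trmxK Qv trmx0.
by rewrite slab_coordB mulmxDl -scalemxAl vQ scaler0 add0r -mulmxA QQ mulmx1.
Qed.

Lemma slab_coord_surj p v Q x : dot v v = 1 -> is_frame v Q ->
  x = slab_coord p v Q (dot (x - p) v) ((x - p) *m Q^T).
Proof.
move=> v1 vQ; have OO := orthogonal_frame v1 vQ.
have OtO := mulmx1C OO.
rewrite /slab_coord -addrA -[LHS](subrK p) addrC; congr (_ + _).
rewrite -[LHS]mulmx1 -OtO mulmxA.
have -> : (x - p) *m (col_mx v Q : 'M[R]_k.+1)^T =
    row_mx (dot (x - p) v)%:M ((x - p) *m Q^T).
  rewrite [(_)^T](@tr_col_mx _ 1 k k.+1) [LHS](@mul_mx_row _ 1 k.+1 1 k).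
  suff -> : (x - p) *m v^T = (dot (x - p) v)%:M by [].
  by apply/matrixP => i j; rewrite !ord1 -dot_mulmx mxE eqxx.
by rewrite -mul_scalar_mx; exact: (@mul_row_col _ 1 1 k k.+1).
Qed.

Lemma measurable_slab_coord p v Q : measurable_fun setT
  (fun q : measurableTypeR R * 'rV[R]_k => slab_coord p v Q q.1 q.2).
Proof.
apply: measurable_fun_rV => i.
rewrite (_ : _ \o _ = fun q => p 0 i + (q.1 : R) * v 0 i +
    \sum_(j < k) rV_coord j q.2 * Q j i); last first.
  by apply/funext => q; rewrite /rV_coord/= /slab_coord !mxE.
apply: measurable_funD.
  by apply: measurable_funD => //; apply: measurable_funM.
apply: measurable_sum => j; apply: measurable_funM => //.
apply: measurableT_comp; [exact: measurable_rV_coord|exact: measurable_snd].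
Qed.

Lemma measurable_slices p v Q X : measurable X ->
  measurable_fun setT (fun s : measurableTypeR R =>
    lebesgue_rV R k [set y | X (slab_coord p v Q s y)]).
Proof.
move=> mX; pose A := [set q : measurableTypeR R * 'rV[R]_k |
  X (slab_coord p v Q q.1 q.2)].
have mA : measurable A.
  by rewrite -[A]setTI; exact: measurable_slab_coord.
have := measurable_fun_xsection (lebesgue_rV R k) mA.
congr (measurable_fun _ _); apply/funext => s /=; congr (lebesgue_rV R k _).
by rewrite xsectionE.
Qed.

Lemma compact_slice p v Q X s : is_frame v Q -> compact X ->
  compact [set y | X (slab_coord p v Q s y)].
Proof.
move=> vQ cX; have [r r0 rX] := compact_le cX.
apply: bounded_closed_compact.
  exists (k.+1%:R * (r + `|p|) * `|Q^T|); split; first exact: num_real.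
  move=> c rc y /= Xy; rewrite (le_trans _ (ltW rc))//.
  rewrite -(slab_coordK p s y vQ) (le_trans (norm_mulmx_le _ _))//.
  rewrite ler_wpM2r// ler_wpM2l// (le_trans (ler_normB _ _))// lerD2r.
  exact: rX.
apply: (@closed_comp _ _ (slab_coord p v Q s)); last exact: compact_closed_rV.
move=> y _; apply: (lipschitz_continuous_rV (c := k%:R * `|Q|)) => {}y z.
rewrite (_ : _ - _ = (y - z) *m Q).
  by rewrite (le_trans (norm_mulmx_le _ _))// mulrAC.
by rewrite /slab_coord mulmxBl opprD addrACA subrr add0r.
Qed.

Lemma lebesgue_rV_fin n (X : set 'rV[R]_n) : compact X ->
  lebesgue_rV R n X \is a fin_num.
Proof.
move=> cX; have [r r0 rX] := compact_le cX.
rewrite ge0_fin_numE//; apply: le_lt_trans (lebesgue_rV_norm_le r).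
apply: le_measure; rewrite ?inE//; [exact: compact_measurable_rV|].
exact: measurable_norm_le.
Qed.

(** Only the slices at heights between -s and s contribute to the integral. *)
Lemma slab_measure_le p v Q X (s c : R) : dot v v = 1 -> is_frame v Q ->
  compact X -> 0 <= s -> 0 <= c ->
  (forall x, X x -> `|dot (x - p) v| <= s) ->
  (forall a, `|a| <= s ->
    (lebesgue_rV R k [set y | X (slab_coord p v Q a y)] <= c%:E)%E) ->
  (lebesgue_rV R k.+1 X <= (2 * s * c)%:E)%E.
Proof.
move=> v1 vQ cX s0 c0 Xs Xc; rewrite (lebesgue_rV_slices p v1 vQ cX).
have mI : measurable (`[- s, s]%classic : set (measurableTypeR R)) by [].
apply: (@le_trans _ _ (\int[lebesgue_measure]_(a in `[(- s)%R, s]) c%:E)%E).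
  rewrite [leRHS]integral_mkcond; apply: ge0_le_integral => //.
  - by apply: measurable_slices; exact: compact_measurable_rV.
  - by apply/(measurable_restrictT _ _).1 => //.
  - move=> a _; rewrite patchE; case: ifPn => [/set_mem/=|].
      by rewrite in_itv/= -ler_norml; exact: Xc.
    rewrite notin_setE/= in_itv/= -ler_norml => /negP.
    rewrite -ltNge => sa.
    rewrite [X in lebesgue_rV R k X](_ : _ = set0) ?measure0//.
    apply/seteqP; split => y //= /Xs; rewrite dot_slab_coord//.
    by rewrite leNgt sa.
rewrite integral_cst//= lebesgue_measure_itv/= lte_fin.
case: ifPn => [_|]; first by rewrite -EFinB -EFinM lee_fin mulrC; lra.
by rewrite mule0 lee_fin !mulr_ge0.
Qed.

End slabs.

(** * Sets on which one or two affine forms are small *)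

Section affine_forms.
Context {R : realType}.

(** The half-space encoded by the pair h is the set where this form is
    nonpositive. *)
Definition aff n (h : 'rV[R]_n * R) (x : 'rV[R]_n) : R := dot h.1 x - h.2.

Lemma affE n (h : 'rV[R]_n * R) x y : aff h x = aff h y + dot h.1 (x - y).
Proof. by rewrite /aff dotBr; ring. Qed.

Lemma aff_lipschitz n (h : 'rV[R]_n * R) x y :
  `|aff h x - aff h y| <= n%:R * `|h.1| * `|x - y|.
Proof. by rewrite (affE h x y) addrAC subrr add0r; exact: norm_dot_le. Qed.

Definition euclid_norm n (a : 'rV[R]_n) : R := Num.sqrt (dot a a).

Lemma euclid_norm_gt0 n (a : 'rV[R]_n) : a != 0 -> 0 < euclid_norm a.
Proof. by move=> a0; rewrite sqrtr_gt0 lt_neqAle dot_ge0 eq_sym dot_eq0 a0. Qed.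

Lemma euclid_norm_sqr n (a : 'rV[R]_n) : euclid_norm a ^+ 2 = dot a a.
Proof. by rewrite sqr_sqrtr ?dot_ge0. Qed.

(** After normalisation by the Euclidean length of the linear part, the form
    is the signed distance to a hyperplane. *)
Lemma aff_normal n (h : 'rV[R]_n * R) : h.1 != 0 ->
  exists p v, [/\ dot v v = 1, v = (euclid_norm h.1)^-1 *: h.1, aff h p = 0 &
    forall x, dot (x - p) v = aff h x / euclid_norm h.1].
Proof.
move=> h0; have d0 := euclid_norm_gt0 h0.
have dd : dot h.1 h.1 != 0 by rewrite dot_eq0.
exists ((h.2 / dot h.1 h.1) *: h.1), ((euclid_norm h.1)^-1 *: h.1); split=> //.
- rewrite dotZl dotZr -euclid_norm_sqr; field; exact: lt0r_neq0.
- by rewrite /aff dotZr; field.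
- move=> x; rewrite dotZr dotBl dotZl mulrC; congr (_ / _).
  by rewrite /aff (dotC x); congr (_ - _); field.
Qed.

Lemma slab1_le k (h : 'rV[R]_k.+1 * R) (r : R) : h.1 != 0 ->
  exists2 C : R, 0 <= C & forall (X : set 'rV[R]_k.+1) (s : R), compact X ->
    (forall x, X x -> `|x| <= r) -> (forall x, X x -> `|aff h x| <= s) ->
    0 <= s -> (lebesgue_rV R k.+1 X <= (C * s)%:E)%E.
Proof.
move=> h0; have [p [v [v1 _ hp hv]]] := aff_normal h0.
have vQ := frameP v1; set Q := frame v in vQ.
pose r' := k.+1%:R * (r + `|p|) * `|Q^T|.
pose c := fine (lebesgue_rV R k [set y | `|y| <= r']).
have cE : lebesgue_rV R k [set y | (`|y| <= r')%R] = c%:E.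
  by rewrite fineK// ge0_fin_numE// lebesgue_rV_norm_le.
have c0 : 0 <= c by rewrite fine_ge0.
have d0 := euclid_norm_gt0 h0.
exists (2 * c / euclid_norm h.1) => [|X s cX Xr Xs s0].
  by rewrite divr_ge0// ?mulr_ge0// ltW.
have -> : 2 * c / euclid_norm h.1 * s = 2 * (s / euclid_norm h.1) * c by ring.
apply: (@slab_measure_le _ _ p v Q _ _ _ v1 vQ cX) => //; first by rewrite divr_ge0// ltW.
  by move=> x Xx; rewrite hv normrM normfV (gtr0_norm d0) ler_pM2r ?invr_gt0// Xs.
move=> a _; rewrite -cE; apply: le_measure; rewrite ?inE.
- by apply: compact_measurable_rV; exact: compact_slice.
- exact: measurable_norm_le.
- move=> y /= Xy; rewrite -(slab_coordK p a y vQ) (le_trans (norm_mulmx_le _ _))//.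
  rewrite ler_wpM2r// ler_wpM2l// (le_trans (ler_normB _ _))// lerD2r.
  exact: Xr.
Qed.

(** The pairs are compared, not only their linear parts: forms with distinct
    parallel hyperplanes count as non-proportional, and so does any form
    paired with a nonzero constant. In these cases the two forms cannot both
    be small, which is as good for slab2_le as transversality. *)
Definition nonprop n (h1 h2 : 'rV[R]_n * R) :=
  h1 <> 0 /\ forall c : R, h2 <> (c *: h1.1, c * h1.2).

(** On the hyperplane slices of the first slab the second form restricts to an
    affine form with bounded values, so each of two transverse directions
    contributes a factor s. If the restriction is constant, it is nonzero and
    the set is empty for small s. *)
Lemma slab2_le k (h1 h2 : 'rV[R]_k.+1 * R) (r : R) : nonprop h1 h2 ->
  exists C T : R, [/\ 0 <= C, 0 < T & forall (X : set 'rV[R]_k.+1) (s : R), compact X ->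
    (forall x, X x -> `|x| <= r) ->
    (forall x, X x -> `|aff h1 x| <= s /\ `|aff h2 x| <= s) ->
    0 <= s <= T -> (lebesgue_rV R k.+1 X <= (C * s ^+ 2)%:E)%E].
Proof.
case: h1 h2 => a1 b1 [a2 b2] [h10 h12].
have empty (X : set 'rV[R]_k.+1) (C s : R) : X = set0 -> 0 <= C ->
    (lebesgue_rV R k.+1 X <= (C * s ^+ 2)%:E)%E.
  by move=> -> C0; rewrite measure0 lee_fin mulr_ge0// sqr_ge0.
have [a10|a10] := eqVneq a1 0.
  have b10 : b1 != 0 by apply: contra_notN h10 => /eqP ->; rewrite a10.
  exists 0, (`|b1| / 2); split=> //; first by rewrite divr_gt0// normr_gt0.
  move=> X s cX Xr Xs /andP[s0 sb]; apply: empty => //.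
  apply/seteqP; split=> x // /Xs[+ _]; rewrite /aff/= a10.
  rewrite dot_mulmx mul0mx mxE sub0r normrN => h.
  have : 0 < `|b1| by rewrite normr_gt0.
  have := le_trans h sb; lra.
have [p [v [v1 vE hp hv]]] := @aff_normal _ (a1, b1) a10.
rewrite /= in vE hv.
have vQ := frameP v1; set Q := frame v in vQ.
have d0 := euclid_norm_gt0 a10.
pose b := a2 *m Q^T.
pose e := aff (a2, b2) p.
have a2E : a2 = dot a2 v *: v + b *m Q.
  have := slab_coord_surj 0 a2 v1 vQ; rewrite /slab_coord add0r !subr0.
  by [].
(* on a slice of the first slab, replacing the second form by its restriction
   to the hyperplane of the first form costs at most (q - 1) * s *)
pose q := 1 + `|dot a2 v| / euclid_norm a1.
have q1 : 1 <= q by rewrite lerDl divr_ge0// ltW.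
have slice (X : set 'rV[R]_k.+1) s :
    (forall x, X x -> `|aff (a1, b1) x| <= s /\ `|aff (a2, b2) x| <= s) ->
    forall a y, X (slab_coord p v Q a y) -> `|aff (b, - e) y| <= q * s.
  move=> Xs a y Xy; have [h1 h2] := Xs _ Xy.
  have as_ : `|a| <= s / euclid_norm a1.
    rewrite -(dot_slab_coord p a y v1 vQ) hv normrM normfV (gtr0_norm d0).
    by rewrite ler_pM2r ?invr_gt0.
  have -> : aff (b, - e) y = aff (a2, b2) (slab_coord p v Q a y) - a * dot a2 v.
    rewrite [X in X - _](affE _ _ p) slab_coordB/= -/e dotDr dotZr.
    rewrite (_ : dot a2 (y *m Q) = dot b y); last first.
      by rewrite !dot_mulmx trmx_mul mulmxA.
    by rewrite /aff/=; ring.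
  rewrite (le_trans (ler_normB _ _))// /q mulrDl mul1r lerD// normrM.
  by rewrite mulrAC -mulrA mulrC ler_wpM2l// mulrC.
have qs0 s : 0 <= s -> 0 <= q * s.
  by move=> s0; rewrite mulr_ge0// (le_trans _ q1).
have [b0|b0] := eqVneq b 0.
  have e0 : e != 0.
    apply/eqP => e0; apply: (h12 (dot a2 v / euclid_norm a1)) => /=.
    have a2v : a2 = (dot a2 v / euclid_norm a1) *: a1.
      by rewrite {1}a2E b0 mul0mx addr0 {2}vE scalerA.
    congr pair => //.
    move: e0 hp; rewrite /e /aff/= {1}a2v dotZl => /eqP.
    rewrite subr_eq0 => /eqP <- /eqP; rewrite subr_eq0 => /eqP -> //.
  have qp : 0 < q by rewrite (lt_le_trans _ q1).
  have e_gt0 : 0 < `|e| by rewrite normr_gt0.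
  exists 0, (`|e| / 2 / q); split=> //; first by rewrite !divr_gt0.
  move=> X s cX Xr Xs /andP[s0]; rewrite ler_pdivlMr// => sT.
  apply: empty => //; apply/seteqP; split=> x // Xx.
  rewrite (slab_coord_surj p x v1 vQ) in Xx.
  have := slice X s Xs _ _ Xx.
  rewrite /aff/= b0 dot_mulmx mul0mx mxE sub0r opprK mulrC => h.
  have := le_trans h sT; lra.
pose r' := k.+1%:R * (r + `|p|) * `|Q^T|.
have [C C0 HC] : exists2 C : R, 0 <= C & forall (Y : set 'rV[R]_k) (s : R), compact Y ->
    (forall y, Y y -> `|y| <= r') -> (forall y, Y y -> `|aff (b, - e) y| <= s) ->
    0 <= s -> (lebesgue_rV R k Y <= (C * s)%:E)%E.
  have : (b, - e).1 != 0 by [].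
  clear -b0; clearbody e; move: (b, - e); clearbody r'.
  move: r'; clear; case: k => [|k'] r' h h0; last exact: slab1_le.
  by move: h0; rewrite (_ : h.1 = 0) ?eqxx//; apply/rowP => -[].
exists (2 * C * q / euclid_norm a1), 1; split=> //.
  rewrite divr_ge0// ?mulr_ge0// ?(le_trans _ q1)//; exact: ltW.
move=> X s cX Xr Xs /andP[s0 _].
have -> : 2 * C * q / euclid_norm a1 * s ^+ 2 = 2 * (s / euclid_norm a1) * (C * (q * s)).
  by ring.
apply: (@slab_measure_le _ _ p v Q _ _ _ v1 vQ cX) => //.
- by rewrite divr_ge0// ltW.
- by rewrite mulr_ge0// qs0.
- move=> x Xx; rewrite hv normrM normfV (gtr0_norm d0) ler_pM2r ?invr_gt0//.
  exact: (Xs _ Xx).1.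
move=> a _; apply: HC; [exact: compact_slice| |exact: slice|exact: qs0].
move=> y /= Xy; rewrite -(slab_coordK p a y vQ) (le_trans (norm_mulmx_le _ _))//.
rewrite ler_wpM2r// ler_wpM2l// (le_trans (ler_normB _ _))// lerD2r.
exact: Xr.
Qed.

End affine_forms.

(** * Volume of a set described by its slices *)

Section subgraph.
Context {R : realType} {k : nat}.
Variables (A : set 'rV[R]_k) (g : 'rV[R]_k -> R).
Hypothesis mA : measurable A.
Hypothesis mg : measurable_fun A g.
Hypothesis g0 : forall y, A y -> 0 <= g y.

Let Rg := [set q : measurableTypeR R * 'rV[R]_k |
  [/\ A q.2, q.1 <= 0 & - q.1 <= g q.2]].

Let mRg : measurable Rg.
Proof.
have mg' : measurable_fun setT (g \_ A) by exact/(measurable_restrictT _ _).1.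
have -> : Rg = (setT `*` A) `&` ([set q | (q.1 : R) <= 0] `&`
    [set q | 0 <= (q.1 : R) + (g \_ A) q.2]).
  apply/seteqP; split=> -[s y] /=; rewrite patchE.
    by move=> [Ay s0 sg]; rewrite mem_set// -lerBlDl sub0r.
  by move=> [[_ Ay]]; rewrite mem_set// -lerBlDl sub0r => -[].
apply: measurableI; first exact: measurableX.
apply: measurableI.
  rewrite -[X in measurable X]setTI.
  exact: (@measurable_fun_le _ _ _ setT fst (cst 0)).
rewrite -[X in measurable X]setTI.
apply: (@measurable_fun_le _ _ _ setT (cst 0) (fun q => (q.1 : R) + (g \_ A) q.2)) => //.
apply: measurable_funD => //.
by apply: measurableT_comp => //; exact: measurable_snd.
Qed.

Lemma measurable_subgraph : measurable_fun setT (fun s : measurableTypeR R =>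
  lebesgue_rV R k [set y | [/\ A y, (s : R) <= 0 & - (s : R) <= g y]]).
Proof.
have := measurable_fun_xsection (lebesgue_rV R k) mRg.
congr (measurable_fun _ _); apply/funext => s /=; congr (lebesgue_rV R k _).
by rewrite xsectionE.
Qed.

(** Both sides are the measure of the region between the hyperplane and the
    graph of - g, integrated in the two possible orders. *)
Lemma lebesgue_rV_subgraph :
  (\int[lebesgue_measure]_s lebesgue_rV R k [set y | [/\ A y, s <= 0 & - s <= g y]%R] =
   \int[lebesgue_rV R k]_(y in A) (g y)%:E)%E.
Proof.
transitivity ((@lebesgue_measure R \x lebesgue_rV R k)%E Rg).
  apply: eq_integral => s _ /=; congr (lebesgue_rV R k _).
  by rewrite xsectionE.
transitivity ((@lebesgue_measure R \x^ lebesgue_rV R k)%E Rg).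
  apply: product_measure_unique => // X Y mX mY.
  exact: product_measure2E.
rewrite [RHS]integral_mkcond; apply: eq_integral => y _ /=.
rewrite patchE ysectionE /Rg; case: ifPn => [/set_mem Ay|].
  rewrite [X in lebesgue_measure X](_ : _ = `[- g y, 0]%classic).
    rewrite lebesgue_measure_itv/= lte_fin oppr_lt0.
    case: ltP => [_|h]; first by rewrite -EFinB opprK add0r.
    by congr EFin; apply/eqP; rewrite eq_le h g0.
  apply/seteqP; split=> s /=; rewrite in_itv/=.
    by move=> [_ s0]; rewrite lerNl => ->.
  by move=> /andP[h1 h2]; split=> //; rewrite lerNl.
rewrite notin_setE => nAy.
rewrite [X in lebesgue_measure X](_ : _ = set0) ?measure0//.
by apply/seteqP; split=> s //= -[].
Qed.

End subgraph.

Section flux_tube.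
Context {R : realType} {k : nat}.
Variables (p v : 'rV[R]_k.+1) (Q : 'M[R]_(k, k.+1)).
Hypotheses (v1 : dot v v = 1) (vQ : is_frame v Q).
Variables (A : set 'rV[R]_k) (g : 'rV[R]_k -> R) (X : set 'rV[R]_k.+1).
Variables (L : R) (rel : R -> 'rV[R]_k -> 'rV[R]_k -> Prop).
Hypotheses (mA : measurable A) (mg : measurable_fun A g).
Hypothesis g0 : forall y, A y -> 0 <= g y.
Hypothesis cA : forall s, compact [set y | [/\ A y, s <= 0 & - s <= g y]].
Hypotheses (cX : compact X) (L0 : 0 <= L).

Let slice s := [set y | X (slab_coord p v Q s y)].

(** For negative s the slice of X at height s is compared with the set of
    those y for which g y is at least - s, through a relation that multiplies
    distances by at most L; the measures of the latter sets add up to the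
    integral of g. Thus Lipschitz bounds within each slice control the volume
    of X. *)
Lemma flux_tube_le :
  (forall s y', slice s y' -> exists2 y, [/\ A y, s <= 0 & - s <= g y] & rel s y y') ->
  (forall s y z y' z', A y -> A z -> slice s y' -> slice s z' -> rel s y y' ->
    rel s z z' -> `|y' - z'| <= L * `|y - z|) ->
  (lebesgue_rV R k.+1 X <=
     (L ^+ k)%:E * \int[lebesgue_rV R k]_(y in A) (g y)%:E)%E.
Proof.
move=> Xg relL; rewrite (lebesgue_rV_slices p v1 vQ cX) -lebesgue_rV_subgraph//.
have mS := measurable_subgraph mA mg.
rewrite -ge0_integralZl//; last by rewrite lee_fin exprn_ge0.
apply: ge0_le_integral => //.
- by apply: measurable_slices; exact: compact_measurable_rV.
- exact: measurable_funeM.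
- move=> s _; apply: (lebesgue_rV_lipschitz (rel := rel s)) => //.
  + by apply: compact_measurable_rV; exact: compact_slice.
  + exact: Xg.
  + move=> y z y' z' [Ay _ _] [Az _ _]; exact: relL.
Qed.

Lemma flux_tube_ge :
  (forall s y, A y -> s <= 0 -> - s <= g y -> exists2 y', slice s y' & rel s y y') ->
  (forall s y z y' z', A y -> A z -> slice s y' -> slice s z' -> rel s y y' ->
    rel s z z' -> `|y - z| <= L * `|y' - z'|) ->
  (\int[lebesgue_rV R k]_(y in A) (g y)%:E <=
     (L ^+ k)%:E * lebesgue_rV R k.+1 X)%E.
Proof.
move=> Xg relL; rewrite (lebesgue_rV_slices p v1 vQ cX) -lebesgue_rV_subgraph//.
have mS := measurable_subgraph mA mg.
have mX : measurable_fun setT (fun s : measurableTypeR R =>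
    lebesgue_rV R k (slice s)).
  by apply: measurable_slices; exact: compact_measurable_rV.
rewrite -ge0_integralZl//; last by rewrite lee_fin exprn_ge0.
apply: ge0_le_integral => //.
- exact: measurable_funeM.
- move=> s _; apply: (lebesgue_rV_lipschitz (rel := fun y' y => rel s y y')) => //.
  + exact: compact_slice.
  + by apply: compact_measurable_rV; exact: cA.
  + by move=> y [Ay s0 sg]; have [y' Xy' yy'] := Xg s y Ay s0 sg; exists y'.
  + move=> y' z' y z Xy' Xz' [Ay _ _] [Az _ _]; exact: relL.
Qed.

End flux_tube.

(** * Mean value inequalities and Lipschitz vector fields *)

Section mean_value.
Context {R : realType}.

Lemma lipschitz_continuous_R (f : R -> R) (c : R) :
  (forall x y, `|f x - f y| <= c * `|x - y|) -> continuous f.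
Proof.
move=> fc x; apply/cvgrPdist_lt => e e0.
pose d := Num.max c 0 + 1.
have d0 : 0 < d by rewrite ltr_wpDl// le_max lexx orbT.
apply: (filterS _ (nbhsx_ballx x _ (divr_gt0 e0 d0))) => y.
rewrite -ball_normE/= ltr_pdivlMr// => xy.
rewrite (le_lt_trans (fc _ _))// (le_lt_trans _ xy)// mulrC ler_wpM2l//.
by rewrite /d ler_wpDr// le_max lexx.
Qed.

Lemma is_derive_coord m n (g : R -> 'M[R]_(m, n)) (s : R) (dg : 'M[R]_(m, n)) i j :
  is_derive s (1 : R) g dg -> is_derive s (1 : R) (fun r => g r i j) (dg i j).
Proof.
move=> gs; have gd := @ex_derive _ _ _ _ _ _ _ gs.
apply: DeriveDef; first by move/derivable_mxP : gd; exact.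
by rewrite -(@derive_val _ _ _ _ _ _ _ gs) derive_mx// mxE.
Qed.

Lemma mean_value_le m (g dg : R -> 'rV[R]_m) (w : 'rV[R]_m) (c a b : R) :
  (forall s, a <= s <= b -> is_derive s (1 : R) g (dg s)) ->
  (forall s, a <= s <= b -> `|dg s - w| <= c) -> a <= b ->
  `|g b - g a - (b - a) *: w| <= c * (b - a).
Proof.
move=> gd dgc ab.
have c0 : 0 <= c by rewrite (le_trans _ (dgc a _))// lexx.
apply: norm_le_coord => [|i j]; first by rewrite mulr_ge0// subr_ge0.
have gij s : s \in `[a, b] -> is_derive s (1 : R) (fun r => g r i j) (dg s i j).
  by rewrite in_itv/= => /gd; exact: is_derive_coord.
have H1 s : s \in `]a, b[ -> is_derive s (1 : R) (fun r => g r i j) (dg s i j).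
  by move=> sab; apply: gij; exact: subset_itv_oo_cc.
have H2 : {within `[a, b], continuous (fun r => g r i j)}.
  apply: derivable_within_continuous => r /gij h.
  exact: (@ex_derive _ _ _ _ _ _ _ h).
have [s sab gE] := MVT_segment ab H1 H2.
rewrite in_itv/= in sab.
have -> : (g b - g a - (b - a) *: w) i j = (dg s - w) i j * (b - a).
  by rewrite !mxE gE; ring.
rewrite normrM (ger0_norm (_ : 0 <= b - a)) ?subr_ge0// ler_wpM2r ?subr_ge0//.
by rewrite (le_trans (le_coord_norm _ _ _))// dgc.
Qed.

Lemma mean_value_norm_le m (g dg : R -> 'rV[R]_m) (w : 'rV[R]_m) (c T a b : R) :
  (forall s, `|s| <= T -> is_derive s (1 : R) g (dg s)) ->
  (forall s, `|s| <= T -> `|dg s - w| <= c) -> `|a| <= T -> `|b| <= T ->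
  `|g b - g a - (b - a) *: w| <= c * `|b - a|.
Proof.
move=> gd dgc aT bT; move: (aT) (bT); rewrite !ler_norml => /andP[? ?] /andP[? ?].
have [ab|/ltW ba] := leP a b.
  rewrite (ger0_norm (_ : 0 <= b - a)) ?subr_ge0//.
  apply: mean_value_le => // s /andP[? ?].
    by apply: gd; rewrite ler_norml; apply/andP; split; lra.
  by apply: dgc; rewrite ler_norml; apply/andP; split; lra.
rewrite [X in c * X]distrC (ger0_norm (_ : 0 <= a - b)) ?subr_ge0//.
rewrite -normrN (_ : - (_ - _ - _) = g a - g b - (a - b) *: w); last first.
  by apply/matrixP => i j; rewrite !mxE; ring.
apply: mean_value_le => // s /andP[? ?].
  by apply: gd; rewrite ler_norml; apply/andP; split; lra.
by apply: dgc; rewrite ler_norml; apply/andP; split; lra.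
Qed.

End mean_value.

Section smooth_lipschitz.
Context {R : realType} {k : nat}.
Local Notation V := 'rV[R]_k.+1.
Implicit Types (M : set V) (F : V -> V).

Lemma norm_lt_coord m n (x : 'M[R]_(m, n)) (c : R) :
  0 < c -> (forall i j, `|x i j| < c) -> `|x| < c.
Proof.
move=> c0 xc; rewrite /Num.norm/= mx_normrE.
by apply: bigmax_lt => // i _; exact: xc.
Qed.

Lemma is_derive_line F (z v : V) (s : R) : derivable F (z + s *: v) v ->
  is_derive s (1 : R) (fun r => F (z + r *: v)) ('D_v F (z + s *: v)).
Proof.
move=> Fd.
have E : (fun h : R => h^-1 *: (((fun r => F (z + r *: v)) \o shift s) (h *: 1) -
      F (z + s *: v))) =
    (fun h : R => h^-1 *: ((F \o shift (z + s *: v)) (h *: v) - F (z + s *: v))).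
  apply/funext => h /=; congr (_ *: (F _ - _)).
  by rewrite scalerDl [h *: 1]mulr1 addrCA addrA.
apply: DeriveDef; first by rewrite /derivable E.
by rewrite /derive E.
Qed.

(** Going from x to y one coordinate at a time stays in the sup-norm ball and
    involves only the partial derivatives along the axes. *)
Lemma smooth_locally_lipschitz (U : set V) F (x0 : V) : open U -> U x0 ->
  smooth_on U F -> exists r K : R, [/\ 0 < r, 0 <= K &
    forall x y, `|x - x0| < r -> `|y - x0| < r -> `|F y - F x| <= K * `|y - x|].
Proof.
move=> oU Ux0 sF.
pose e (j : 'I_k.+1) : V := delta_mx 0 j.
pose K := \big[Num.max/0]_j (`|'D_(e j) F x0| + 1).
have K0 : 0 <= K by exact: bigmax_ge_id.
have [r /= r0 Hr] : exists2 r : R, 0 < r & forall z : V, `|z - x0| < r ->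
    U z /\ forall j, `|'D_(e j) F z| <= K.
  have : nbhs (x0 : V) (fun z : V => U z /\ forall j, `|'D_(e j) F z| <= K).
    apply: filterI; first exact: open_nbhs_nbhs.
    apply: (@filter_forall _ _ (fun j (z : V) => `|'D_(e j) F z| <= K) (nbhs (x0 : V))) => j.
    have [+ _] := sF [:: e j] x0 Ux0.
    move=> /(@cvgrPdist_lt _ _ _ (nbhs (x0 : V))) /(_ 1 ltr01).
    apply: filterS => z /= zx; apply: (@le_trans _ _ (`|'D_(e j) F x0| + 1)).
      move: zx; move: ('D_(e j) F z) ('D_(e j) F x0) => a b ba.
      have -> : a = b - (b - a) by rewrite opprB addrC subrK.
      by rewrite (le_trans (ler_normB _ _))// lerD2l ltW.
    exact: (le_bigmax _ (fun j => `|'D_(e j) F x0| + 1) j).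
  move=> /nbhs_ballP[r /= r0 xr]; exists r => // z zx; apply: xr.
  by rewrite -ball_normE/= distrC.
exists r, (k.+1%:R * K); split => // [|x y xr yr]; first by rewrite mulr_ge0.
pose z (j : nat) : V := \row_i (if (i < j)%N then y 0 i else x 0 i).
have z0 : z 0%N = x by apply/rowP => i; rewrite mxE.
have zk : z k.+1 = y by apply/rowP => i; rewrite mxE ltn_ord.
have step (j : 'I_k.+1) : `|F (z j.+1) - F (z j)| <= K * `|y - x|.
  pose z' : V := z j - x 0 j *: e j.
  have zE i s : (z' + s *: e j) 0 i = if i == j then s else z j 0 i.
    rewrite !mxE eqxx/=; have [->|] := eqVneq i j; last by rewrite !mulr0 subr0 addr0.
    by rewrite ltnn /= !mulr1 subrr add0r.
  have seg s : `|s - x0 0 j| < r -> `|z' + s *: e j - x0| < r.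
    move=> sr; apply: norm_lt_coord => // i' i; rewrite ord1 mxE zE [X in _ + X]mxE.
    have [->|_] := eqVneq i j; first by [].
    rewrite mxE; case: ifP => _.
      by apply: le_lt_trans yr; have := le_coord_norm (y - x0) 0 i; rewrite !mxE.
    by apply: le_lt_trans xr; have := le_coord_norm (x - x0) 0 i; rewrite !mxE.
  have mvt a b : a <= b -> `|a - x0 0 j| < r -> `|b - x0 0 j| < r ->
      `|F (z' + b *: e j) - F (z' + a *: e j)| <= K * `|b - a|.
    move=> ab ar br; rewrite (ger0_norm (_ : 0 <= b - a)) ?subr_ge0//.
    have inr s : a <= s <= b -> `|z' + s *: e j - x0| < r.
      move=> /andP[as_ sb]; apply: seg; move: ar br; rewrite !ltr_norml.
      by move=> /andP[? ?] /andP[? ?]; apply/andP; split; lra.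
    have := @mean_value_le R k.+1 (fun s => F (z' + s *: e j))
      (fun s => 'D_(e j) F (z' + s *: e j)) 0 K a b.
    rewrite scaler0 subr0; apply=> // s /inr/Hr[Us Ks].
      by apply: is_derive_line; have [_] := sF [::] _ Us; exact.
    by rewrite subr0.
  have xjr : `|x 0 j - x0 0 j| < r.
    by apply: le_lt_trans xr; have := le_coord_norm (x - x0) 0 j; rewrite !mxE.
  have yjr : `|y 0 j - x0 0 j| < r.
    by apply: le_lt_trans yr; have := le_coord_norm (y - x0) 0 j; rewrite !mxE.
  have -> : z j.+1 = z' + y 0 j *: e j.
    apply/rowP => i; rewrite zE mxE ltnS leq_eqVlt val_eqE.
    by have [->|_] := eqVneq i j; rewrite ?mxE.
  have -> : z j = z' + x 0 j *: e j by rewrite subrK.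
  apply: (@le_trans _ _ (K * `|y 0 j - x 0 j|)).
    have [xy|/ltW yx] := leP (x 0 j) (y 0 j); first exact: mvt.
    by rewrite distrC [X in K * X]distrC; exact: mvt.
  rewrite ler_wpM2l//; have := le_coord_norm (y - x) 0 j; by rewrite !mxE.
rewrite -zk -[in X in `|_ - X|]z0 -(telescope_sumr (fun j => F (z j)))//.
rewrite big_mkord (le_trans (ler_norm_sum _ _ _))//.
rewrite -mulrA mulr_natl -[X in _ <= _ *+ X](card_ord k.+1) -sumr_const.
by apply: ler_sum => j _; rewrite zk; exact: step.
Qed.

Lemma smooth_near_bounded M F : compact M -> smooth_near M F ->
  exists2 C : R, 0 < C & forall x, M x -> `|F x| <= C.
Proof.
move=> cM [U [oU MU sF]].
have cF : {within M, continuous F}.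
  apply: continuous_in_subspaceT => x /set_mem/MU Ux.
  by have [] := sF [::] x Ux.
have [r r0 rF] := compact_le (continuous_compact cF cM).
by exists r => // x Mx; apply: rF; exists x.
Qed.

(** M is not convex, so a segment between two points of M may leave the domain
    of F: the local Lipschitz constants serve for close pairs, and the bound
    on F for distant ones. *)
Lemma smooth_near_lipschitz M F : compact M -> smooth_near M F ->
  exists2 L : R, 0 < L & forall x y, M x -> M y -> `|F x - F y| <= L * `|x - y|.
Proof.
move=> cM sMF; have [C C0 CF] := smooth_near_bounded cM sMF.
have [U [oU MU sF]] := sMF.
have /compact_near_coveringP H := cM.
have := H R (+oo%R) (fun (L : R) (x : V) => forall y, M x -> M y ->
  `|F x - F y| <= L * `|x - y|) _.
move=> /(_ _)[].
  move=> x0 Mx0.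
  have [r [K [r0 K0 FK]]] := smooth_locally_lipschitz oU (MU _ Mx0) sF.
  have r20 : 0 < r / 2 by rewrite divr_gt0.
  exists (ball (x0 : V) (r / 2), [set L : R | K + 2 * C / (r / 2) <= L]).
    split; first exact: nbhsx_ballx.
    by apply: nbhs_pinfty_ge; exact: num_real.
  move=> [x L] /=; rewrite -ball_normE/= => -[x0x KL] y Mx My.
  have CR : 0 <= 2 * C / (r / 2) by rewrite divr_ge0// ?mulr_ge0// ltW.
  have [xy|xy] := ltP `|x - y| (r / 2).
    apply: (@le_trans _ _ (K * `|x - y|)).
      apply: FK; last by rewrite distrC (lt_trans x0x)// gtr_pMr// invf_lt1// ltr1n.
      rewrite -(subrK x y) -addrA (le_lt_trans (ler_normD _ _))// [ltRHS]splitr.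
      by rewrite ltrD// distrC.
    by rewrite ler_wpM2r// (le_trans _ KL)// lerDl.
  apply: (@le_trans _ _ (2 * C)).
    by rewrite (le_trans (ler_normB _ _))// mulr_natl mulr2n lerD// CF.
  apply: (@le_trans _ _ (2 * C / (r / 2) * `|x - y|)).
    by rewrite mulrAC ler_pdivlMr// ler_wpM2l// mulr_ge0// ltW.
  by rewrite ler_wpM2r// (le_trans _ KL)// lerDr.
move=> r [_ rF]; exists (Num.max r 0 + 1); first by rewrite ltr_wpDl// le_max lexx orbT.
by move=> x y Mx My; apply: rF => //; rewrite ltr_pwDr// le_max lexx.
Qed.

End smooth_lipschitz.

(** * Short-time estimates for the flow *)

Section flow.
Context {R : realType} {k : nat}.
Local Notation V := 'rV[R]_k.+1.
Variables (M : set V) (F : V -> V) (Phi : R -> V -> V) (C L : R).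
Hypothesis (flowP : is_flow M F Phi).
Hypotheses (C0 : 0 < C) (L0 : 0 < L).
Hypothesis F_le : forall x, M x -> `|F x| <= C.
Hypothesis F_lip : forall x y, M x -> M y -> `|F x - F y| <= L * `|x - y|.

Lemma flow_speed x s r : M x -> `|Phi s x - Phi r x| <= C * `|s - r|.
Proof.
move=> Mx.
have := @mean_value_norm_le R _ (fun s => Phi s x) (fun s => F (Phi s x)) 0 C
  (Num.max `|s| `|r|) r s.
rewrite scaler0 subr0; apply.
- by move=> q _; exact: (flow_ode flowP).
- by move=> q _; rewrite subr0 F_le//; exact: (flow_in flowP).
- by rewrite le_max lexx orbT.
- by rewrite le_max lexx.
Qed.

(** Short enough for the largest distance between two trajectories to be
    controlled by the initial one: L times this time is 1/4. *)
Definition flow_time := (4 * L)^-1.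
Local Notation T0 := flow_time.

Lemma flow_time_gt0 : 0 < T0.
Proof. by rewrite invr_gt0 mulr_gt0. Qed.

(** At the time q when the distance between the trajectories is largest, the
    mean value inequality bounds that distance by the initial distance plus a
    quarter of itself. *)
Lemma flow_dist x y s : M x -> M y -> `|s| <= T0 ->
  `|Phi s x - Phi s y| <= 2 * `|x - y|.
Proof.
move=> Mx My sT.
pose g s := Phi s x - Phi s y.
have cg : continuous (fun s => `|g s|).
  apply: (@lipschitz_continuous_R _ _ (C + C)) => q r.
  rewrite (le_trans (ler_dist_dist _ _))//.
  rewrite (_ : _ - _ = (Phi q x - Phi r x) - (Phi q y - Phi r y)); last first.
    by apply/matrixP => i j; rewrite !mxE; ring.
  by rewrite (le_trans (ler_normB _ _))// mulrDl lerD// flow_speed.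
have T00 : - T0 <= T0.
  by rewrite (@le_trans _ _ 0)// ?oppr_le0 ltW// flow_time_gt0.
have [q] := @EVT_max R (fun s => `|g s|) (- T0) T0 T00 (continuous_subspaceT cg).
rewrite in_itv/= -ler_norml => qT qmax.
have gq r : `|r| <= T0 -> `|g r| <= `|g q|.
  by move=> rT; apply: qmax; rewrite in_itv/= -ler_norml.
have := @mean_value_norm_le R _ g (fun s => F (Phi s x) - F (Phi s y)) 0
  (L * `|g q|) T0 0 q.
rewrite scaler0 !subr0 /g !(flow0 flowP)// -/(g q) => H.
apply: (le_trans (gq s sT)).
suff : `|g q - (x - y)| <= `|g q| / 2.
  move=> h; have := ler_normD (g q - (x - y)) (x - y); rewrite subrK; lra.
apply: (le_trans (H _ _ _ qT)).
- move=> r _; apply: is_deriveB; exact: (flow_ode flowP).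
- move=> r rT; rewrite subr0; apply: (le_trans (F_lip _ _)).
  + exact: (flow_in flowP).
  + exact: (flow_in flowP).
  + by rewrite (ler_wpM2l (ltW L0))//; exact: gq.
- by rewrite normr0 ltW// flow_time_gt0.
apply: (@le_trans _ _ (L * `|g q| * T0)).
  by rewrite ler_wpM2l// mulr_ge0// ltW.
have -> : L * `|g q| * T0 = `|g q| / 4 by rewrite /T0; field; exact: lt0r_neq0.
have := normr_ge0 (g q); lra.
Qed.

Lemma flow_near_id x y s : M x -> M y -> `|s| <= T0 ->
  `|Phi s x - Phi s y - (x - y)| <= 2 * L * `|s| * `|x - y|.
Proof.
move=> Mx My sT.
have := @mean_value_norm_le R _ (fun s => Phi s x - Phi s y)
  (fun s => F (Phi s x) - F (Phi s y)) 0 (L * (2 * `|x - y|)) T0 0 s.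
rewrite scaler0 !subr0 !(flow0 flowP)// => H.
rewrite (le_trans (H _ _ _ sT))//.
- move=> r _; apply: is_deriveB; exact: (flow_ode flowP).
- move=> r rT; rewrite subr0; apply: (le_trans (F_lip _ _)).
  + exact: (flow_in flowP).
  + exact: (flow_in flowP).
  + by rewrite (ler_wpM2l (ltW L0))//; exact: flow_dist.
- by rewrite normr0 ltW// flow_time_gt0.
- by rewrite le_eqVlt; apply/orP; left; apply/eqP; ring.
Qed.

(** On a time interval of length 2T the field seen along a trajectory varies
    by at most L * (C * (2 * T)). *)
Lemma flow_linear x (T s r q : R) : M x -> `|s| <= T -> `|r| <= T -> `|q| <= T ->
  `|Phi s x - Phi r x - (s - r) *: F (Phi q x)| <= L * (C * (2 * T)) * `|s - r|.
Proof.
move=> Mx sT rT qT.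
apply: (@mean_value_norm_le R _ (fun s => Phi s x) (fun s => F (Phi s x))) (rT) (sT).
  by move=> a _; exact: (flow_ode flowP).
move=> a aT; apply: (le_trans (F_lip _ _)).
- exact: (flow_in flowP).
- exact: (flow_in flowP).
- rewrite (ler_wpM2l (ltW L0))//; apply: (le_trans (flow_speed _ _ Mx)).
  rewrite (ler_wpM2l (ltW C0))//; move: aT qT; rewrite !ler_norml.
  by move=> /andP[? ?] /andP[? ?]; apply/andP; split; lra.
Qed.

(** If y minimises the distance of Phi s y to q on a small closed ball around
    x, then Phi s y = q: moving y by q - Phi s y would at least halve that
    distance, since Phi s is close to a translation. So Phi s maps this ball
    onto a neighbourhood of Phi s x. *)
Lemma flow_interior x s : `|s| <= T0 -> interior M x -> interior M (Phi s x).
Proof.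
move=> sT /nbhs_ballP[e /= e0 xM].
have Mx : M x by apply: xM; exact: ballxx.
pose r := e / 2.
have r0 : 0 < r by rewrite divr_gt0.
have cM y : `|y - x| <= r -> M y.
  move=> yx; apply: xM; rewrite -ball_normE/= distrC (le_lt_trans yx)//.
  by rewrite /r gtr_pMr// invf_lt1// ltr1n.
have r20 : 0 < r / 2 by rewrite divr_gt0.
apply: (filterS _ (nbhsx_ballx (Phi s x) _ r20)) => q.
rewrite -ball_normE/= => sq.
pose K : set V := [set y | `|y - x| <= r].
have cK : compact K.
  apply: bounded_closed_compact.
    exists (`|x| + r); split; first exact: num_real.
    move=> c rc y /= yr; rewrite (le_trans _ (ltW rc))// -(subrK x y) addrC.
    by rewrite (le_trans (ler_normD _ _))// lerD2l.
  apply: (@closed_comp _ _ (fun y : V => `|y - x|) [set c | c <= r]); last exact: closed_le.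
  move=> y _; apply: (lipschitz_continuous_rV (c := 1)) => {}y z.
  by rewrite mul1r (le_trans (ler_dist_dist _ _))// opprB addrA subrK.
have cf : {within K, continuous (fun y => `|Phi s y - q|)}.
  apply/subspace_continuousP => y Ky.
  apply/cvgrPdist_lt => d d0.
  have d20 : 0 < d / 2 by rewrite divr_gt0.
  rewrite near_withinE; apply: (filterS _ (nbhsx_ballx y _ d20)) => z.
  rewrite -ball_normE/= => yz Kz.
  rewrite (le_lt_trans (ler_dist_dist _ _))// opprB addrA subrK.
  rewrite (le_lt_trans (flow_dist (cM _ Ky) (cM _ Kz) sT))//.
  by rewrite mulrC -ltr_pdivlMr.
have Kx : K x by rewrite /K/= subrr normr0 ltW.
have [y /set_mem Ky ymin] := compact_EVT_min (ex_intro _ x Kx) cK cf.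
have near_id z z' : K z -> K z' -> `|Phi s z - Phi s z' - (z - z')| <= `|z - z'| / 2.
  move=> Kz Kz'; rewrite (le_trans (flow_near_id (cM _ Kz) (cM _ Kz') sT))//.
  rewrite mulrC ler_wpM2l// (@le_trans _ _ (2 * L * T0))//.
    by rewrite ler_wpM2l// mulr_ge0// ltW.
  by rewrite le_eqVlt; apply/orP; left; apply/eqP; rewrite /T0; field; exact: lt0r_neq0.
pose z := y + (q - Phi s y).
have Kz : K z.
  rewrite /K/=.
  have -> : z - x = (q - Phi s x) - (Phi s y - Phi s x - (y - x)).
    by apply/matrixP => i j; rewrite !mxE; ring.
  rewrite (le_trans (ler_normB _ _))// [leRHS]splitr lerD//.
    by rewrite distrC ltW.
  by rewrite (le_trans (near_id _ _ Ky Kx))// ler_pM2r// invr_gt0.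
have := ymin z; rewrite inE => /(_ Kz) h1.
have h2 : `|Phi s z - q| <= `|Phi s y - q| / 2.
  have -> : Phi s z - q = Phi s z - Phi s y - (z - y).
    by apply/matrixP => i j; rewrite !mxE; ring.
  rewrite (le_trans (near_id _ _ Kz Ky))// ler_pM2r ?invr_gt0//.
  by rewrite /z addrAC subrr add0r distrC.
have /eqP : `|Phi s y - q| = 0.
  by apply/eqP; rewrite eq_le normr_ge0 andbT; lra.
rewrite normr_eq0 subr_eq0 => /eqP <-.
by apply: (flow_in flowP); exact: cM.
Qed.

Lemma compact_flow_out (E : set V) (T : R) : compact E -> E `<=` M -> T <= T0 ->
  compact [set x | exists y s, [/\ E y, 0 <= s <= T & x = Phi (- s) y]].
Proof.
move=> cE EM TT.
pose f (q : V * R) := Phi (- q.2) q.1.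
have -> : [set x | exists y s, [/\ E y, 0 <= s <= T & x = Phi (- s) y]] =
    f @` (E `*` `[0, T]).
  apply/seteqP; split=> [x [y [s [Ey sT ->]]]|_ [[y s] /= [Ey sT] <-]].
    by exists (y, s) => //; split.
  by exists y, s; split => //; move: sT; rewrite in_itv.
apply: continuous_compact; last by apply: compact_setX => //; exact: segment_compact.
apply/subspace_continuousP => -[y s] [/= Ey]; rewrite in_itv/= => /andP[s0 sT].
apply/(@cvgrPdist_lt _ _ _ (within _ (nbhs ((y, s) : V * R)))) => d d0.
have d20 : 0 < d / 2 / 2 by rewrite !divr_gt0.
have d30 : 0 < d / 2 / C by rewrite !divr_gt0.
rewrite near_withinE.
exists (ball y (d / 2 / 2), ball s (d / 2 / C)); first by split; exact: nbhsx_ballx.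
move=> [z r] /=; rewrite -!ball_normE/= => -[yz sr] [Ez].
rewrite in_itv/= => /andP[r0 rT]; rewrite /f/=.
rewrite (_ : _ - _ = (Phi (- s) y - Phi (- r) y) + (Phi (- r) y - Phi (- r) z)); last first.
  by rewrite addrA subrK.
rewrite (le_lt_trans (ler_normD _ _))// [ltRHS]splitr ltr_leD//.
  rewrite (le_lt_trans (flow_speed _ _ (EM _ Ey)))//.
  by rewrite mulrC -ltr_pdivlMr// opprK addrC distrC.
rewrite (le_trans (flow_dist (EM _ Ey) (EM _ Ez) _))//.
  by rewrite normrN ger0_norm// (le_trans rT).
by rewrite mulrC -ler_pdivlMr// ltW.
Qed.

End flow.

(** * Trajectories and polyhedra *)

Section polyhedra.
Context {R : realType} {k : nat}.
Local Notation V := 'rV[R]_k.+1.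
Local Notation form := (V * R)%type.
Implicit Types (h l : form) (s : seq (seq form)).

Definition polyset s : set V :=
  [set x | has (fun c => all (fun h => dot h.1 x <= h.2) c) s].

Lemma polyset_transfer s (x z : V) : polyset s x ->
  (forall h, h \in flatten s -> aff h x <= 0 -> aff h z <= 0) -> polyset s z.
Proof.
move=> /hasP[c cs /allP cx] xz; apply/hasP; exists c => //; apply/allP => h hc.
rewrite -subr_le0; apply: xz; last by rewrite subr_le0 cx.
by apply/flattenP; exists c.
Qed.

Lemma aff_scale (c : R) h x : aff (c *: h.1, c * h.2) x = c * aff h x.
Proof. by rewrite /aff/= dotZl mulrBr. Qed.

Lemma nonpropPn l h : l <> 0 -> ~ nonprop l h -> exists c : R, h = (c *: l.1, c * l.2).
Proof.
move=> l0 nlh; apply: contrapT => nex; apply: nlh; split=> // c hc.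
by apply: nex; exists c.
Qed.

Lemma aff0 x : aff (0 : form) x = 0.
Proof. by rewrite /aff/= dot_mulmx mul0mx mxE subrr. Qed.

Section curve.
Variables (g : R -> V) (c t : R).
Hypothesis g_lip : forall r r', `|g r - g r'| <= c * `|r - r'|.

Definition touches h := exists2 r, 0 <= r <= t & aff h (g r) = 0.

Let cont_aff h : continuous (fun r => aff h (g r)).
Proof.
apply: (@lipschitz_continuous_R _ _ (k.+1%:R * `|h.1| * c)) => r r'.
rewrite (le_trans (aff_lipschitz _ _ _))//.
by rewrite -[leRHS]mulrA ler_wpM2l// mulr_ge0.
Qed.

Lemma untouched_le0 h a b : ~ touches h -> 0 <= a <= t -> 0 <= b <= t ->
  aff h (g a) <= 0 -> aff h (g b) <= 0.
Proof.
move=> nth /andP[a0 at_] /andP[b0 bt] ha; rewrite leNgt; apply/negP => hb.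
apply: nth; have [ab|/ltW ba] := leP a b.
  have [|r] := @IVT _ _ a b 0 ab (continuous_subspaceT (@cont_aff h)).
    by rewrite ge_min ha/= le_max (ltW hb) orbT.
  rewrite in_itv/= => /andP[ar rb] hr; exists r => //.
  by rewrite (le_trans a0)// (le_trans rb).
have [|r] := @IVT _ _ b a 0 ba (continuous_subspaceT (@cont_aff h)).
  by rewrite ge_min ha orbT/= le_max (ltW hb).
rewrite in_itv/= => /andP[ar rb] hr; exists r => //.
by rewrite (le_trans b0)// (le_trans rb).
Qed.

Lemma untouched_same_sign h a b : ~ touches h -> 0 <= a <= t -> 0 <= b <= t ->
  0 < aff h (g a) * aff h (g b).
Proof.
move=> nth a0t b0t.
have nz r : 0 <= r <= t -> aff h (g r) != 0.
  by move=> rt; apply/eqP => hr; apply: nth; exists r.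
have [ha|ha] := leP (aff h (g a)) 0.
  have hb := untouched_le0 nth a0t b0t ha.
  by rewrite nmulr_rgt0 lt_neqAle ?nz.
rewrite pmulr_rgt0// ltNge; apply/negP => hb.
by have := untouched_le0 nth b0t a0t hb; rewrite leNgt ha.
Qed.

(** Suppose that all forms touched along the curve are proportional to one
    form. When that form vanishes, all touched forms vanish, and the others
    have the same sign as at both ends; hence the inequalities satisfied at
    time 0 for s1 and at time t for s2 all hold at that moment. *)
Lemma polyset_crossing s1 s2 : 0 <= t -> polyset s1 (g 0) -> polyset s2 (g t) ->
  (exists2 r, 0 <= r <= t & polyset s1 (g r) /\ polyset s2 (g r)) \/
  (exists h1 h2, [/\ h1 \in flatten s1 ++ flatten s2,
     h2 \in flatten s1 ++ flatten s2, nonprop h1 h2, touches h1 & touches h2]).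
Proof.
move=> t0 g0 gt; apply: contrapT => /not_orP[nhit nbad].
have t00 : 0 <= (0 : R) <= t by rewrite lexx.
have ttt : 0 <= t <= t by rewrite t0 lexx.
have key r a s : 0 <= r <= t -> 0 <= a <= t ->
    {subset flatten s <= flatten s1 ++ flatten s2} ->
    (forall h, h \in flatten s1 ++ flatten s2 -> touches h -> aff h (g r) <= 0) ->
    polyset s (g a) -> polyset s (g r).
  move=> rt at_ ss H ga; apply: (polyset_transfer ga) => h hs ha.
  have [th|nth] := pselect (touches h); first by apply: H => //; exact: ss.
  exact: (untouched_le0 nth at_ rt ha).
have sub1 : {subset flatten s1 <= flatten s1 ++ flatten s2}.
  by move=> h; rewrite mem_cat => ->.
have sub2 : {subset flatten s2 <= flatten s1 ++ flatten s2}.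
  by move=> h; rewrite mem_cat => ->; rewrite orbT.
have [[h0 [h0s h00 [r rt hr]]]|none] := pselect (exists h0,
    [/\ h0 \in flatten s1 ++ flatten s2, h0 <> 0 & touches h0]).
  have H h : h \in flatten s1 ++ flatten s2 -> touches h -> aff h (g r) <= 0.
    move=> hs th; have [hh|/(nonpropPn h00)[d ->]] := pselect (nonprop h0 h).
      by exfalso; apply: nbad; exists h0, h; split=> //; exists r.
    by rewrite aff_scale hr mulr0.
  by apply: nhit; exists r => //; split; [exact: key sub1 H g0|exact: key sub2 H gt].
apply: nhit; exists 0 => //; split=> //; apply: (key 0 t) gt => // h hs th.
have [->|h0] := pselect (h = 0); first by rewrite aff0.
by exfalso; apply: none; exists h.
Qed.

End curve.

(** Trajectories that come near two distinct bounding hyperplanes in time t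
    start in a set of volume O(t^2), which is negligible compared with a flux
    of order t. *)
Lemma two_forms_measure (M : set V) (ps : seq (form * form)) (c : R) : compact M ->
  (forall q, q \in ps -> nonprop q.1 q.2) -> 0 <= c ->
  exists K T : R, [/\ 0 <= K, 0 < T & forall t, 0 <= t <= T ->
    exists Z : set V, [/\ compact Z, (lebesgue_rV R k.+1 Z <= (K * t ^+ 2)%:E)%E &
      forall x q, M x -> q \in ps -> `|aff q.1 x| <= c * t -> `|aff q.2 x| <= c * t ->
        Z x]].
Proof.
move=> cM; have [r r0 rM] := compact_le cM.
elim: ps => [|q ps IH] psP c0.
  exists 0, 1; split=> // t _; exists set0; split=> //; first exact: compact0.
  by rewrite measure0 mul0r.
have [|K [T [K0 T0 KT]]] := IH _ c0.
  by move=> q' q'ps; apply: psP; rewrite in_cons q'ps orbT.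
have qP : nonprop q.1 q.2 by apply: psP; rewrite mem_head.
have [C [T' [C0 T'0 CT]]] := slab2_le r qP.
have c10 : 0 < c + 1 by rewrite ltr_wpDl.
exists (K + C * (c + 1) ^+ 2), (Num.min T (T' / (c + 1))); split.
- by rewrite addr_ge0// mulr_ge0// sqr_ge0.
- by rewrite lt_min T0 divr_gt0.
move=> t /andP[t0]; rewrite le_min ler_pdivlMr// => /andP[tT tT'].
have [|Z [cZ ZK ZP]] := KT t; first by rewrite t0.
pose Y := [set x | [/\ M x, `|aff q.1 x| <= (c + 1) * t & `|aff q.2 x| <= (c + 1) * t]].
have cY : compact Y.
  have closedS (h : form) : closed [set x : V | `|aff h x| <= (c + 1) * t].
    apply: (@closed_comp _ _ (fun x : V => `|aff h x|) [set a | a <= (c + 1) * t]);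
      last exact: closed_le.
    move=> x _; apply: (lipschitz_continuous_rV (c := k.+1%:R * `|h.1|)) => {}x y.
    exact: le_trans (ler_dist_dist _ _) (aff_lipschitz _ _ _).
  have -> : Y = (M `&` [set x : V | `|aff q.1 x| <= (c + 1) * t]) `&`
      [set x : V | `|aff q.2 x| <= (c + 1) * t].
    by apply/seteqP; split=> [x [? ? ?]|x [[? ?] ?]]; split.
  by apply: compact_closedI => //; apply: compact_closedI.
exists (Z `|` Y); split.
- exact: compactU.
- have mZ := compact_measurable_rV cZ; have mY := compact_measurable_rV cY.
  apply: (@le_trans _ _ (lebesgue_rV R k.+1 Z + lebesgue_rV R k.+1 Y)%E).
    exact: measureU2.
  rewrite mulrDl EFinD leeD// -mulrA -exprMn.
  apply: CT => //.
  + by move=> x [Mx _ _]; exact: rM.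
  + by move=> x [].
  + by rewrite mulr_ge0 ?(ltW c10)//= mulrC.
- move=> x q' Mx; rewrite in_cons => /predU1P[->|q'ps] h1 h2.
    right; split=> //; [apply: (le_trans h1)|apply: (le_trans h2)];
      by rewrite ler_wpM2r// lerDl.
  by left; exact: (ZP x q').
Qed.

(** Two independent vectors of the orthogonal complement of W, taken with
    their values at p. *)
Lemma codim2_forms (p : V) (W : 'M[R]_k.+1) : ((\rank W).+2 <= k.+1)%N ->
  exists h1 h2 : form, nonprop h1 h2 /\
    forall x, (x - p <= W)%MS -> aff h1 x = 0 /\ aff h2 x = 0.
Proof.
move=> rW; pose N := row_base (kermx W^T).
have rN : (1 < \rank (kermx W^T))%N.
  by rewrite mxrank_ker mxrank_tr ltn_subRL addn1.
pose i0 : 'I_(\rank (kermx W^T)) := Ordinal (ltnW rN).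
pose i1 : 'I_(\rank (kermx W^T)) := Ordinal rN.
have NW : N *m W^T = 0.
  by apply/sub_kermxP; rewrite eq_row_base.
have Nfree : row_free N by exact: row_base_free.
exists (row i0 N, dot (row i0 N) p), (row i1 N, dot (row i1 N) p); split.
  split.
    move=> [r0 _].
    have : (delta_mx 0 i0 : 'rV[R]_(\rank (kermx W^T))) *m N = 0 *m N by rewrite -rowE r0 mul0mx.
    move=> /(row_free_inj Nfree) /(congr1 (fun A : 'rV_ _ => A 0 i0)).
    by rewrite !mxE !eqxx => /eqP; rewrite oner_eq0.
  move=> c [r1 _].
  have : (delta_mx 0 i1 : 'rV[R]_(\rank (kermx W^T))) *m N =
      (c *: delta_mx 0 i0) *m N.
    by rewrite -scalemxAl -!rowE.
  move=> /(row_free_inj Nfree) /(congr1 (fun A : 'rV_ _ => A 0 i1)).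
  by rewrite !mxE !eqxx/= mulr0 => /eqP; rewrite oner_eq0.
move=> x /submxP[D xD].
have E i : aff (row i N, dot (row i N) p) x = 0.
  rewrite /aff/= -dotBr dotC xD dot_mulmx -mulmxA -[W *m _]trmxK trmx_mul trmxK.
  by rewrite -row_mul NW row0 trmx0 mulmx0 mxE.
by split; exact: E.
Qed.

Lemma open_null_empty (G Z : set V) : open G -> measurable Z -> G `<=` Z ->
  lebesgue_rV R k.+1 Z = 0%E -> forall x, ~ G x.
Proof.
move=> oG mZ GZ Z0 x Gx.
have /nbhs_ballP[e /= e0 xG] : nbhs (x : V) G by exact: open_nbhs_nbhs.
have [e2 e20 e2e] : exists2 e2 : R, 0 < e2 & e2 < e by exists (e / 2); lra.
pose K := [set y : V | forall i, `[x 0 i, x 0 i + e2]%classic (y 0 i)].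
have mK : measurable K.
  exact: (measurable_box (A := fun i => `[x 0 i, x 0 i + e2]%classic)).
have KG : K `<=` G.
  move=> y Ky; apply: xG; rewrite -ball_normE/=.
  apply: norm_lt_coord => // i j; rewrite ord1 !mxE.
  have := Ky j; rewrite /= in_itv/= => /andP[? ?].
  by rewrite ltr_norml; apply/andP; split; lra.
have : (lebesgue_rV R k.+1 K <= lebesgue_rV R k.+1 Z)%E.
  by apply: le_measure; rewrite ?inE// => y /KG/GZ.
rewrite Z0 (@lebesgue_rV_box _ _ (fun i => `[x 0 i, x 0 i + e2]%classic) (fun=> e2))//.
  by rewrite prodr_const card_ord lee_fin leNgt exprn_gt0.
move=> i; rewrite lebesgue_measure_itv/= lte_fin ltrDl e20.
by rewrite -EFinB addrAC subrr add0r.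
Qed.

End polyhedra.

(** * Crossing a face *)

Section height.
Context {R : realType} {k : nat}.
Local Notation V := 'rV[R]_k.+1.
Variables (M : set V) (F : V -> V) (Phi : R -> V -> V) (C L : R).
Hypothesis (flowP : is_flow M F Phi).
Hypotheses (C0 : 0 < C) (L0 : 0 < L).
Hypothesis F_le : forall x, M x -> `|F x| <= C.
Hypothesis F_lip : forall x y, M x -> M y -> `|F x - F y| <= L * `|x - y|.
Variables (v p : V).
Let N : R := k.+1%:R.

Definition height (x : V) := dot (x - p) v.

Lemma height_aff x : height x = aff (v, dot p v) x.
Proof. by rewrite /height dotBl /aff/= dotC. Qed.

Hypothesis v1 : dot v v = 1.

Lemma height_lip x y : `|height x - height y| <= N * `|x - y|.
Proof.
rewrite /height -dotBl opprB addrA subrK.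
rewrite (le_trans (norm_dot_le _ _))// ler_piMr ?mulr_ge0//.
exact/norm_le_unit/v1.
Qed.

Lemma flux_lip x y : M x -> M y -> `|dot (F x) v - dot (F y) v| <= N * (L * `|x - y|).
Proof.
move=> Mx My; rewrite -dotBl (le_trans (norm_dot_le _ _))//.
rewrite -mulrA ler_wpM2l// (le_trans _ (F_lip Mx My))// ler_piMr//.
exact/norm_le_unit/v1.
Qed.

Lemma height_flow x (T s r q : R) : M x -> `|s| <= T -> `|r| <= T -> `|q| <= T ->
  `|height (Phi s x) - height (Phi r x) - (s - r) * dot (F (Phi q x)) v|
    <= N * (L * (C * (2 * T))) * `|s - r|.
Proof.
move=> Mx sT rT qT.
rewrite /height -dotBl opprB addrA subrK -dotZl -dotBl.
rewrite (le_trans (norm_dot_le _ _))// -[leRHS]mulrA -[leLHS]mulrA ler_wpM2l//.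
rewrite (le_trans _ (flow_linear flowP C0 L0 F_le F_lip Mx sT rT qT))// ler_piMr//.
exact/norm_le_unit/v1.
Qed.

End height.

Section orientation.
Context {R : realType} {k : nat}.
Local Notation V := 'rV[R]_k.+1.
Variables (M : set V) (F : V -> V) (Phi : R -> V -> V) (C L : R).
Hypothesis (flowP : is_flow M F Phi).
Hypotheses (C0 : 0 < C) (L0 : 0 < L).
Hypothesis F_le : forall x, M x -> `|F x| <= C.
Hypothesis F_lip : forall x y, M x -> M y -> `|F x - F y| <= L * `|x - y|.
Hypothesis cM : compact M.
Variables (s1 s2 : seq (seq (V * R))) (v p : V).
Let A := M `&` polyset s1.
Let B := M `&` polyset s2.
Hypotheses (regA : closure (interior A) = A) (regB : closure (interior B) = B).
Hypothesis AB0 : lebesgue_rV R k.+1 (A `&` B) = 0%E.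
Hypotheses (vAB : face_normal A B v) (ABp : (A `&` B) p).

Local Notation height := (height v p).
Let T0 := flow_time L.
Let N : R := k.+1%:R.

Lemma normal_unit : dot v v = 1. Proof. by case: vAB. Qed.

Lemma height_face x : (A `&` B) x -> height x = 0.
Proof. by move=> ABx; case: vAB => _ + _ _; apply. Qed.

Let l : V * R := (v, dot p v).

Lemma normal_form_neq0 : l <> 0.
Proof.
move=> -[v0 _]; have := normal_unit; rewrite v0 => /eqP.
by rewrite dot_mulmx mul0mx mxE eq_sym oner_eq0.
Qed.

(** The condition concerns the hyperplanes that bound A or B, apart from the
    one that contains the face. *)
Definition generic (y : V) :=
  forall h, h \in flatten s1 ++ flatten s2 -> nonprop l h -> aff h y != 0.

(** Within such a region the forms other than that of the face have constant
    sign, so that membership in either polyhedron depends on the height alone. *)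
Definition sign_cell (y z : V) :=
  forall h, h \in flatten s1 ++ flatten s2 -> nonprop l h -> 0 < aff h y * aff h z.

Lemma sign_cell_refl y : generic y -> sign_cell y y.
Proof. by move=> gy h hs hl; rewrite -expr2 exprn_even_gt0//= gy. Qed.

Lemma open_sign_cell y : open (sign_cell y).
Proof.
have oform h : open [set z : V | 0 < aff h y * aff h z].
  apply: (@open_comp _ _ (fun z : V => aff h y * aff h z) [set a | 0 < a]);
    last exact: open_gt.
  move=> x _; apply: (lipschitz_continuous_rV (c := `|aff h y| * (N * `|h.1|))) => {}x z.
  by rewrite -mulrBr normrM -mulrA ler_wpM2l// aff_lipschitz.
have oseq (hs : seq (V * R)) :
    open [set z : V | forall h, h \in hs -> nonprop l h -> 0 < aff h y * aff h z].
  elim: hs => [|h hs IH].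
    by rewrite [X in open X](_ : _ = setT); [exact: openT|exact/seteqP].
  have [hl|nhl] := pselect (nonprop l h).
    rewrite [X in open X](_ : _ = [set z : V | 0 < aff h y * aff h z] `&`
        [set z : V | forall h, h \in hs -> nonprop l h -> 0 < aff h y * aff h z]).
      exact: openI.
    apply/seteqP; split=> z /= H.
      split; first by apply: H => //; exact: mem_head.
      by move=> h' h's; apply: H; rewrite in_cons h's orbT.
    by move=> h'; rewrite in_cons => /predU1P[-> _|h's]; [exact: H.1|exact: H.2].
  rewrite [X in open X](_ : _ =
      [set z : V | forall h, h \in hs -> nonprop l h -> 0 < aff h y * aff h z])//.
  apply/seteqP; split=> z /= H.
    by move=> h' h's; apply: H; rewrite in_cons h's orbT.
  by move=> h'; rewrite in_cons => /predU1P[->|]; [|exact: H].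
exact: oseq.
Qed.

(** A form proportional to that of the face is a multiple of the height, and
    the other forms have the same sign at x and z. The inequality for z is not
    strict because the polyhedra are closed. *)
Lemma side_transfer s y x z (e : R) :
  {subset flatten s <= flatten s1 ++ flatten s2} ->
  sign_cell y x -> sign_cell y z -> polyset s x -> 0 < height x * e -> 0 <= height z * e ->
  polyset s z.
Proof.
move=> ss yx yz sx xe ze; apply: (polyset_transfer sx) => h hs hx.
have [hl|/(nonpropPn normal_form_neq0)[c hc]] := pselect (nonprop l h).
  have := yx h (ss _ hs) hl; have := yz h (ss _ hs) hl.
  rewrite leNgt => yz0 yx0; apply/negP => hz.
  have hy : 0 < aff h y by rewrite pmulr_lgt0 in yz0.
  by move: yx0; rewrite pmulr_rgt0// ltNge hx.
move: hx; rewrite hc !aff_scale -!height_aff => hx.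
rewrite leNgt; apply/negP => hz; nra.
Qed.

Lemma exists_off_plane (G : set V) : open G -> G !=set0 -> exists2 z, G z & height z != 0.
Proof.
move=> oG [z Gz]; have [hz|?] := eqVneq (height z) 0; last by exists z.
have /nbhs_ballP[e /= e0 zG] : nbhs (z : V) G by exact: open_nbhs_nbhs.
have e20 : 0 < e / 2 by rewrite divr_gt0.
exists (z + (e / 2) *: v).
  apply: zG; rewrite -ball_normE/= opprD addrA subrr add0r normrN normrZ gtr0_norm//.
  have := norm_le_unit normal_unit; nra.
by rewrite /height addrAC dotDl -/(height z) hz add0r dotZl normal_unit mulr1 gt_eqF.
Qed.

(** With a nonzero flux at y the height is strictly monotone along nearby
    trajectories, up to an error that is small for short times; it changes
    sign between - T and T if the trajectory starts close enough to the
    hyperplane. *)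
Lemma flow_to_face y (r : R) : M y -> height y = 0 -> dot (F y) v != 0 -> 0 < r ->
  exists2 d : R, 0 < d & forall z, M z -> `|z - y| < d ->
    exists s, [/\ `|s| <= T0, `|Phi s z - y| < r & height (Phi s z) = 0].
Proof.
move=> My hy Fy r0; set c := dot (F y) v in Fy.
have c0 : 0 < `|c| by rewrite normr_gt0.
have N0 : 0 < N by [].
have T00 : 0 < T0 := flow_time_gt0 L0.
pose K := N * (L * (C * 2)).
have K0 : 0 < K by rewrite !mulr_gt0.
pose T := Num.min T0 (Num.min (`|c| / 4 / K) (r / 2 / C)).
have T0' : 0 < T by rewrite !lt_min T00 !divr_gt0.
have [TT0 TK TC] : [/\ T <= T0, K * T <= `|c| / 4 & C * T <= r / 2].
  split; first by rewrite ge_min lexx.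
    by rewrite mulrC -ler_pdivlMr// !ge_min lexx !orbT.
  by rewrite mulrC -ler_pdivlMr// !ge_min lexx !orbT.
pose d := Num.min (`|c| / 4 / (N * L)) (Num.min (`|c| * T / 4 / N) (r / 2)).
have NL0 : 0 < N * L by rewrite mulr_gt0.
exists d => [|z Mz zd]; first by rewrite !lt_min !divr_gt0// !mulr_gt0.
have [d1 d2 d3] : [/\ N * L * d <= `|c| / 4, N * d <= `|c| * T / 4 & d <= r / 2].
  split; last by rewrite !ge_min lexx !orbT.
    by rewrite mulrC -ler_pdivlMr// !ge_min lexx.
  by rewrite mulrC -ler_pdivlMr// !ge_min lexx !orbT.
have hz : `|height z| <= `|c| * T / 4.
  rewrite -[height z]subr0 -hy (le_trans (height_lip p normal_unit _ _))// (le_trans _ d2)//.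
  by rewrite ler_wpM2l// ltW.
have Fz : `|dot (F z) v - c| <= `|c| / 4.
  rewrite (le_trans (flux_lip F_lip normal_unit Mz My))// mulrA (le_trans _ d1)//.
  by rewrite ler_wpM2l// ltW.
have nT : `|T| <= T by rewrite ger0_norm// ltW.
have nNT : `|- T| <= T by rewrite normrN.
have n0T : `|0 : R| <= T by rewrite normr0 ltW.
have hT s : `|s| <= T ->
    `|height (Phi s z) - height z - s * dot (F z) v| <= `|c| / 4 * `|s|.
  move=> sT; have := height_flow flowP C0 L0 F_le F_lip p normal_unit Mz sT n0T n0T; rewrite (flow0 flowP)// subr0.
  move=> h; rewrite (le_trans h)// ler_wpM2r// (le_trans _ TK)//.
  by rewrite le_eqVlt; apply/orP; left; apply/eqP; rewrite /K; ring.
have hTT s : `|s| = T -> `|height (Phi s z) - s * c| <= `|c| * T * (3 / 4).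
  move=> sT; have sT' : `|s| <= T by rewrite sT.
  have -> : height (Phi s z) - s * c =
      (height (Phi s z) - height z - s * dot (F z) v) + height z +
      s * (dot (F z) v - c) by ring.
  rewrite (le_trans (ler_normD _ _))// (_ : _ * (3 / 4) =
    (`|c| / 4 * T + `|c| * T / 4) + `|c| / 4 * T); last by field.
  rewrite lerD//; last by rewrite normrM sT mulrC ler_wpM2r// ltW.
  rewrite (le_trans (ler_normD _ _))// lerD//.
  by have := hT s sT'; rewrite sT.
have hp := hTT T (ger0_norm (ltW T0')).
have hm : `|height (Phi (- T) z) + T * c| <= `|c| * T * (3 / 4).
  by rewrite -[T * c]opprK -mulNr; apply: hTT; rewrite normrN ger0_norm// ltW.
have cont : continuous (fun s => height (Phi s z)).
  apply: (@lipschitz_continuous_R _ _ (N * C)) => a b.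
  rewrite (le_trans (height_lip p normal_unit _ _))// -mulrA ler_wpM2l//.
  exact: (flow_speed flowP F_le).
have mT : - T <= T by rewrite (le_trans _ (ltW T0'))// oppr_le0 ltW.
have [|s] := @IVT _ _ (- T) T 0 mT (continuous_subspaceT cont).
  have cT0 : 0 < `|c| * T by rewrite mulr_gt0.
  move: hp hm; rewrite !ler_norml => /andP[p1 p2] /andP[m1 m2].
  rewrite ge_min le_max.
  have [cn|cp] := ltP c 0.
    have : `|c| * T = - (T * c) by rewrite ltr0_norm// mulNr mulrC.
    move=> cE; apply/andP; split; apply/orP; [right|left]; lra.
  have : `|c| * T = T * c by rewrite ger0_norm// mulrC.
  move=> cE; apply/andP; split; apply/orP; [left|right]; lra.
rewrite in_itv/= -ler_norml => sT hs.
exists s; split=> //; first exact: le_trans sT TT0.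
rewrite -(subrK z (Phi s z)) -addrA (le_lt_trans (ler_normD _ _))// [ltRHS]splitr.
rewrite ler_ltD//; last exact: lt_le_trans zd d3.
rewrite -[X in Phi s z - X](flow0 flowP Mz) (le_trans (flow_speed flowP F_le _ _ Mz))//.
by rewrite subr0 (le_trans _ TC)// ler_wpM2l// ltW.
Qed.

(** As A and B are the closures of their interiors, each has an interior point
    in the sign cell of y, and then contains the whole side of the hyperplane
    on which this point lies, as far as M reaches; the two sides differ
    because A and B overlap in a null set. That A is the one behind is
    prescribed by the normal vector, but only at relatively interior points of
    the face, whereas y may belong to the boundary of M. So an interior point
    of A close to y is carried along the flow to the hyperplane: it stays in
    the interior of M, and the point that it reaches is relatively interior to
    the face. *)
Lemma face_orientation y : (A `&` B) y -> generic y -> dot (F y) v != 0 ->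
  forall z, sign_cell y z ->
    (height z <= 0 -> polyset s1 z) /\ (0 <= height z -> polyset s2 z).
Proof.
move=> ABy gy Fy; have [Ay By] := ABy.
have cyy := sign_cell_refl gy.
have sub1 : {subset flatten s1 <= flatten s1 ++ flatten s2}.
  by move=> h; rewrite mem_cat => ->.
have sub2 : {subset flatten s2 <= flatten s1 ++ flatten s2}.
  by move=> h; rewrite mem_cat => ->; rewrite orbT.
have mAB : measurable (A `&` B).
  apply: measurableI; [rewrite -regA|rewrite -regB]; apply: closed_measurable_rV;
    exact: closed_closure.
have oside (e : R) : open [set z | 0 < height z * e].
  apply: (@open_comp _ _ (fun z : V => height z * e) [set a | 0 < a]);
    last exact: open_gt.
  move=> x _; apply: (lipschitz_continuous_rV (c := `|e| * N)) => {}x z.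
  by rewrite -mulrBl normrM mulrC -mulrA ler_wpM2l// (height_lip p normal_unit).
have side (D : set V) : closure (interior D) y ->
    exists z, [/\ interior D z, sign_cell y z & height z != 0].
  move=> /(_ (sign_cell y)); case; first by apply: open_nbhs_nbhs; split=> //; exact: open_sign_cell.
  move=> z0 [Dz0 yz0].
  have [||z [Dz yz] hz] := @exists_off_plane (interior D `&` sign_cell y).
  - by apply: openI; [exact: open_interior|exact: open_sign_cell].
  - by exists z0.
  by exists z.
have [zA [AzA yzA hzA]] : exists z, [/\ interior A z, sign_cell y z & height z != 0].
  by apply: side; rewrite regA.
have [zB [BzB yzB hzB]] : exists z, [/\ interior B z, sign_cell y z & height z != 0].
  by apply: side; rewrite regB.
have PA := (interior_subset AzA).2; have PB := (interior_subset BzB).2.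
have sgA : 0 < height zA * height zA by rewrite -expr2 exprn_even_gt0//= hzA.
have sgB : 0 < height zB * height zB by rewrite -expr2 exprn_even_gt0//= hzB.
have tA z : sign_cell y z -> 0 <= height z * height zA -> polyset s1 z.
  by move=> yz hz; exact: (side_transfer sub1 yzA yz PA sgA hz).
have tB z : sign_cell y z -> 0 <= height z * height zB -> polyset s2 z.
  by move=> yz hz; exact: (side_transfer sub2 yzB yz PB sgB hz).
have AB_neg : height zA * height zB < 0.
  rewrite ltNge; apply/negP => AB.
  have hh : 0 < height zA * height zB by rewrite lt_neqAle AB eq_sym mulf_neq0.
  apply: (@open_null_empty _ _ (interior A `&` sign_cell y `&`
      [set z | 0 < height z * height zB]) _ _ mAB _ AB0 zA) => //.
    by apply: openI => //; apply: openI; [exact: open_interior|exact: open_sign_cell].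
  move=> z [[/interior_subset Az yz] hz]; split=> //; split; first exact: Az.1.
  by apply: tB => //; exact: ltW.
have [hA|hA] := ltP (height zA) 0.
  have hB : 0 < height zB by rewrite -(nmulr_rlt0 _ hA).
  move=> z yz; split=> hz; [apply: tA|apply: tB] => //.
    by rewrite nmulr_lge0.
  by rewrite mulr_ge0// ltW.
exfalso.
(* A would lie ahead of the face: a relatively interior point x of the face,
   reached by the flow from the interior of A, contradicts the orientation of v *)
have hA' : 0 < height zA by rewrite lt_neqAle hA eq_sym hzA.
have hB : height zB < 0 by rewrite -(pmulr_rlt0 _ hA').
have My := Ay.1.
have /nbhs_ballP[r /= r0 yr] : nbhs (y : V) (sign_cell y).
  by apply: open_nbhs_nbhs; split=> //; exact: open_sign_cell.
have [d d0 Hd] := flow_to_face My (height_face ABy) Fy r0.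
have : closure (interior A) y by rewrite regA.
move=> /(_ _ (nbhsx_ballx y _ d0))[z [Az]]; rewrite -ball_normE/= distrC => yz.
have iMz : interior M z by apply: interiorS Az => ? [].
have [s [sT sr hs]] := Hd z (interior_subset iMz) yz.
have iMs := flow_interior flowP L0 F_le F_lip sT iMz.
set x := Phi s z in sr hs iMs.
have yx : sign_cell y x by apply: yr; rewrite -ball_normE/= distrC.
have heightE w : height w = dot (w - x) v.
  by rewrite -[LHS]subr0 -hs /height -dotBl opprB addrA subrK.
have in_plane w : sign_cell y w -> M w -> height w = 0 -> (A `&` B) w.
  by move=> yw Mw hw; split; split=> //; [apply: tA|apply: tB] => //; rewrite hw mul0r.
have iMy : nbhs (x : V) (interior M `&` sign_cell y).
  apply: open_nbhs_nbhs; split => //.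
  by apply: openI; [exact: open_interior|exact: open_sign_cell].
have xrel : relint_face A B v x.
  split; first by apply: in_plane => //; exact: interior_subset.
  apply: (filterS _ iMy) => w [/interior_subset Mw yw] hw.
  by apply: in_plane => //; rewrite heightE.
have [_ _ _ /(_ x xrel)[+ _]] := vAB.
move=> /(_ _ iMy)[w [[Aw hw] [iMw yw]]].
rewrite /= -heightE in hw.
have ww : 0 < height w * height w by rewrite nmulr_rgt0.
apply: (@open_null_empty _ _ (interior M `&` sign_cell y `&`
    [set z | 0 < height z * height w]) _ _ mAB _ AB0 w) => //.
  by apply: openI => //; apply: openI; [exact: open_interior|exact: open_sign_cell].
move=> u [[/interior_subset Mu yu] hu]; split; split=> //.
  by apply: (side_transfer sub1 yw yu Aw.2 ww); exact: ltW.
apply: tB => //; have := ltW hu; nra.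
Qed.

Definition face_forms := l :: flatten s1 ++ flatten s2.

Let K : R := N * (L * (C * 2)).

(** Where the outward flux is at least e, trajectories cross the face
    transversally and the time of crossing is determined by the height. *)
Definition face_part (e : R) := [set y | (A `&` B) y /\ e <= dot (F y) v].

Section crossing.
Variables (c t : R).
Hypothesis c_le : forall h, h \in face_forms -> N * `|h.1| * C <= c.
Hypothesis t0 : 0 <= t.

Definition near_two_forms x := exists h1 h2, [/\ h1 \in face_forms, h2 \in face_forms,
  nonprop h1 h2, `|aff h1 x| <= c * t & `|aff h2 x| <= c * t].

Lemma touches_near x h : M x -> h \in face_forms ->
  touches (fun r => Phi r x) t h -> `|aff h x| <= c * t.
Proof.
move=> Mx hs [r /andP[r0 rt] hr].
rewrite -[aff h x]subr0 -hr -{1}(flow0 flowP Mx) (le_trans (aff_lipschitz _ _ _))//.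
apply: (@le_trans _ _ (N * `|h.1| * (C * t))).
  rewrite ler_wpM2l ?mulr_ge0// (le_trans (flow_speed flowP F_le _ _ Mx))//.
  by rewrite sub0r normrN ler_wpM2l ?(ltW C0)// ger0_norm.
by rewrite mulrA ler_wpM2r// c_le.
Qed.

Let form_l : l \in face_forms. Proof. exact: mem_head. Qed.

Let form_s h : h \in flatten s1 ++ flatten s2 -> h \in face_forms.
Proof. by move=> hs; rewrite /face_forms in_cons hs orbT. Qed.

(** Touching the hyperplane of the face and another hyperplane would put the
    starting point near two forms. *)
Lemma generic_crossing x r : M x -> 0 <= r <= t -> (A `&` B) (Phi r x) ->
  ~ near_two_forms x ->
  generic (Phi r x) /\ forall a, 0 <= a <= t -> sign_cell (Phi r x) (Phi a x).
Proof.
move=> Mx rt ABr nx.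
have lr : touches (fun r => Phi r x) t l.
  by exists r => //; rewrite -height_aff height_face.
have nt h : h \in flatten s1 ++ flatten s2 -> nonprop l h ->
    ~ touches (fun r => Phi r x) t h.
  move=> hs hl th; apply: nx; exists l, h; split=> //; first exact: form_s.
    exact: touches_near.
  by apply: touches_near => //; exact: form_s.
split=> [h hs hl|a a_t h hs hl].
  by apply/eqP => hr; apply: (nt h hs hl); exists r.
apply: (@untouched_same_sign _ _ (fun r => Phi r x) C t) => //.
  by move=> q q'; exact: (flow_speed flowP F_le).
exact: nt.
Qed.

Variable e : R.
Hypotheses (e0 : 0 < e) (Kt : K * t <= e).

Let height_flow_t x (s r q : R) : M x -> 0 <= s <= t -> 0 <= r <= t -> 0 <= q <= t ->
  `|height (Phi s x) - height (Phi r x) - (s - r) * dot (F (Phi q x)) v|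
    <= e * `|s - r|.
Proof.
have nt a : 0 <= a <= t -> `|a| <= t by move=> /andP[a0 ?]; rewrite ger0_norm.
move=> Mx /nt st /nt rt /nt qt; rewrite (le_trans (height_flow flowP C0 L0 F_le F_lip p normal_unit Mx st rt qt))//.
rewrite ler_wpM2r// (le_trans _ Kt)//.
by rewrite le_eqVlt; apply/orP; left; apply/eqP; rewrite /K; ring.
Qed.

Let z_t : 0 <= (0 : R) <= t. Proof. by rewrite lexx. Qed.
Let t_t : 0 <= t <= t. Proof. by rewrite t0 lexx. Qed.

(** A trajectory that goes from A to B meets the face unless it touches two
    distinct hyperplanes. If the flux at the meeting point is at most - e, the
    trajectory comes from ahead of the face, hence starts in B as well as in
    A; if it is smaller than e in absolute value, the trajectory starts at
    height at most 2 * e * t. *)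
Lemma crossing_upper x : A x -> B (Phi t x) ->
  [\/ (A `&` B) x, near_two_forms x, `|height x| <= 2 * e * t |
     exists2 r, 0 <= r <= t & face_part e (Phi r x)].
Proof.
move=> Ax Bx; have Mx := Ax.1.
have [nx|nx] := pselect (near_two_forms x); first by apply: Or42.
have g_lip r r' : `|Phi r x - Phi r' x| <= C * `|r - r'|.
  exact: (flow_speed flowP F_le).
have A0 : polyset s1 (Phi 0 x) by rewrite (flow0 flowP)//; exact: Ax.2.
have [[r rt [r1 r2]]|[h1 [h2 [h1s h2s h12 t1 t2]]]] :=
    polyset_crossing g_lip t0 A0 Bx.2; last first.
  apply: Or42; exists h1, h2; split=> //; try exact: form_s.
    by apply: touches_near => //; exact: form_s.
  by apply: touches_near => //; exact: form_s.
have Mr := flow_in flowP r Mx.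
have ABr : (A `&` B) (Phi r x) by split; split.
have hr := height_face ABr.
have := height_flow_t Mx z_t rt rt.
rewrite (flow0 flowP)// hr subr0 sub0r normrN mulNr opprK.
case/andP: (rt) => r0 rlet; rewrite (ger0_norm r0).
set f := dot _ v => hx.
have [ef|fe] := leP e f; first by apply: Or44; exists r.
have [fe'|ef] := ltP (- e) f.
  apply: Or43; have : `|f| <= e by rewrite ler_norml !ltW.
  move=> fe2; rewrite -[height x](addrK (r * f)) (le_trans (ler_normB _ _))//.
  rewrite (_ : 2 * e * t = e * t + e * t); last by ring.
  rewrite lerD//; first by rewrite (le_trans hx)// ler_wpM2l// ltW.
  by rewrite normrM ger0_norm// mulrC ler_pM.
have f0 : f != 0 by rewrite lt_eqF// (le_lt_trans ef)// oppr_lt0.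
have [gr cr] := generic_crossing Mx rt ABr nx.
have [_ Bside] := face_orientation ABr gr f0 (cr 0 z_t).
apply: Or41; split=> //; split=> //.
rewrite -(flow0 flowP Mx); apply: Bside; rewrite (flow0 flowP)//.
move: hx; rewrite ler_norml => /andP[h1 _]; nra.
Qed.

(** Before it meets this part of the face a trajectory is behind the
    hyperplane, afterwards ahead of it, and the orientation of the face turns
    this into membership in A and in B. *)
Lemma crossing_lower x r : M x -> 0 <= r <= t -> face_part e (Phi r x) ->
  near_two_forms x \/ (A x /\ B (Phi t x)).
Proof.
move=> Mx rt [ABr ef]; have [nx|nx] := pselect (near_two_forms x); first by left.
have hr := height_face ABr.
have f0 : dot (F (Phi r x)) v != 0 by rewrite gt_eqF// (lt_le_trans e0).
have [gr cr] := generic_crossing Mx rt ABr nx.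
case/andP: (rt) => r0 rlet.
right; split; split=> //.
- have [Aside _] := face_orientation ABr gr f0 (cr 0 z_t).
  rewrite -(flow0 flowP Mx); apply: Aside.
  have := height_flow_t Mx z_t rt rt; rewrite hr subr0 sub0r normrN mulNr opprK.
  rewrite (ger0_norm r0) ler_norml => /andP[_ h2]; nra.
- exact: (flow_in flowP).
- have [_ Bside] := face_orientation ABr gr f0 (cr t t_t).
  apply: Bside; have := height_flow_t Mx t_t rt rt; rewrite hr subr0.
  have tr : 0 <= t - r by rewrite subr_ge0.
  rewrite (ger0_norm tr) ler_norml => /andP[h1 _]; nra.
Qed.

End crossing.

End orientation.

Section forms_bound.
Context {R : realType} {k : nat}.
Local Notation V := 'rV[R]_k.+1.

Lemma forms_bound (hs : seq (V * R)) (C : R) : 0 < C ->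
  exists2 c : R, 0 <= c & forall h, h \in hs -> k.+1%:R * `|h.1| * C <= c.
Proof.
move=> C0; exists (\sum_(h <- hs) k.+1%:R * `|h.1| * C).
  by apply: sumr_ge0 => h _; rewrite !mulr_ge0// ltW.
move=> h hs_h; rewrite (big_rem h)//= lerDl.
by apply: sumr_ge0 => h' _; rewrite !mulr_ge0// ltW.
Qed.

Definition nonprop_pairs (hs : seq (V * R)) :=
  [seq q <- [seq (h1, h2) | h1 <- hs, h2 <- hs] | `[< nonprop q.1 q.2 >]].

Lemma nonprop_pairsP hs q : q \in nonprop_pairs hs -> nonprop q.1 q.2.
Proof. by rewrite mem_filter => /andP[/asboolP]. Qed.

Lemma mem_nonprop_pairs hs h1 h2 : h1 \in hs -> h2 \in hs -> nonprop h1 h2 ->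
  (h1, h2) \in nonprop_pairs hs.
Proof.
move=> h1s h2s h12; rewrite mem_filter; apply/andP; split; first exact/asboolP.
by apply/allpairsP; exists (h1, h2).
Qed.

(** When the cells meet in codimension 2 only, a trajectory from one to the
    other touches two non-proportional forms in any case: two bounding forms
    if it misses the intersection, and two equations of an affine subspace
    covering the intersection if it meets it. *)
Lemma codim2_crossing (M : set V) (F : V -> V) (Phi : R -> V -> V) (C : R)
    (s1 s2 : seq (seq (V * R))) :
  is_flow M F Phi -> 0 < C -> (forall x, M x -> `|F x| <= C) ->
  codim2 ((M `&` polyset s1) `&` (M `&` polyset s2)) ->
  exists (ps : seq ((V * R) * (V * R))) (c : R),
    [/\ forall q, q \in ps -> nonprop q.1 q.2, 0 <= c &
    forall t x, 0 <= t -> M x -> polyset s1 x -> polyset s2 (Phi t x) ->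
      exists q, [/\ q \in ps, `|aff q.1 x| <= c * t & `|aff q.2 x| <= c * t]].
Proof.
move=> flowP C0 F_le [ws [wsr wsE]].
have H (pW : V * 'M[R]_k.+1) : exists q : (V * R) * (V * R),
    ((\rank pW.2).+2 <= k.+1)%N -> nonprop q.1 q.2 /\
      forall x, (x - pW.1 <= pW.2)%MS -> aff q.1 x = 0 /\ aff q.2 x = 0.
  have [/(codim2_forms pW.1)[h1 [h2 h12]]|nr] :=
    boolP ((\rank pW.2).+2 <= k.+1)%N; first by exists (h1, h2).
  by exists (0, 0).
have [f fP] := choice H.
pose hs := flatten s1 ++ flatten s2.
pose ps := nonprop_pairs hs ++ map f ws.
have [c c0 cP] := forms_bound (map fst ps ++ map snd ps) C0.
exists ps, c; split=> // [q|t x t0 Mx x1 x2].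
  rewrite mem_cat => /orP[|/mapP[pW pWs ->]]; first exact: nonprop_pairsP.
  by have [] := fP pW (allP wsr _ pWs).
have g_lip r r' : `|Phi r x - Phi r' x| <= C * `|r - r'|.
  exact: (flow_speed flowP F_le).
have near h : h \in map fst ps ++ map snd ps ->
    touches (fun r => Phi r x) t h -> `|aff h x| <= c * t.
  move=> hps [r /andP[r0 rt] hr].
  rewrite -[aff h x]subr0 -hr -{1}(flow0 flowP Mx) (le_trans (aff_lipschitz _ _ _))//.
  apply: (@le_trans _ _ (k.+1%:R * `|h.1| * (C * t))).
    rewrite ler_wpM2l ?mulr_ge0// (le_trans (g_lip _ _))//.
    by rewrite sub0r normrN ler_wpM2l ?(ltW C0)// ger0_norm.
  by rewrite mulrA ler_wpM2r// cP.
have nearq q : q \in ps -> touches (fun r => Phi r x) t q.1 ->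
    touches (fun r => Phi r x) t q.2 ->
    exists q, [/\ q \in ps, `|aff q.1 x| <= c * t & `|aff q.2 x| <= c * t].
  move=> qps t1 t2; exists q; split=> //; apply: near => //; rewrite mem_cat.
    by rewrite map_f.
  by rewrite (map_f snd qps) orbT.
have x0 : polyset s1 (Phi 0 x) by rewrite (flow0 flowP).
have [[r rt [r1 r2]]|[h1 [h2 [h1s h2s h12 t1 t2]]]] := polyset_crossing g_lip t0 x0 x2.
  have Mr := flow_in flowP r Mx.
  have /hasP[pW pWs xW] : has (fun pW => (Phi r x - pW.1 <= pW.2)%MS) ws.
    by apply: wsE; split; split.
  have [_ /(_ _ xW)[f1 f2]] := fP pW (allP wsr _ pWs).
  apply: (nearq (f pW)); [by rewrite mem_cat map_f// orbT| |]; by exists r.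
apply: (nearq (h1, h2)) => //; rewrite mem_cat; apply/orP; left.
exact: mem_nonprop_pairs.
Qed.

End forms_bound.

(** * Volume of a flow tube *)

Section lipschitz_on.
Context {R : realType} {m : nat}.
Variables (A : set 'rV[R]_m) (g : 'rV[R]_m -> R) (c : R).
Hypothesis cA : compact A.
Hypothesis g_lip : forall y z, A y -> A z -> `|g y - g z| <= c * `|y - z|.

Lemma compact_superlevel a : compact [set y | A y /\ a <= g y].
Proof.
have clA := compact_closed_rV cA.
apply: bounded_closed_compact.
  have [r r0 rA] := compact_le cA.
  exists r; split; first exact: num_real.
  by move=> d rd y /= [Ay _]; rewrite (le_trans (rA _ Ay))// ltW.
move=> y cy; have Ay : A y.
  apply: clA => U yU; have [z [[Az _] Uz]] := cy U yU; by exists z.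
split=> //; apply/ler_addgt0Pr => e e0.
pose d := Num.max c 0 + 1.
have d0 : 0 < d by rewrite ltr_wpDl// le_max lexx orbT.
have [z [[Az az]]] := cy _ (nbhsx_ballx y _ (divr_gt0 e0 d0)).
rewrite -ball_normE/= ltr_pdivlMr// => yz.
have : `|g y - g z| <= e.
  rewrite (le_trans (g_lip Ay Az))// (le_trans _ (ltW yz))// mulrC ler_wpM2l//.
  by rewrite /d ler_wpDr// le_max lexx.
rewrite ler_norml => /andP[h _]; lra.
Qed.

(** The superlevel sets are compact, hence Borel. *)
Lemma measurable_lipschitz_on : measurable_fun A g.
Proof.
apply: (measurability (@RGenCInfty.G R)); first exact: RGenCInfty.measurableE.
move=> _ [_ [a ->] <-].
apply: compact_measurable_rV.
rewrite [X in compact X](_ : _ = [set y | A y /\ a <= g y]).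
  exact: compact_superlevel.
by apply/seteqP; split=> y /=; rewrite in_itv/= andbT.
Qed.

End lipschitz_on.

Section tube.
Context {R : realType} {k : nat}.
Local Notation V := 'rV[R]_k.+1.
Variables (M : set V) (F : V -> V) (Phi : R -> V -> V) (C L : R).
Hypothesis (flowP : is_flow M F Phi).
Hypotheses (C0 : 0 < C) (L0 : 0 < L).
Hypothesis F_le : forall x, M x -> `|F x| <= C.
Hypothesis F_lip : forall x y, M x -> M y -> `|F x - F y| <= L * `|x - y|.
Variables (v p : V) (E : set V) (e : R).
Hypotheses (v1 : dot v v = 1) (e0 : 0 < e) (cE : compact E) (EM : E `<=` M).
Hypothesis E_plane : forall y, E y -> height v p y = 0.
Hypothesis E_flux : forall y, E y -> e <= dot (F y) v.

Let N : R := k.+1%:R.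
Let Q := frame v.
Let vQ : is_frame v Q := frameP v1.
Let T0 := flow_time L.

Definition tube t := [set x | exists y s, [/\ E y, 0 <= s <= t & x = Phi (- s) y]].
Definition chart_set := [set y | E (chart p v y)].
Definition chart_flux y := dot (F (chart p v y)) v.

Let K0 := N * (L * (C * 2)).

Let chartE y : chart p v y = slab_coord p v Q 0 y.
Proof. by rewrite /slab_coord scale0r addr0. Qed.

Lemma compact_chart_set : compact chart_set.
Proof.
rewrite [chart_set](_ : _ = [set y | E (slab_coord p v Q 0 y)]).
  exact: compact_slice.
by apply/funext => y; rewrite /chart_set/= chartE.
Qed.

Lemma chart_flux_lip y z : chart_set y -> chart_set z ->
  `|chart_flux y - chart_flux z| <= N * (L * (k%:R * `|Q|)) * `|y - z|.
Proof.
move=> Ey Ez; rewrite (le_trans (flux_lip F_lip v1 (EM Ey) (EM Ez)))//.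
rewrite -!mulrA ler_wpM2l// ler_wpM2l ?(ltW L0)//.
rewrite (_ : _ - _ = (y - z) *m Q); last first.
  by rewrite /chart mulmxBl opprD addrACA subrr add0r.
by rewrite (le_trans (norm_mulmx_le _ _))// mulrAC -mulrA.
Qed.

Let drift y s t : E y -> 0 <= s <= t ->
  `|height v p (Phi (- s) y) + s * dot (F y) v| <= K0 * t * s.
Proof.
move=> Ey /andP[s0 st]; have My := EM Ey.
have nst : `|- s| <= t by rewrite normrN ger0_norm.
have n0t : `|0 : R| <= t by rewrite normr0 (le_trans s0).
have := height_flow flowP C0 L0 F_le F_lip p v1 My nst n0t n0t.
rewrite (flow0 flowP)// (E_plane Ey) !subr0 mulNr opprK normrN (ger0_norm s0).
move=> h; rewrite (le_trans h)// le_eqVlt; apply/orP; left; apply/eqP.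
by rewrite /K0; ring.
Qed.

(* 2 * L is the distortion at equal times; the other term comes from the
   difference of the hitting times *)
Let K1 := 2 * L + C * (2 / e * (N * (2 * L))).

Let K1_ge0 : 0 <= K1.
Proof. apply: addr_ge0; first by rewrite mulr_ge0// ltW.
apply: mulr_ge0; first exact: ltW.
apply: mulr_ge0; first by rewrite divr_ge0// ltW.
by rewrite !mulr_ge0// ltW. Qed.

(** The two points are at the same height. Since the flux is at least e, their
    hitting times s and s' differ by a multiple of t * |y - y'|, so that the
    displacement from y - y' is of the same order. *)
Let near_translation y y' s s' t : t <= T0 -> K0 * t <= e / 2 -> E y -> E y' ->
  0 <= s <= t -> 0 <= s' <= t ->
  height v p (Phi (- s) y) = height v p (Phi (- s') y') ->
  `|Phi (- s) y - Phi (- s') y' - (y - y')| <= K1 * t * `|y - y'|.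
Proof.
move=> tT Kt Ey Ey' /andP[s0 st] /andP[s'0 s't] hss'.
have My := EM Ey; have My' := EM Ey'.
set u := Phi (- s) y'; set x := Phi (- s) y; set x' := Phi (- s') y'.
have xu : `|x - u - (y - y')| <= 2 * L * t * `|y - y'|.
  have := flow_near_id flowP L0 F_le F_lip My My' (_ : `|- s| <= flow_time L).
  rewrite normrN ger0_norm// => /(_ (le_trans st tT)) h; rewrite (le_trans h)//.
  by rewrite ler_wpM2r// ler_wpM2l// mulr_ge0// ltW.
have hu : `|height v p x' - height v p u| <= N * (2 * L * t * `|y - y'|).
  rewrite -hss' -/x /height -dotBl opprB addrA subrK.
  have -> : dot (x - u) v = dot (x - u - (y - y')) v.
    rewrite [RHS]dotBl (_ : dot (y - y') v = 0) ?subr0//.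
    have := E_plane Ey; have := E_plane Ey'; rewrite /height !dotBl; lra.
  rewrite (le_trans (norm_dot_le _ _))// -mulrA ler_wpM2l// (le_trans _ xu)//.
  by rewrite ler_piMr// norm_le_unit.
have nst : `|- s| <= t by rewrite normrN ger0_norm.
have ns't : `|- s'| <= t by rewrite normrN ger0_norm.
have n0t : `|0 : R| <= t by rewrite normr0 (le_trans s0).
have := height_flow flowP C0 L0 F_le F_lip p v1 My' ns't nst n0t.
rewrite (flow0 flowP)// -/x' -/u => hd.
have ss' : `|- s' - - s| <= 2 / e * (N * (2 * L) * t * `|y - y'|).
  set a := `|- s' - - s| in hd *.
  have h1 : e * a <= `|(- s' - - s) * dot (F y') v|.
    rewrite normrM -/a mulrC; apply: ler_wpM2l; first exact: normr_ge0.
    exact: le_trans (E_flux Ey') (ler_norm _).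
  have h2 : `|(- s' - - s) * dot (F y') v| <=
      e / 2 * a + N * (2 * L * t * `|y - y'|).
    rewrite -[X in `|X|](subKr (height v p x' - height v p u)).
    rewrite (le_trans (ler_normB _ _))// addrC lerD//.
    apply: (le_trans hd); apply: ler_wpM2r; first exact: normr_ge0.
    rewrite (le_trans _ Kt)//.
    by rewrite le_eqVlt; apply/orP; left; apply/eqP; rewrite /K0; ring.
  rewrite mulrAC ler_pdivlMr//.
  have := le_trans h1 h2; nra.
have x'u : `|x' - u| <= C * `|- s' - - s| := flow_speed flowP F_le _ _ My'.
have -> : x - x' - (y - y') = (x - u - (y - y')) - (x' - u).
  by apply/matrixP => i j; rewrite !mxE; ring.
rewrite (le_trans (ler_normB _ _))//.
rewrite (_ : K1 * t * _ = 2 * L * t * `|y - y'| +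
    C * (2 / e * (N * (2 * L) * t * `|y - y'|))); last by rewrite /K1; ring.
by rewrite lerD// (le_trans x'u)// ler_wpM2l// ltW.
Qed.

Let K2 := N * `|Q^T| * K1 * (k%:R * `|Q|).

Let K2_ge0 : 0 <= K2.
Proof. by rewrite /K2 !mulr_ge0 ?K1_ge0. Qed.

Let rel t (s : R) (y y' : 'rV[R]_k) :=
  exists2 r, 0 <= r <= t & slab_coord p v Q s y' = Phi (- r) (chart p v y).

Let rel_near t s y z y' z' : t <= T0 -> K0 * t <= e / 2 ->
  chart_set y -> chart_set z -> rel t s y y' -> rel t s z z' ->
  `|(y' - z') - (y - z)| <= K2 * t * `|y - z|.
Proof.
move=> tT Kt Ey Ez [r rt yr] [q qt zq].
have h : height v p (Phi (- r) (chart p v y)) = height v p (Phi (- q) (chart p v z)).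
  by rewrite -yr -zq /height !dot_slab_coord.
have := near_translation tT Kt Ey Ez rt qt h; rewrite -yr -zq.
have -> : slab_coord p v Q s y' - slab_coord p v Q s z' = (y' - z') *m Q.
  by rewrite /slab_coord mulmxBl opprD addrACA subrr add0r.
have -> : chart p v y - chart p v z = (y - z) *m Q.
  by rewrite /chart mulmxBl opprD addrACA subrr add0r.
rewrite -mulmxBl => H.
have -> : y' - z' - (y - z) = (y' - z' - (y - z)) *m Q *m Q^T.
  by rewrite -mulmxA vQ.1 mulmx1.
rewrite (le_trans (norm_mulmx_le _ _))//.
have t0 : 0 <= t by case/andP: rt => /le_trans; apply.
apply: (@le_trans _ _ (N * (K1 * t * (k%:R * `|y - z| * `|Q|)) * `|Q^T|)).
  rewrite ler_wpM2r// ler_wpM2l// (le_trans H)// ler_wpM2l ?mulr_ge0 ?K1_ge0//.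
  exact: norm_mulmx_le.
by rewrite le_eqVlt; apply/orP; left; apply/eqP; rewrite /K2; ring.
Qed.

(** The slice of the tube at height s consists of the points reached from
    those y whose trajectory descends to height s, which up to O(t^2) means -
    s <= t * chart_flux y, and the passage from y to this point multiplies
    distances by 1 + O(t). So flux_tube_le and flux_tube_ge apply with g y
    equal to t * (chart_flux y + K * t) and t * (chart_flux y - K * t). *)
Lemma tube_measure : exists K T : R, [/\ 0 <= K, 0 < T & forall t, 0 < t <= T ->
  [/\ compact (tube t),
   (lebesgue_rV R k.+1 (tube t) <= ((1 + K * t) ^+ k)%:E *
     \int[lebesgue_rV R k]_(y in chart_set) (t * (chart_flux y + K * t))%:E)%E,
   (\int[lebesgue_rV R k]_(y in chart_set) (t * (chart_flux y - K * t))%:E <=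
     ((1 + K * t) ^+ k)%:E * lebesgue_rV R k.+1 (tube t))%E &
   forall y, chart_set y -> 0 <= chart_flux y - K * t]].
Proof.
have N0 : 0 < N by [].
have K00 : 0 < K0 by rewrite !mulr_gt0.
pose K := K0 + 2 * K2.
have K_gt0 : 0 < K by rewrite ltr_wpDr// mulr_ge0 ?K2_ge0.
exists K, (Num.min T0 (Num.min 1 (e / 2) / K)); split; first exact: ltW.
  by rewrite lt_min flow_time_gt0// divr_gt0// lt_min ltr01 divr_gt0.
move=> t /andP[t0]; rewrite le_min => /andP[tT].
rewrite ler_pdivlMr// mulrC le_min => /andP[Kt1 Kt].
have K0t : K0 * t <= K * t by rewrite ler_wpM2r ?(ltW t0)// lerDl mulr_ge0 ?K2_ge0.
have K2t : 2 * (K2 * t) <= K * t.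
  by rewrite mulrA ler_wpM2r ?(ltW t0)// lerDr ltW.
have K0te := le_trans K0t Kt.
have K2t0 : 0 <= K2 * t by rewrite mulr_ge0 ?K2_ge0 ?(ltW t0).
have cT : compact (tube t) := compact_flow_out flowP C0 L0 F_le F_lip cE EM tT.
have cA := compact_chart_set.
have mA := compact_measurable_rV cA.
have L1 : 0 <= 1 + K * t by rewrite addr_ge0// mulr_ge0// ltW.
have flux_e y : chart_set y -> e <= chart_flux y by exact: E_flux.
pose g (b : R) y := t * (chart_flux y + b).
have g_lip b y z : chart_set y -> chart_set z ->
    `|g b y - g b z| <= t * (N * (L * (k%:R * `|Q|))) * `|y - z|.
  move=> Ey Ez; rewrite -mulrBr normrM gtr0_norm// -mulrA ler_wpM2l ?(ltW t0)//.
  by rewrite opprD addrACA subrr addr0 chart_flux_lip.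
have mg b : measurable_fun chart_set (g b).
  exact: (measurable_lipschitz_on cA (g_lip b)).
have g_ge0 b y : - (K * t) <= b -> chart_set y -> 0 <= g b y.
  move=> bK /flux_e ey; rewrite mulr_ge0 ?(ltW t0)//; lra.
have cg b s : compact [set y | [/\ chart_set y, s <= 0 & - s <= g b y]].
  have [s0|s0] := leP s 0.
    rewrite [X in compact X](_ : _ = [set y | chart_set y /\ - s <= g b y]).
      exact: (compact_superlevel cA (g_lip b)).
    by apply/seteqP; split=> y [] //.
  rewrite [X in compact X](_ : _ = set0); first exact: compact0.
  by apply/seteqP; split=> y [].
have bKp : - (K * t) <= K * t by rewrite ge0_cp// mulr_ge0// ltW.
split=> //.
- apply: (@flux_tube_le _ _ p v Q v1 vQ chart_set (g (K * t)) (tube t) (1 + K * t)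
      (rel t)) => //.
  + by move=> y; exact: g_ge0.
  + move=> s y' [y [r [Ey rt yr]]].
    have yE : chart p v ((y - p) *m Q^T) = y.
      rewrite chartE [RHS](slab_coord_surj p y v1 vQ).
      by congr slab_coord; rewrite -/(height v p y) E_plane.
    exists ((y - p) *m Q^T); last by exists r; rewrite ?yE.
    have sE : s = height v p (Phi (- r) y) by rewrite -yr /height dot_slab_coord.
    have := drift Ey rt; rewrite -sE ler_norml => /andP[h1 h2].
    have ey := E_flux Ey.
    case/andP: rt => r0 rt.
    have K0tr : K0 * t * r <= K * t * r by rewrite ler_wpM2r.
    rewrite /chart_set/= /g /chart_flux yE; split=> //; first by nra.
    have c0 : 0 <= dot (F y) v + K * t.
      by rewrite addr_ge0 ?mulr_ge0 ?(ltW t0) ?(ltW K_gt0)// (le_trans (ltW e0)).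
    apply: (@le_trans _ _ (r * (dot (F y) v + K * t))); first by nra.
    by rewrite ler_wpM2r.
  + move=> s y z y' z' Ey Ez _ _ yy' zz'.
    have h := rel_near tT K0te Ey Ez yy' zz'.
    rewrite -(subrK (y - z) (y' - z')) (le_trans (ler_normD _ _))//.
    rewrite mulrDl mul1r addrC lerD2l (le_trans h)// ler_wpM2r//; lra.
- apply: (@flux_tube_ge _ _ p v Q v1 vQ chart_set (g (- (K * t))) (tube t) (1 + K * t)
      (rel t)) => //.
  + by move=> y; exact: g_ge0.
  + move=> s y Ey s0 sg.
    have cont : continuous (fun r => height v p (Phi (- r) (chart p v y))).
      apply: (@lipschitz_continuous_R _ _ (N * C)) => a b.
      rewrite (le_trans (height_lip p v1 _ _))// -mulrA ler_wpM2l//.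
      rewrite (le_trans (flow_speed flowP F_le _ _ (EM Ey)))//.
      by rewrite -opprD normrN.
    have t00 : 0 <= (0 : R) <= t by rewrite lexx ltW.
    have ttt : 0 <= t <= t by rewrite lexx ltW.
    have [|r] := @IVT _ _ 0 t s (ltW t0) (continuous_subspaceT cont).
      rewrite oppr0 (flow0 flowP); last exact: EM.
      rewrite (E_plane Ey) ge_min le_max s0/= andbT; apply/orP; right.
      have := drift Ey ttt; rewrite ler_norml => /andP[_ h].
      move: sg; rewrite /g /chart_flux; nra.
    rewrite in_itv/= => rt hr.
    exists ((Phi (- r) (chart p v y) - p) *m Q^T).
      exists (chart p v y), r; split=> //.
      by rewrite -hr -(slab_coord_surj p _ v1 vQ).
    by exists r => //; rewrite -hr -(slab_coord_surj p _ v1 vQ).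
  + move=> s y z y' z' Ey Ez _ _ yy' zz'.
    have h := rel_near tT K0te Ey Ez yy' zz'.
    have h2 : `|y - z| <= `|y' - z'| + K2 * t * `|y - z|.
      rewrite (le_trans _ (lerD (lexx _) h))//.
      rewrite -{1}(subKr (y' - z') (y - z)).
      exact: ler_normB.
    have H0 := normr_ge0 (y' - z'); have D0 := normr_ge0 (y - z).
    move: (K2 * t) (K * t) K2t K2t0 Kt1 h2 H0 D0 => a b ab a0 b1 h2 H0 D0.
    apply: (@le_trans _ _ ((1 + 2 * a) * `|y' - z'|)); last first.
      by rewrite ler_wpM2r// lerD2l.
    have h3 : 0 <= (1 + 2 * a) * (`|y' - z'| - (1 - a) * `|y - z|).
      by rewrite mulr_ge0//; lra.
    have h4 : 0 <= a * (1 - 2 * a) * `|y - z| by rewrite !mulr_ge0//; lra.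
    nra.
- by move=> y /flux_e; lra.
Qed.

End tube.

(** * The flux through a face as a derivative *)

Section lipschitz_integral.
Context {R : realType} {m : nat}.
Variables (A : set 'rV[R]_m) (g : 'rV[R]_m -> R) (c : R).
Hypothesis cA : compact A.
Hypothesis g_lip : forall y z, A y -> A z -> `|g y - g z| <= c * `|y - z|.
Local Notation mu := (lebesgue_rV R m).

Lemma lipschitz_integrable : mu.-integrable A (EFin \o g).
Proof.
apply: measurable_bounded_integrable.
- exact: compact_measurable_rV.
- by have := lebesgue_rV_fin cA; rewrite ge0_fin_numE.
- exact: (measurable_lipschitz_on cA g_lip).
have [[y0 Ay0]|A0] := pselect (A !=set0); last first.
  by exists 0; split => // d d0 y Ay; exfalso; apply: A0; exists y.
have [r r0 rA] := compact_le cA.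
exists (`|g y0| + `|c| * (r + r)); split; first exact: num_real.
move=> d rd y /= Ay; rewrite (le_trans _ (ltW rd))// -(subrK (g y0) (g y)) addrC.
rewrite (le_trans (ler_normD _ _))// lerD2l (le_trans (g_lip Ay Ay0))//.
apply: (@le_trans _ _ (`|c| * `|y - y0|)); first by rewrite ler_wpM2r// ler_norm.
by rewrite ler_wpM2l// (le_trans (ler_normB _ _))// lerD// rA.
Qed.

Lemma integral_affine (a b : R) :
  (\int[mu]_(y in A) (a * (g y + b))%:E)%E =
  (a * (\int[mu]_(y in A) g y + b * fine (mu A)))%:E.
Proof.
have mA := compact_measurable_rV cA.
have ig := lipschitz_integrable.
have ib : mu.-integrable A (EFin \o cst b).
  apply: measurable_bounded_integrable => //.
    by have := lebesgue_rV_fin cA; rewrite ge0_fin_numE.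
  by exists `|b|; split => // d bd y _ /=; exact: ltW.
have igb : mu.-integrable A (EFin \o (fun y => g y + b)).
  have := integrableD mA ig ib; apply: eq_integrable => //.
have iagb : mu.-integrable A (EFin \o (fun y => a * (g y + b))).
  have := integrableZl mA a igb; apply: eq_integrable => //.
rewrite -[LHS]fineK; last exact: (integrable_fin_num mA iagb).
rewrite -[fine _]/(\int[mu]_(y in A) (a * (g y + b))).
by rewrite RintegralZl// RintegralD// Rintegral_cst.
Qed.

End lipschitz_integral.

Section flow_preimage.
Context {R : realType} {k : nat}.
Local Notation V := 'rV[R]_k.+1.
Variables (M : set V) (F : V -> V) (Phi : R -> V -> V) (C L : R).
Hypothesis (flowP : is_flow M F Phi).
Hypotheses (L0 : 0 < L).
Hypothesis F_le : forall x, M x -> `|F x| <= C.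
Hypothesis F_lip : forall x y, M x -> M y -> `|F x - F y| <= L * `|x - y|.
Hypothesis cM : compact M.

Lemma compact_flow_preimage (E : set V) t : compact E -> `|t| <= flow_time L ->
  compact [set x | M x /\ E (Phi t x)].
Proof.
move=> cE tT; have clM := compact_closed_rV cM; have clE := compact_closed_rV cE.
apply: bounded_closed_compact.
  have [r r0 rM] := compact_le cM.
  exists r; split; first exact: num_real.
  by move=> d rd y /= [My _]; rewrite (le_trans (rM _ My))// ltW.
move=> y cy; have My : M y.
  by apply: clM => U yU; have [z [[Mz _] Uz]] := cy U yU; exists z.
split=> //; apply: clE => U /nbhs_ballP[d /= d0 dU].
have d20 : 0 < d / 2 by rewrite divr_gt0.
have [z [[Mz Ez]]] := cy _ (nbhsx_ballx y _ d20).
rewrite -ball_normE/= => yz; exists (Phi t z); split=> //; apply: dU.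
rewrite -ball_normE/= (le_lt_trans (flow_dist flowP L0 F_le F_lip My Mz tT))//.
by rewrite mulrC -ltr_pdivlMr.
Qed.

End flow_preimage.

Section limits.
Context {R : realType}.

Lemma near0_right (T : R) (P : R -> Prop) : 0 < T ->
  (forall t, 0 < t <= T -> P t) -> \forall t \near 0^'+, P t.
Proof.
move=> T0 H; near=> t; apply: H; apply/andP; split; near: t.
  exact: nbhs_right_gt.
exact: nbhs_right_le.
Unshelve. all: by end_near. Qed.

Lemma cvg_right_id : (t : R) @[t --> 0^'+] --> (0 : R).
Proof. by apply: cvg_at_right_filter; exact: cvg_id. Qed.

End limits.

Section face_flux.
Context {R : realType} {k : nat}.
Local Notation V := 'rV[R]_k.+1.
Variables (M : set V) (F : V -> V) (Phi : R -> V -> V) (C L : R).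
Hypothesis (flowP : is_flow M F Phi).
Hypotheses (C0 : 0 < C) (L0 : 0 < L).
Hypothesis F_le : forall x, M x -> `|F x| <= C.
Hypothesis F_lip : forall x y, M x -> M y -> `|F x - F y| <= L * `|x - y|.
Hypothesis cM : compact M.
Variables (s1 s2 : seq (seq (V * R))).
Let A := M `&` polyset s1.
Let B := M `&` polyset s2.
Hypotheses (regA : closure (interior A) = A) (regB : closure (interior B) = B).
Local Notation mu := (lebesgue_rV R k.+1).

Definition transit t := [set x | A x /\ B (Phi t x)].

Let clA : closed A. Proof. by rewrite -regA; exact: closed_closure. Qed.
Let clB : closed B. Proof. by rewrite -regB; exact: closed_closure. Qed.

Let cA : compact A.
Proof. exact: (subclosed_compact clA cM (@subIsetl _ _ _)). Qed.

Let cB : compact B.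
Proof. exact: (subclosed_compact clB cM (@subIsetl _ _ _)). Qed.

Let cAB : compact (A `&` B).
Proof. by apply: compact_closedI. Qed.

Lemma compact_transit t : `|t| <= flow_time L -> compact (transit t).
Proof.
move=> tT; have cP := compact_flow_preimage flowP L0 F_le F_lip cM cB tT.
rewrite (_ : transit t = A `&` [set x | M x /\ B (Phi t x)]).
  exact: compact_closedI (compact_closed_rV cP).
by apply/seteqP; split=> x [Ax Bx]; split=> //; [split=> //; exact: Ax.1|exact: Bx.2].
Qed.

Lemma codim2_flux : codim2 (A `&` B) ->
  fine (mu (transit t)) / t @[t --> 0^'+] --> (0 : R).
Proof.
move=> /(codim2_crossing flowP C0 F_le)[ps [c [psP c0 crossing]]].
have [K [T [K0 T0 HT]]] := two_forms_measure cM psP c0.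
apply/cvgrPdist_le => e e0.
pose d := Num.min (Num.min T (flow_time L)) (e / (K + 1)).
have K1 : 0 < K + 1 by rewrite ltr_wpDl.
have d0 : 0 < d by rewrite !lt_min T0 flow_time_gt0// divr_gt0.
apply: (near0_right d0) => t /andP[t0]; rewrite !le_min -andbA => /and3P[tT tL te].
have t0T : 0 <= t <= T by rewrite ltW.
have [Z [cZ ZK ZP]] := HT t t0T.
have nt : `|t| <= flow_time L by rewrite gtr0_norm.
have cS := compact_transit nt.
have SZ : transit t `<=` Z.
  move=> x [Ax Bx]; have [q [qps q1 q2]] := crossing t x (ltW t0) Ax.1 Ax.2 Bx.2.
  exact: (ZP x q Ax.1).
have : (mu (transit t) <= (K * t ^+ 2)%:E)%E.
  by apply: le_trans ZK; apply: le_measure; rewrite ?inE//; exact: compact_measurable_rV.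
rewrite -{1}(fineK (lebesgue_rV_fin cS)) lee_fin => h.
rewrite sub0r normrN ger0_norm; last by rewrite divr_ge0 ?fine_ge0 ?measure_ge0// ltW.
rewrite ler_pdivrMr// (le_trans h)// expr2 mulrA ler_wpM2r ?(ltW t0)//.
rewrite (le_trans _ (_ : (K + 1) * t <= _))//; first by rewrite ler_wpM2r ?(ltW t0)// lerDl.
by rewrite mulrC -ler_pdivlMr.
Qed.

Variables (v p : V).
Hypothesis AB0 : mu (A `&` B) = 0%E.
Hypotheses (vAB : face_normal A B v) (ABp : (A `&` B) p).
Let v1 : dot v v = 1 := normal_unit vAB.
Let N : R := k.+1%:R.
Local Notation chart_AB := [set y | (A `&` B) (chart p v y)].
Local Notation flux y := (dot (F (chart p v y)) v).
Local Notation nu := (lebesgue_rV R k).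

Definition face_flux : \bar R :=
  (\int[nu]_(y in chart_AB) (Num.max (flux y) 0)%:E)%E.

Let ABM : A `&` B `<=` M. Proof. by move=> x [[]]. Qed.

Let face_part_compact e : compact (face_part M F s1 s2 v e).
Proof.
apply: (@compact_superlevel _ _ (A `&` B) (fun y => dot (F y) v) (N * L)) => // y z ABy ABz.
by rewrite -mulrA; apply: (flux_lip F_lip v1); exact: ABM.
Qed.

Let chart_AB_compact : compact chart_AB.
Proof. exact: (compact_chart_set (p := p) v1 cAB). Qed.

Let chart_AB_lip y z : chart_AB y -> chart_AB z ->
  `|flux y - flux z| <= N * (L * (k%:R * `|frame v|)) * `|y - z|.
Proof. exact: (chart_flux_lip L0 F_lip v1 ABM). Qed.

(** Outside the part of the face considered, the positive part of the flux is
    at most e. *)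
Lemma face_flux_bounds e : 0 < e ->
  let I := \int[nu]_(y in chart_set v p (face_part M F s1 s2 v e)) chart_flux F v p y in
  (I%:E <= face_flux)%E /\ (face_flux <= (I + e * fine (nu chart_AB))%:E)%E.
Proof.
move=> e0; set Ae := chart_set _ _ _ => I.
have cAe : compact Ae by apply: (compact_chart_set (p := p) v1); exact: face_part_compact.
have mAe := compact_measurable_rV cAe.
have mAB := compact_measurable_rV chart_AB_compact.
have AeAB : Ae `<=` chart_AB by move=> y [].
have mD : measurable (chart_AB `\` Ae) by exact: measurableD.
have mf : measurable_fun chart_AB (fun y => (Num.max (flux y) 0)%:E).
  apply/measurable_EFinP; apply: measurable_maxr => //.
  exact: (measurable_lipschitz_on chart_AB_compact chart_AB_lip).
have f0 y : (0 <= (Num.max (flux y) 0)%:E)%E by rewrite lee_fin le_max lexx orbT.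
have IE : I%:E = (\int[nu]_(y in Ae) (Num.max (flux y) 0)%:E)%E.
  rewrite /I /Rintegral fineK.
    apply: eq_integral => y; rewrite inE => -[_ ey].
    by rewrite max_l// (le_trans (ltW e0)).
  apply: integrable_fin_num => //.
  apply: (lipschitz_integrable cAe) => y z Ay Az.
  by apply: chart_AB_lip; exact: AeAB.
split; first by rewrite IE; apply: ge0_subset_integral.
have UE : chart_AB = Ae `|` (chart_AB `\` Ae) by rewrite setDUK.
rewrite /face_flux {1}UE ge0_integral_setU//; last 2 first.
- by rewrite -UE.
- by apply/disj_setPS => y [? []].
rewrite EFinD IE leeD2l//.
apply: (@le_trans _ _ (\int[nu]_(y in chart_AB `\` Ae) e%:E)%E).
  apply: ge0_le_integral => //.
    by apply: measurable_funS mf => // y [].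
  move=> y [ABy nAe]; rewrite lee_fin ge_max (ltW e0) andbT leNgt.
  by apply/negP => /ltW ey; apply: nAe.
rewrite integral_cst// EFinM lee_wpmul2l ?lee_fin ?(ltW e0)//.
rewrite fineK; last exact: lebesgue_rV_fin.
by apply: le_measure; rewrite ?inE// => y [].
Qed.

Lemma face_flux_fin : face_flux \is a fin_num.
Proof.
have [h1 h2] := face_flux_bounds ltr01.
by rewrite fin_real// (lt_le_trans (ltNyr _) h1) (le_lt_trans h2 (ltry _)).
Qed.

(** The trajectories counted by transit fill the tube over face_part e, up to
    a set of measure O(t^2) and a slab of measure D * (e * t). The constant D
    must come before e, since e is later chosen small compared with 1 / D. *)
Lemma transit_measure : exists2 D : R, 0 <= D & forall e : R, 0 < e ->
  let Ae := chart_set v p (face_part M F s1 s2 v e) in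
  let I := \int[nu]_(y in Ae) chart_flux F v p y in
  let m := fine (nu Ae) in
  exists K K' T : R, [/\ 0 <= K, 0 < T & forall t, 0 < t <= T ->
    fine (mu (transit t)) <=
      K' * t ^+ 2 + D * (e * t) + (1 + K * t) ^+ k * (t * (I + K * t * m)) /\
    t * (I - K * t * m) <= (1 + K * t) ^+ k * (fine (mu (transit t)) + K' * t ^+ 2)].
Proof.
have [rM rM0 rMP] := compact_le cM.
have v0 : v != 0.
  apply/eqP => v0; have := v1; rewrite v0 => /eqP.
  by rewrite dot_mulmx mul0mx mxE eq_sym oner_eq0.
have [D D0 DP] := slab1_le (h := (v, dot p v)) rM v0.
exists (D * 2) => [|e e0 Ae I m]; first by rewrite mulr_ge0.
have [c c0 cP] := forms_bound (face_forms s1 s2 v p) C0.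
have psP q : q \in nonprop_pairs (face_forms s1 s2 v p) -> nonprop q.1 q.2.
  exact: nonprop_pairsP.
have [K' [T' [K'0 T'0 ZP]]] := two_forms_measure cM psP c0.
have cE : compact (face_part M F s1 s2 v e) by exact: face_part_compact.
have EM : face_part M F s1 s2 v e `<=` M by move=> y [/ABM].
have E_plane y : face_part M F s1 s2 v e y -> height v p y = 0.
  by move=> [ABy _]; exact: (height_face vAB ABp ABy).
have E_flux y : face_part M F s1 s2 v e y -> e <= dot (F y) v by case.
have [K [T [K0 T0 tubeP]]] := tube_measure flowP C0 L0 F_le F_lip v1 e0 cE EM E_plane E_flux.
have cAe : compact Ae by exact: (compact_chart_set (p := p) v1).
have flux_lip' y z : Ae y -> Ae z ->
    `|chart_flux F v p y - chart_flux F v p z| <= N * (L * (k%:R * `|frame v|)) * `|y - z|.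
  exact: (chart_flux_lip L0 F_lip v1 EM).
have K20 : 0 < N * (L * (C * 2)) by rewrite !mulr_gt0.
exists K, K', (Num.min (Num.min T' T) (Num.min (flow_time L) (e / (N * (L * (C * 2)))))).
split=> //; first by rewrite !lt_min T'0 T0 flow_time_gt0// divr_gt0.
move=> t /andP[t0]; rewrite !le_min => /andP[/andP[tT' tT] /andP[tL]].
rewrite ler_pdivlMr// mulrC => Kt.
have [|Z [cZ ZK ZZ]] := ZP t; first by rewrite (ltW t0).
have [|cTu Tu_le Tu_ge _] := tubeP t; first by rewrite t0.
rewrite (integral_affine cAe flux_lip') -/I -/m in Tu_le.
rewrite (integral_affine cAe flux_lip') mulNr -/I -/m in Tu_ge.
have nt : `|t| <= flow_time L by rewrite gtr0_norm.
have cS := compact_transit nt.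
have near_Z x : M x -> near_two_forms s1 s2 v p c t x -> Z x.
  move=> Mx [h1 [h2 [h1s h2s h12 n1 n2]]]; apply: (ZZ x (h1, h2)) => //.
  exact: mem_nonprop_pairs.
have k1 : 0 <= (1 + K * t) ^+ k.
  by rewrite exprn_ge0// addr_ge0// mulr_ge0// ltW.
have fS := lebesgue_rV_fin cS; have fZ := lebesgue_rV_fin cZ.
have fTu := lebesgue_rV_fin cTu; have fAB := lebesgue_rV_fin cAB.
have mS := compact_measurable_rV cS; have mZ := compact_measurable_rV cZ.
have mTu := compact_measurable_rV cTu; have mAB := compact_measurable_rV cAB.
have ZK' : fine (mu Z) <= K' * t ^+ 2 by rewrite -lee_fin fineK.
split.
  pose Y := [set x | M x /\ - (2 * e * t) <= - `|height v p x|].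
  have cY : compact Y.
    apply: (@compact_superlevel _ _ M (fun x => - `|height v p x|) N) => // x y Mx My.
    rewrite -opprD normrN.
    by rewrite (le_trans (ler_dist_dist _ _))// (height_lip p v1).
  have mY := compact_measurable_rV cY; have fY := lebesgue_rV_fin cY.
  have YD : fine (mu Y) <= D * 2 * (e * t).
    rewrite -lee_fin fineK// (le_trans (DP Y (2 * e * t) cY _ _ _))//.
    - by move=> x [Mx _]; exact: rMP.
    - by move=> x [Mx]; rewrite lerN2 height_aff.
    - by rewrite !mulr_ge0// ltW.
    - by rewrite lee_fin !mulrA.
  have sub : transit t `<=` (Z `|` Y) `|` (tube Phi (face_part M F s1 s2 v e) t `|` (A `&` B)).
    move=> x [Ax Bx].
    have := crossing_upper flowP C0 L0 F_le F_lip regA regB AB0 vAB ABp cP (ltW t0) e0 Kt Ax Bx.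
    move=> [?|?|?|[r rt fr]].
    - by right; right.
    - by left; left; apply: near_Z => //; exact: Ax.1.
    - by left; right; split; [exact: Ax.1|rewrite lerN2].
    - right; left; exists (Phi r x), r; split=> //.
      by rewrite -(flowD flowP) ?addNr ?(flow0 flowP)//; exact: Ax.1.
  have : (mu (transit t) <= (mu Z + mu Y) +
      (mu (tube Phi (face_part M F s1 s2 v e) t) + mu (A `&` B)))%E.
    apply: (le_trans (le_measure _ _ _ sub)); rewrite ?inE//.
      by repeat apply: measurableU.
    apply: (le_trans (measureU2 _ _ _)); try by apply: measurableU.
    by apply: leeD; exact: measureU2.
  rewrite AB0 adde0 -(fineK fS) -(fineK fZ) -(fineK fY) -(fineK fTu) -!EFinD lee_fin.
  move=> /le_trans; apply; rewrite !lerD//.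
  by rewrite -lee_fin fineK.
have sub : tube Phi (face_part M F s1 s2 v e) t `<=` transit t `|` Z.
  move=> x [y [r [Ey rt ->]]]; have My := EM y Ey.
  have Mx := flow_in flowP (- r) My.
  have yE : y = Phi r (Phi (- r) y) by rewrite -(flowD flowP)// subrr (flow0 flowP).
  rewrite {1}yE in Ey.
  have := crossing_lower flowP C0 L0 F_le F_lip regA regB AB0 vAB ABp cP (ltW t0) e0 Kt Mx rt Ey.
  by move=> [?|//]; [right; exact: near_Z|left].
have TuS : (mu (tube Phi (face_part M F s1 s2 v e) t) <= mu (transit t) + mu Z)%E.
  apply: (le_trans (le_measure _ _ _ sub)); rewrite ?inE//; first exact: measurableU.
  exact: measureU2.
move: TuS Tu_ge; rewrite -(fineK fS) -(fineK fZ) -(fineK fTu) -EFinD lee_fin => TuS.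
rewrite -EFinM lee_fin => /le_trans; apply; rewrite ler_wpM2l// (le_trans TuS)//.
by rewrite lerD2l.
Qed.

(** For fixed e the two bounds of transit_measure, divided by t, tend to I + D
    * e and to I, where I is within e times the area of the face from
    face_flux; e is arbitrary. *)
Lemma face_flux_limit : fine (mu (transit t)) / t @[t --> 0^'+] --> fine face_flux.
Proof.
have [D D0 H] := transit_measure.
apply/cvgrPdist_le => eps eps0.
set m0 := fine (nu chart_AB).
have m00 : 0 <= m0 by rewrite fine_ge0// measure_ge0.
pose e := eps / (D + m0 + 1).
have Dm : 0 < D + m0 + 1 by rewrite ltr_wpDl// addr_ge0.
have e0 : 0 < e by rewrite divr_gt0.
have [] := face_flux_bounds e0; have [K [K' [T [K0 T0]]]] := H e e0.
rewrite -/m0; set I := \int[_]_(_ in _) _; set m := fine _ => HT.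
have := face_flux_fin; move: face_flux => phi phi_fin.
rewrite -(fineK phi_fin) !lee_fin => I_le phi_le.
have cvgt : (t : R) @[t --> 0^'+] --> (0 : R) := cvg_right_id.
have cvgc (a : R) : (a * t) @[t --> 0^'+] --> (0 : R).
  by rewrite -[X in _ --> X](mulr0 a); apply: cvgMr.
have cvgk : (1 + K * t) ^+ k @[t --> 0^'+] --> (1 : R).
  rewrite -[X in _ --> X](expr1n _ k) -[X in X ^+ k]addr0.
  apply: (@cvg_comp _ _ _ (fun t => 1 + K * t) (fun x => x ^+ k)); last exact: exprn_continuous.
  by apply: cvgD => //; exact: cvg_cst.
have cvgU : K' * t + D * e + (1 + K * t) ^+ k * (I + K * m * t)
    @[t --> 0^'+] --> 0 + D * e + 1 * (I + 0).
  by apply: cvgD; [apply: cvgD => //; exact: cvg_cst|apply: cvgM => //; apply: cvgD => //; exact: cvg_cst].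
have cvgL : (I - K * m * t) / (1 + K * t) ^+ k - K' * t
    @[t --> 0^'+] --> (I - 0) / 1 - 0.
  apply: cvgB => //; apply: cvgM; first by apply: cvgB => //; exact: cvg_cst.
  by apply: cvgV => //; exact: oner_neq0.
have /cvgrPdist_le/(_ e e0) nearU := cvgU.
have /cvgrPdist_le/(_ e e0) nearL := cvgL.
rewrite add0r mul1r addr0 in nearU; rewrite !subr0 divr1 in nearL.
have nearT : \forall t \near 0^'+, 0 < t <= T by exact: (near0_right T0).
near=> t.
have /andP[t0 tT] : 0 < t <= T by near: t.
have hU : `|D * e + I - (K' * t + D * e + (1 + K * t) ^+ k * (I + K * m * t))| <= e by near: t.
have hL : `|I - ((I - K * m * t) / (1 + K * t) ^+ k - K' * t)| <= e by near: t.
have [|h1 h2] := HT t; first by rewrite t0.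
move: (fine (mu (transit t))) h1 h2 => q h1 h2.
have eE : (D + m0 + 1) * e = eps by rewrite /e mulrC divfK// gt_eqF.
have {}h1 : q / t <= K' * t + D * e + (1 + K * t) ^+ k * (I + K * m * t).
  rewrite ler_pdivrMr// (le_trans h1)// le_eqVlt; apply/orP; left; apply/eqP.
  by rewrite expr2; ring.
have {}h2 : (I - K * m * t) / (1 + K * t) ^+ k - K' * t <= q / t.
  rewrite lerBlDr ler_pdivrMr; last by rewrite exprn_gt0// ltr_wpDr// mulr_ge0// ltW.
  rewrite -(ler_pM2l t0); apply: le_trans (le_trans h2 _); rewrite le_eqVlt; apply/orP; left; apply/eqP.
    by ring.
  by rewrite expr2; field; rewrite gt_eqF.
move: hU hL; rewrite !ler_norml => /andP[hU _] /andP[_ hL]; apply/andP; split; nra.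
Unshelve. all: by end_near. Qed.

End face_flux.

(** * Step functions on an almost everywhere partition *)

Section cells.
Context d (T : measurableType d) {R : realType} (m : {measure set T -> \bar R}).
Variables (n : nat) (B : 'I_n -> set T).
Hypothesis mB : forall i, measurable (B i).

Let integrable_indicator i (D : set T) : measurable D -> (m D < +oo)%E ->
  m.-integrable D (EFin \o (\1_(B i) : T -> R)).
Proof.
move=> mD Doo; apply: measurable_bounded_integrable => //.
exists 1; split=> // a a1 x _ /=; rewrite indicE.
by case: (x \in B i); rewrite ?normr1 ?normr0 ltW// (lt_trans ltr01).
Qed.

Lemma integrable_step (a : 'I_n -> R) (D : set T) : measurable D -> (m D < +oo)%E ->
  m.-integrable D (EFin \o (fun x => \sum_i a i * \1_(B i) x)).
Proof.
move=> mD Doo.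
rewrite (_ : _ \o _ = (fun x => \sum_(i < n) (a i)%:E * (EFin \o \1_(B i)) x)%E); last first.
  by apply/funext => x /=; rewrite -sumEFin.
apply: integrable_sum => // i _; apply: integrableZl => //.
exact: integrable_indicator.
Qed.

Lemma Rintegral_step (a : 'I_n -> R) (D : set T) : measurable D -> (m D < +oo)%E ->
  \int[m]_(x in D) (\sum_i a i * \1_(B i) x) = \sum_i a i * fine (m (B i `&` D)).
Proof.
move=> mD Doo; rewrite /Rintegral.
under eq_integral do rewrite -sumEFin.
have ii i : m.-integrable D (EFin \o \1_(B i)) by exact: integrable_indicator.
have iai i : m.-integrable D (fun x => (a i * \1_(B i) x)%:E).
  by have := integrableZl mD (a i) (ii i); apply: eq_integrable.
rewrite integral_sum//.
have E i : (\int[m]_(x in D) (a i * \1_(B i) x)%:E = (a i * fine (m (B i `&` D)))%:E)%E.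
  have -> : (\int[m]_(x in D) (a i * \1_(B i) x)%:E =
      (a i)%:E * \int[m]_(x in D) (\1_(B i) x)%:E)%E.
    exact: (integralZl mD (ii i)).
  rewrite integral_indic// EFinM fineK// ge0_fin_numE//.
  by rewrite (le_lt_trans _ Doo)// le_measure ?inE//; exact: measurableI.
by under eq_bigr do rewrite E; rewrite sumEFin.
Qed.

Variable M : set T.
Hypotheses (mM : measurable M) (BM : forall i, B i `<=` M).
Hypothesis B_disjoint : forall i j, i != j -> m (B i `&` B j) = 0%E.
Hypothesis B_cover : m (M `\` \bigcup_i B i) = 0%E.

(** This expresses that the cells form a partition up to null sets in a form
    that can be integrated against a function. *)
Lemma cells_count_ae : {ae m, forall x, M x -> \sum_i \1_(B i) x = 1 :> R}.
Proof.
have mU : measurable (\bigcup_i B i).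
  by apply: fin_bigcup_measurable => //; exact: finite_finset.
have covered : {ae m, forall x, ~ (M `\` \bigcup_i B i) x}.
  by exists (M `\` \bigcup_i B i); split => // [|x /=]; [exact: measurableD|exact: contrapT].
have disj (ij : 'I_n * 'I_n) : {ae m, forall x, ij.1 != ij.2 -> ~ (B ij.1 `&` B ij.2) x}.
  have [->|ij_neq] := eqVneq ij.1 ij.2; first exact: aeW.
  exists (B ij.1 `&` B ij.2); split => //; [exact: measurableI|exact: B_disjoint|].
  by move=> x /= H; apply: contrapT => nx; apply: H.
have ae_m : Filter (almost_everywhere m) := ae_filter_ringOfSetsType m.
have {}disj := @filter_forall _ _ _ (almost_everywhere m) ae_m disj.
apply: filterS2 covered disj => x nU nI Mx.
have [i _ Bi] : (\bigcup_i B i) x by apply: contrapT => nx; apply: nU.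
rewrite (bigD1 i)//= indicE mem_set// big1 ?addr0// => j ji.
by rewrite indicE memNset// => Bj; apply: (nI (j, i)).
Qed.

Lemma Rintegral_cells (g : T -> R) : m.-integrable M (EFin \o g) ->
  \int[m]_(x in M) g x = \sum_i \int[m]_(x in B i) g x.
Proof.
move=> ig.
have gB i : (fun x => (g x * \1_(B i) x)%:E) = (EFin \o g) \_ (B i).
  apply/funext => x; rewrite patchE indicE.
  by case: ifP => _; rewrite ?mulr1 ?mulr0.
have igB i : m.-integrable M (fun x => (g x * \1_(B i) x)%:E).
  rewrite gB; apply: (integrableS measurableT) => //.
  by apply/(integrable_mkcond (D := B i)) => //; apply: integrableS ig.
have -> : \int[m]_(x in M) g x = \int[m]_(x in M) (\sum_i g x * \1_(B i) x).
  congr fine; apply: ae_eq_integral => //.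
  - exact: measurable_int ig.
  - rewrite (_ : (fun x => _) = (fun x => \sum_(i < n) (g x * \1_(B i) x)%:E)%E).
      by apply: measurable_int; exact: integrable_sum.
    by apply/funext => x /=; rewrite sumEFin.
  - apply: filterS cells_count_ae => x H Mx.
    by rewrite -mulr_sumr H// mulr1.
rewrite /Rintegral; under eq_integral do rewrite -sumEFin.
rewrite integral_sum//.
have -> : (\sum_(i < n) \int[m]_(x in M) (g x * \1_(B i) x)%:E =
    (\sum_(i < n) \int[m]_(x in B i) g x)%:E)%E.
  rewrite -sumEFin; apply: eq_bigr => i _.
  rewrite gB -integral_mkcondr setIidr// fineK//.
  by apply: integrable_fin_num => //; apply: integrableS ig.
by [].
Qed.

End cells.

(** * The generator *)

Section outflow_limit.
Context {R : realType} {k : nat}.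
Local Notation V := 'rV[R]_k.+1.
Variables (M : set V) (F : V -> V) (Phi : R -> V -> V) (C L : R).
Hypothesis (flowP : is_flow M F Phi).
Hypotheses (C0 : 0 < C) (L0 : 0 < L).
Hypothesis F_le : forall x, M x -> `|F x| <= C.
Hypothesis F_lip : forall x y, M x -> M y -> `|F x - F y| <= L * `|x - y|.
Hypothesis cM : compact M.
Variables (n : nat) (B : 'I_n -> set V) (s : 'I_n -> seq (seq (V * R))).
Hypothesis B_polyset : forall i, B i = M `&` polyset (s i).
Hypothesis B_regular : forall i, closure (interior (B i)) = B i.
Hypothesis B_disjoint : forall i j, i != j -> lebesgue_rV R k.+1 (B i `&` B j) = 0%E.
Hypothesis B_faces : forall i j, i != j ->
  is_face (B i) (B j) \/ codim2 (B i `&` B j).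

Definition crossing i j t := [set x | B i x /\ B j (Phi t x)].

Let clB i : closed (B i).
Proof. by rewrite -B_regular; exact: closed_closure. Qed.

Let cB i : compact (B i).
Proof.
have BM : B i `<=` M by rewrite B_polyset; exact: subIsetl.
exact: (subclosed_compact (@clB i) cM BM).
Qed.

Lemma crossing_transit i j t : crossing i j t = transit M Phi (s i) (s j) t.
Proof. by rewrite /crossing !B_polyset. Qed.

Lemma compact_crossing i j t : `|t| <= flow_time L -> compact (crossing i j t).
Proof.
move=> tL; rewrite crossing_transit.
by apply: (compact_transit flowP L0 F_le F_lip cM) => //; rewrite -B_polyset.
Qed.

Lemma outflow_face i j : is_face (B i) (B j) -> outflow M B F i j =
  (inv_volume M)%:num * fine (face_flux M F (s i) (s j)
     (unit_normal (B i) (B j)) (xget 0 (B i `&` B j))).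
Proof.
move=> fij; set v := unit_normal _ _; set p := xget _ _.
have vB : face_normal (B i) (B j) v by exact: (xgetPex 0 fij).
rewrite /outflow -/v -/p /Rintegral /normalized_surface.
have cBB : compact (B i `&` B j) by exact: (compact_closedI (@cB i) (@clB j)).
have mBB := compact_measurable_rV cBB.
have v1' : dot v v = 1 by case: vB.
have mf : measurable_fun (B i `&` B j) (fun x => (Num.max (dot (F x) v) 0)%:E).
  apply/measurable_EFinP; apply: measurable_maxr => //.
  apply: (measurable_lipschitz_on (c := k.+1%:R * L) cBB) => x y [Bx _] [By _].
  by rewrite -mulrA; apply: (flux_lip F_lip v1'); [move: Bx|move: By]; rewrite B_polyset => -[].
have f0 x : (0 <= (Num.max (dot (F x) v) 0)%:E)%E by rewrite lee_fin le_max lexx orbT.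
rewrite ge0_integral_mscale// ge0_integral_pushforward//.
have regs l : closure (interior (M `&` polyset (s l))) = M `&` polyset (s l).
  by rewrite -B_polyset.
have fin : face_flux M F (s i) (s j) v p \is a fin_num.
  by apply: (face_flux_fin L0 F_lip cM) => //; rewrite -!B_polyset.
rewrite [X in (_ * X)%E](_ : _ = face_flux M F (s i) (s j) v p) ?fineM//.
by rewrite /face_flux -!B_polyset.
Qed.

(** A pair of cells that does not share a face has zero normal vector, so its
    outflow is 0, and the volume of the crossing set is O(t^2). *)
Lemma crossing_limit i j : i != j ->
  fine (normalized_lebesgue M (crossing i j t)) / t @[t --> 0^'+] --> outflow M B F i j.
Proof.
move=> ij.
have q_lim phi : fine (lebesgue_rV R k.+1 (transit M Phi (s i) (s j) t)) / t
     @[t --> 0^'+] --> phi ->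
   fine (normalized_lebesgue M (crossing i j t)) / t @[t --> 0^'+] -->
     (inv_volume M)%:num * phi.
  move=> q_phi; apply: cvg_trans (cvgMr (a := (inv_volume M)%:num) q_phi).
  apply: near_eq_cvg.
  apply: (near0_right (flow_time_gt0 L0)) => t /andP[t0 tL].
  rewrite -crossing_transit /normalized_lebesgue /mscale/= mulrA fineM//.
  by apply: lebesgue_rV_fin; apply: compact_crossing; rewrite gtr0_norm.
have regs l : closure (interior (M `&` polyset (s l))) = M `&` polyset (s l).
  by rewrite -B_polyset.
have [fij|nfij] := pselect (is_face (B i) (B j)).
  rewrite outflow_face//; apply: q_lim.
  have vB : face_normal (B i) (B j) (unit_normal (B i) (B j)) by exact: (xgetPex 0 fij).
  have [_ _ [x [Bx _]] _] := vB.
  have Bp := xgetPex 0 (ex_intro _ x Bx).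
  apply: (face_flux_limit flowP C0 L0 F_le F_lip cM) => //; rewrite -!B_polyset//.
  exact: B_disjoint.
have -> : outflow M B F i j = (inv_volume M)%:num * 0.
  rewrite mulr0 /outflow (_ : unit_normal (B i) (B j) = 0); last first.
    by rewrite /unit_normal xgetPN// => v vB; apply: nfij; exists v.
  rewrite /Rintegral integral0_eq// => x _.
  by rewrite dotC dot_mulmx mul0mx mxE maxxx.
apply: q_lim; apply: (codim2_flux flowP C0 L0 F_le F_lip cM) => //.
by rewrite -!B_polyset; case: (B_faces ij).
Qed.

End outflow_limit.

Section generator_limit.
Context {R : realType} {k : nat}.
Local Notation V := 'rV[R]_k.+1.
Variables (M : set V) (F : V -> V) (Phi : R -> V -> V) (C L : R).
Hypothesis (flowP : is_flow M F Phi).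
Hypotheses (C0 : 0 < C) (L0 : 0 < L).
Hypothesis F_le : forall x, M x -> `|F x| <= C.
Hypothesis F_lip : forall x y, M x -> M y -> `|F x - F y| <= L * `|x - y|.
Hypothesis cM : compact M.
Variables (n : nat) (B : 'I_n -> set V) (P : R -> (V -> R) -> (V -> R)).
Hypothesis transferP : is_transfer_operator M Phi P.
Hypothesis partB : polyhedral_partition M B.
Local Notation m := (normalized_lebesgue M).
Local Notation q i j t := (fine (m (crossing Phi B i j t))).

Let BM i : B i `<=` M.
Proof. by have [S _ ->] := cell_polyhedral partB i; exact: subIsetl. Qed.

Let cB i : compact (B i).
Proof.
apply: (subclosed_compact _ cM (@BM i)).
by rewrite -(cell_regular partB); exact: closed_closure.
Qed.

Let mM : measurable M := compact_measurable_rV cM.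
Let mB i : measurable (B i) := compact_measurable_rV (@cB i).

Lemma normalized_lebesgue_fin (X : set V) : compact X -> m X \is a fin_num.
Proof.
move=> cX; rewrite /normalized_lebesgue /mscale/= fin_numM//.
exact: lebesgue_rV_fin.
Qed.

Let Moo : (m M < +oo)%E.
Proof. by rewrite -ge0_fin_numE//; exact: normalized_lebesgue_fin. Qed.

Let Boo i : (m (B i) < +oo)%E.
Proof. by rewrite -ge0_fin_numE//; exact: normalized_lebesgue_fin. Qed.

Let m_disjoint i j : i != j -> m (B i `&` B j) = 0%E.
Proof.
by move=> ij; rewrite /normalized_lebesgue /mscale/= (cell_disjoint partB ij) mule0.
Qed.

Let m_cover : m (M `\` \bigcup_i B i) = 0%E.
Proof. by rewrite /normalized_lebesgue /mscale/= (cell_cover partB) mule0. Qed.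

Lemma volume_gt0 i : 0 < volume M B i.
Proof.
have B0 := cell_volume partB i.
have fB := lebesgue_rV_fin (@cB i); have fM := lebesgue_rV_fin cM.
have M0 : (0 < lebesgue_rV R k.+1 M)%E.
  by rewrite (lt_le_trans B0)// le_measure ?inE.
rewrite /volume /normalized_lebesgue /mscale/= fineM// mulr_gt0//.
  by rewrite invr_gt0 -lte_fin fineK.
by rewrite -lte_fin fineK.
Qed.

Lemma flow_image t (X : set V) : X `<=` M ->
  Phi (- t) @` X = [set x | M x /\ X (Phi t x)].
Proof.
move=> XM; apply/seteqP; split=> [_ [y Xy <-]|x [Mx Xx]] /=.
  have My := XM _ Xy; split; first exact: (flow_in flowP).
  by rewrite -(flowD flowP)// subrr (flow0 flowP).
by exists (Phi t x) => //; rewrite -(flowD flowP)// addNr (flow0 flowP).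
Qed.

(** The defining property of the transfer operator, applied to a cell, turns
    the integral into volumes of sets of points that start in one cell and end
    in another. *)
Lemma transfer_step (v : 'rV[R]_n) l t : `|t| <= flow_time L ->
  \int[m]_(x in B l) P t (step_fun B v) x = \sum_i v 0 i * q i l t.
Proof.
move=> tL.
have istep := integrable_step (m := m) mB (fun i => v 0 i) mM Moo.
have [_ PE] := transferP t istep.
rewrite (PE _ (mB l) (@BM l)) flow_image//.
have cX := compact_flow_preimage flowP L0 F_le F_lip cM (@cB l) tL.
have mX := compact_measurable_rV cX.
rewrite (Rintegral_step mB (fun i => v 0 i) mX); last first.
  by rewrite -ge0_fin_numE//; exact: normalized_lebesgue_fin.
apply: eq_bigr => i _; congr (_ * fine (m _)).
by apply/seteqP; split=> x; [move=> [Bx [_ ?]]|move=> [Bx ?]]; split=> //; split=> //; exact: BM Bx.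
Qed.

(** Conservation of mass: the flow maps M onto itself, so the transfer
    operator preserves the integral over M, which is the sum of the integrals
    over the cells. *)
Lemma crossing_total i t : `|t| <= flow_time L -> \sum_l q i l t = volume M B i.
Proof.
move=> tL; pose f := step_fun B (delta_mx 0 i).
have ifM := integrable_step (m := m) mB (fun j => (delta_mx 0 i : 'rV[R]_n) 0 j) mM Moo.
have [iP PE] := transferP t ifM.
have deltaE (a : 'I_n -> R) : \sum_j (delta_mx 0 i : 'rV[R]_n) 0 j * a j = a i.
  rewrite (bigD1 i)//= big1 ?addr0 ?mxE ?eqxx ?mul1r// => j ji.
  by rewrite mxE (negbTE ji) andbF mul0r.
transitivity (\sum_l \int[m]_(x in B l) P t f x).
  by apply: eq_bigr => l _; rewrite transfer_step// deltaE.
rewrite -(Rintegral_cells mB mM BM m_disjoint m_cover iP) PE// flow_image//.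
rewrite (_ : [set x | _] = M); last first.
  by apply/seteqP; split=> [x []//|x Mx]; split=> //; exact: (flow_in flowP).
rewrite (Rintegral_step mB _ mM Moo) deltaE /volume.
by congr (fine (m _)); exact/setIidl/BM.
Qed.

Lemma projection_step (v : 'rV[R]_n) : projection M B (step_fun B v) = step_fun B v.
Proof.
apply/funext => x; apply: eq_bigr => i _; congr (_ * _).
rewrite (Rintegral_step mB (fun i => v 0 i) (mB i) (Boo i)) (bigD1 i)//= big1 ?addr0.
  by rewrite setIid -/(volume M B i) mulrC mulfK// gt_eqF// volume_gt0.
by move=> j ji; rewrite m_disjoint// mulr0.
Qed.

(** The coefficient of the indicator of cell l in the difference quotient
    minus its expected limit. *)
Let growth (v : 'rV[R]_n) l t :=
  ((volume M B l)^-1 * (\sum_i v 0 i * q i l t) - v 0 l) / t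
    - (v *m rate_matrix M B F) 0 l.

Lemma crossing_rate i j : i != j -> q i j t / t @[t --> 0^'+] --> outflow M B F i j.
Proof.
have /choice[s sP] i' : exists s, B i' = M `&` polyset s.
  by have [S [s ->] ->] := cell_polyhedral partB i'; exists s.
apply: (crossing_limit flowP C0 L0 F_le F_lip cM sP).
- exact: (cell_regular partB).
- exact: (cell_disjoint partB).
- exact: (cell_faces partB).
Qed.

(** For i = l, conservation of mass expresses the loss of a cell as the sum of
    what crosses into the other cells. *)
Lemma crossing_growth i l :
  ((volume M B l)^-1 * q i l t - (i == l)%:R) / t @[t --> 0^'+] --> rate_matrix M B F i l.
Proof.
rewrite mxE; have [->|il] /= := eqVneq i l; last first.
  under eq_fun do rewrite subr0 -mulrA.
  by apply: cvgMr; exact: crossing_rate.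
have lim : - (\sum_(j < n | j != l) (volume M B l)^-1 * (q l j t / t)) @[t --> 0^'+] -->
    - \sum_(j < n | j != l) (volume M B l)^-1 * outflow M B F l j.
  apply: cvgN; apply: cvg_big; first exact: add_continuous.
  by move=> j jl; apply: cvgMr; apply: crossing_rate; rewrite eq_sym.
rewrite (_ : \sum_(j < n | j != l) _ = \sum_(j < n | j != l) (volume M B l)^-1 * outflow M B F l j).
  apply: cvg_trans lim; apply: near_eq_cvg.
  apply: (near0_right (flow_time_gt0 L0)) => t /andP[t0 tL].
  have := @crossing_total l t; rewrite gtr0_norm// => /(_ tL).
  rewrite (bigD1 l)//= => /eqP; rewrite eq_sym -subr_eq => /eqP <-.
  rewrite mulrBr mulVf ?gt_eqF ?volume_gt0// addrC addrA addNr add0r mulNr.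
  by congr (- _); rewrite mulr_sumr mulr_suml; apply: eq_bigr => j _; rewrite mulrA.
apply: eq_bigr => j jl; rewrite /rate; field.
by rewrite !gt_eqF ?volume_gt0.
Qed.

Lemma growth_cvg v l : growth v l t @[t --> 0^'+] --> (0 : R).
Proof.
have lim : \sum_i v 0 i * (((volume M B l)^-1 * q i l t - (i == l)%:R) / t -
     rate_matrix M B F i l) @[t --> 0^'+] --> \sum_(i < n) v 0 i * (rate_matrix M B F i l - rate_matrix M B F i l).
  apply: cvg_big; first exact: add_continuous.
  by move=> i _; apply: cvgMr; apply: cvgB; [exact: crossing_growth|exact: cvg_cst].
rewrite [X in _ --> X](_ : 0 = \sum_(i < n) v 0 i * (rate_matrix M B F i l - rate_matrix M B F i l)); last first.
  by rewrite big1// => i _; rewrite subrr mulr0.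
apply: cvg_trans lim; apply: near_eq_cvg; near=> t.
rewrite /growth mxE mulr_sumr.
have -> : v 0 l = \sum_i v 0 i * (i == l)%:R.
  by rewrite (bigD1 l)//= eqxx mulr1 big1 ?addr0// => i /negbTE ->; rewrite mulr0.
rewrite -sumrB mulr_suml -sumrB; apply: eq_bigr => i _; ring.
Unshelve. all: by end_near. Qed.

(** The difference quotients and the limit all belong to the span of the
    indicators of the cells, so convergence of the coefficients implies
    convergence in L^1. *)
Lemma generator_limit : left_matrix_representation M B P (rate_matrix M B F).
Proof.
move=> v; split; first by exists (v *m rate_matrix M B F).
rewrite projection_step.
have bound : \forall t \near 0^'+, (0 <=
    \int[m]_(x in M) `|(projection M B (P t (step_fun B v)) x - step_fun B v x) / t -
       step_fun B (v *m rate_matrix M B F) x|%:E <=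
    ((\sum_l `|growth v l t|) * fine (m M))%:E)%E.
  apply: (near0_right (flow_time_gt0 L0)) => t /andP[t0 tL].
  have nt : `|t| <= flow_time L by rewrite gtr0_norm.
  rewrite integral_ge0//=.
  have E x : (projection M B (P t (step_fun B v)) x - step_fun B v x) / t -
       step_fun B (v *m rate_matrix M B F) x = \sum_l growth v l t * \1_(B l) x.
    rewrite /projection /step_fun -sumrB mulr_suml -sumrB; apply: eq_bigr => l _.
    by rewrite transfer_step// /growth; ring.
  under eq_integral do rewrite E.
  have iS := integrable_step (m := m) mB (fun l => growth v l t) mM Moo.
  apply: (@le_trans _ _ (\int[m]_(x in M) (\sum_l `|growth v l t|)%:E)%E).
    apply: ge0_le_integral => //.
    - by move: iS => /measurable_int/measurable_EFinP h; apply/measurable_EFinP; exact: measurableT_comp.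
    - move=> x _; rewrite lee_fin (le_trans (ler_norm_sum _ _ _))// ler_sum// => l _.
      by rewrite normrM ler_piMr// indicE; case: (x \in _); rewrite ?normr1 ?normr0.
  by rewrite integral_cst// EFinM fineK// normalized_lebesgue_fin.
apply: (squeeze_cvge bound); first exact: cvg_cst.
apply: cvg_EFin; first by near=> t.
rewrite -[X in _ --> X](mul0r (fine (m M))).
apply: cvgMl.
rewrite [X in _ --> X](_ : 0 = \sum_(l < n) `|0 : R|); last by rewrite normr0 big1.
apply: cvg_big; first exact: add_continuous.
by move=> l _; apply: cvg_norm; exact: growth_cvg.
Unshelve. all: by end_near. Qed.

End generator_limit.

Theorem lemma4p4 (R : realType) (k n : nat) (M : set 'rV[R]_k.+1)
    (F : 'rV[R]_k.+1 -> 'rV[R]_k.+1)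
    (Phi : R -> 'rV[R]_k.+1 -> 'rV[R]_k.+1)
    (P : R -> ('rV[R]_k.+1 -> R) -> ('rV[R]_k.+1 -> R))
    (B : 'I_n -> set 'rV[R]_k.+1) :
  compact M ->
  smooth_near M F ->
  is_flow M F Phi ->
  is_transfer_operator M Phi P ->
  polyhedral_partition M B ->
  left_matrix_representation M B P (rate_matrix M B F).
Proof.
move=> cM sF flowP transferP partB.
have [C C0 F_le] := smooth_near_bounded cM sF.
have [L L0 F_lip] := smooth_near_lipschitz cM sF.
exact: (generator_limit flowP C0 L0 F_le F_lip cM transferP partB).
Qed.
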